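(* Let $Y$ be a general diffusion in natural scale with state space $I$, interior $I^\circ=(l,r)$, speed measure $m$ and absorbing accessible boundary points (as specified in the context). For $h\in(0,\bar h)$ let $\widehat a_h(l)=\widehat a_h(r)=0$ and, for $y\in I^\circ$, $$\widehat a_h(y)=\sup\left\{a\ge0:\ y\pm a\in I\ \text{ and }\ \frac12\int_{(y-a,y+a)}(a-|z-y|)\,m(dz)\le h\right\}.$$ Let $(\widehat X^{h,y}_t)_{t\in[0,\infty)}$ be the associated linearly interpolated Markov chains started in $y$ with scale factors $\widehat a_h$ (the EMCEL approximations). Then for every $y\in I^\circ$ the distributions of $(\widehat X^{h,y}_t)_{t\in[0,\infty)}$ under $P$ converge weakly to the distribution of $(Y_t)_{t\in[0,\infty)}$ under $P_y$ as $h\to0$.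
   Context: General diffusion: $I\subseteq\mathbb R$ is an open, half-open or closed interval with interior $I^\circ=(l,r)$, $-\infty\le l<r\le\infty$, and $\bar I=[l,r]$. $(\Omega,\mathcal F,(\mathcal F_t)_{t\ge0},(P_y)_{y\in I},(Y_t)_{t\ge0})$ is a one-dimensional continuous strong Markov process with state space $I$ and $P_y[Y_0=y]=1$ for $y\in I$ (in the sense of Revuz–Yor, Section VII.3). For $x\in\bar I$ let $H_x=\inf\{t\ge0:Y_t=x\}$ and $H_{a,b}=H_a\wedge H_b$. $Y$ is regular: $P_y[H_x<\infty]>0$ for all $y\in I^\circ$, $x\in I$. $Y$ is in natural scale: $P_y[H_b<H_a]=\frac{y-a}{b-a}$ for $a<y<b$, $a,b\in I$. A boundary point is accessible if and only if it belongs to $I$, and every accessible boundary point is absorbing. The speed measure $m$ satisfies $0<m([a,b])<\infty$ for all $a<b$ in $I^\circ$ and is normalized so that $E_y[H_{a,b}]=\int_{(a,b)}\frac{(b-y\vee u)(y\wedge u-a)}{b-a}\,m(du)$ for all $a<b$ in $I$ and $y\in[a,b]$ (so Brownian motion has speed measure $2\,dx$). $\bar h\in(0,\infty)$ is fixed. Associated processes: let $(\xi_k)_{k\in\mathbb N}$ be iid on a probability space with measure $P$, $P(\xi_k=\pm1)=\frac12$. For $y\in I^\circ$, $h\in(0,\bar h)$ set $\widehat X^{h,y}_0=y$, $\widehat X^{h,y}_{(k+1)h}=\widehat X^{h,y}_{kh}+\widehat a_h(\widehat X^{h,y}_{kh})\xi_{k+1}$ for $k\in\mathbb N_0$, and extend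 by linear interpolation: $\widehat X^{h,y}_t=\widehat X^{h,y}_{\lfloor t/h\rfloor h}+(t/h-\lfloor t/h\rfloor)\bigl(\widehat X^{h,y}_{(\lfloor t/h\rfloor+1)h}-\widehat X^{h,y}_{\lfloor t/h\rfloor h}\bigr)$, $t\in[0,\infty)$. Weak convergence is in $C([0,\infty),\mathbb R)$ with the topology of uniform convergence on compact intervals. *)

(* Defs.v *)
From HB Require Import structures.
From mathcomp Require Import all_boot all_order all_algebra.
From mathcomp Require Import all_classical all_reals all_analysis.
From mathcomp Require Import measurable_realfun.

Set Implicit Arguments.
Unset Strict Implicit.
Unset Printing Implicit Defensive.

Import Order.TTheory GRing.Theory Num.Theory.
Import numFieldNormedType.Exports.

Local Open Scope classical_set_scope.
Local Open Scope ring_scope.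

(* [0, +oo[ with the topology induced by the real line *)
Definition time (R : realType) : Type := {nonneg R}.
HB.instance Definition _ (R : realType) := Choice.on (time R).
HB.instance Definition _ (R : realType) :=
  Topological.copy (time R)
    (initial_topology (fun t : {nonneg R} => t%:num : R)).

(* C([0, +oo[, R) with the topology of uniform convergence on compact sets *)
Definition cpath (R : realType) : Type := continuousType (time R) R.
HB.instance Definition _ (R : realType) := Choice.on (cpath R).
HB.instance Definition _ (R : realType) :=
  Topological.copy (cpath R)
    (initial_topology (fun f : continuousType (time R) R =>
       (f : time R -> R) : {family compact, time R -> R})).

Definition ev (R : realType) (f : cpath R) (t : time R) : R :=
  (f : continuousType (time R) R) t.

Definition mkpath (R : realType) (f : time R -> R) (cf : continuous f) :
  cpath R := mkcts cf.

Section paths.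
Context {R : realType}.

Lemma time_num_continuous : continuous (fun t : time R => t%:num : R).
Proof. exact: initial_continuous. Qed.

Lemma ev_continuous (f : cpath R) : continuous (ev f).
Proof. exact: cts_fun. Qed.

Lemma evE (f : time R -> R) (cf : continuous f) : ev (mkpath cf) = f.
Proof. by []. Qed.

Definition tadd (s t : time R) : time R := (s%:num + t%:num)%:nng.

Lemma shift_continuous (s : time R) (f : cpath R) :
  continuous (fun t => ev f (tadd s t)).
Proof.
have nc : continuous (fun t : time R => s%:num + t%:num : R).
  move=> u; apply: (@cvgD _ _ _ (nbhs u) _ (cst s%:num) (fun t : time R => t%:num)).
    exact: cvg_cst.
  exact: time_num_continuous.
have tc : continuous (tadd s : time R -> time R).
  exact: (@continuous_comp_initial _ _ _ (fun t : {nonneg R} => t%:num : R)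
    (tadd s : time R -> initial_topology (fun t : {nonneg R} => t%:num : R))).
by move=> t; apply: (@continuous_comp _ _ _ (tadd s) (ev f));
  [exact: tc | exact: ev_continuous].
Qed.

Definition shift (s : time R) (f : cpath R) : cpath R :=
  mkpath (@shift_continuous s f).

(* linear interpolation of x 0, x 1, x 2, ... placed at the nodes 0, h, 2h, ... *)
Definition interp (x : nat -> R) (h t : R) : R :=
  let k := Num.truncn (t / h) in
  x k + (t / h - k%:R) * (x k.+1 - x k).

(* closed form of the interpolation before time n.+1, used only for continuity *)
Fixpoint pl (x : nat -> R) (n : nat) (s : R) : R :=
  if n is k.+1 then
    pl x k (Num.min s k.+1%:R) + Num.max (s - k.+1%:R) 0 * (x k.+2 - x k.+1)
  else x 0%N + s * (x 1%N - x 0%N).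

Lemma pl_continuous (x : nat -> R) (n : nat) : continuous (pl x n).
Proof.
elim: n => [|n IH] s /=.
  apply: (@cvgD _ _ _ (nbhs s) _ (cst (x 0%N)) (fun u => u * (x 1%N - x 0%N))).
    exact: cvg_cst.
  by apply: cvgMr_tmp; exact: cvg_id.
apply: (@cvgD _ _ _ (nbhs s) _ (fun u => pl x n (Num.min u n.+1%:R))
  (fun u => Num.max (u - n.+1%:R) 0 * (x n.+2 - x n.+1))).
  apply: (@cvg_comp _ _ _ (fun u => Num.min u n.+1%:R) (pl x n) (nbhs s) _ _ _
    (IH _)).
  by apply: (@continuous_min _ _ id (cst n.+1%:R) s);
    [exact: cvg_id | exact: cvg_cst].
have c1 : {for s, continuous (fun u : R => u - n.+1%:R : R^o)}.
  by apply: (@cvgB _ _ _ (nbhs s) _ id (cst n.+1%:R));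
    [exact: cvg_id | exact: cvg_cst].
have c2 : {for s, continuous (cst (0 : R^o) : R -> R^o)} by exact: cvg_cst.
have mx2 : (Num.max (u - n.+1%:R) 0 : R) @[u --> s] --> (Num.max (s - n.+1%:R) 0 : R).
  exact: (continuous_max c1 c2).
exact: (cvgMr_tmp mx2).
Qed.

Lemma pl_node (x : nat -> R) (n : nat) : pl x n n.+1%:R = x n.+1.
Proof.
elim: n => [|n IH] /=; first by rewrite mul1r addrC subrK.
rewrite min_r ?ler_nat// IH -natrB// subSnn max_l ?ler01//.
by rewrite mul1r addrC subrK.
Qed.

Lemma pl_interp (x : nat -> R) (n : nat) (s : R) : s < n.+1%:R ->
  x (Num.truncn s) + (s - (Num.truncn s)%:R) *
    (x (Num.truncn s).+1 - x (Num.truncn s)) = pl x n s.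
Proof.
elim: n => [|n IH] /= sn.
  have -> : Num.truncn s = 0%N by apply/eqP; rewrite -leqn0 truncn_le_nat.
  by rewrite subr0.
have [sn1|ns] := ltP s n.+1%:R.
  by rewrite IH// max_r ?subr_le0 ?(ltW sn1)// mul0r addr0.
rewrite pl_node max_l ?subr_ge0//.
suff -> : Num.truncn s = n.+1 by [].
by apply: truncn_def; rewrite ns sn.
Qed.

Lemma interp_continuous (x : nat -> R) (h : R) :
  continuous (fun t : time R => interp x h t%:num).
Proof.
have ic : continuous (fun s : R => x (Num.truncn s) + (s - (Num.truncn s)%:R) *
    (x (Num.truncn s).+1 - x (Num.truncn s))).
  move=> s; set n := Num.truncn s.
  have sn : s < n.+1%:R by exact: truncnS_gt.
  have e : {near s, pl x n =1 (fun s : R => x (Num.truncn s) +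
     (s - (Num.truncn s)%:R) * (x (Num.truncn s).+1 - x (Num.truncn s)))}.
    near=> u; apply/esym/pl_interp.
    by near: u; exact: lt_nbhsl.
  rewrite /continuous_at.
  rewrite -(nbhs_singleton e).
  apply: cvg_trans (pl_continuous (x := x) (n := n) (x0 := s)).
  exact: near_eq_cvg.
move=> t; apply: (@continuous_comp _ _ _ (fun t : time R => t%:num / h : R)
  (fun s : R => x (Num.truncn s) + (s - (Num.truncn s)%:R) *
    (x (Num.truncn s).+1 - x (Num.truncn s)))); last exact: ic.
exact: (cvgMr_tmp (@time_num_continuous t)).
Unshelve. all: by end_near. Qed.

End paths.

(* The chain at times 0, h, 2h, ...; the sign xi k drives the step from kh to
   (k+1)h, so that xi k stands for the (k+1)-st variable of the sequence. *)
Fixpoint chain (R : realType) (a : R -> R) (xi : nat -> R) (y : R) (k : nat) : R :=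
  if k is j.+1 then chain a xi y j + a (chain a xi y j) * xi j else y.

Definition chain_path (R : realType) (a : R -> R) (xi : nat -> R) (h y : R) :
  cpath R := mkpath (@interp_continuous R (chain a xi y) h).

Local Open Scope ereal_scope.

(* the value 0 off the interior of I covers both boundary points l and r *)
Definition emcel (R : realType) (I : set R) (m : {measure set R -> \bar R})
    (h y : R) : R :=
  if `[< I° y >] then
    sup [set a : R | (0 <= a)%R /\ I (y - a)%R /\ I (y + a)%R /\
      (2^-1)%:E * \int[m]_(z in `](y - a)%R, (y + a)%R[) (a - `|z - y|)%:E <= h%:E]
  else 0%R.

Definition iid_signs d (Omega : measurableType d) (R : realType)
    (Pr : probability Omega R) (xi : nat -> {RV Pr >-> R}) : Prop :=
  (forall k, Pr [set w | xi k w = 1%R] = (2^-1)%:E /\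
             Pr [set w | xi k w = (-1)%R] = (2^-1)%:E) /\
  (forall (s : seq nat) (B : nat -> set R), uniq s ->
     (forall k, measurable (B k)) ->
     Pr (\bigcap_(k in [set` s]) xi k @^-1` B k) =
     \prod_(k <- s) Pr (xi k @^-1` B k)).

(* Paths are measurable for the cylinder sigma-algebra, which is the Borel one of
   this separable metrizable space, so the expectations below are genuine.
   Weak convergence in C([0, +oo[, R) of the laws of X i under Pr, along the
   filter G, to the law of Y under Q *)
Definition cvg_in_law (R : realType) d d' (Omega : measurableType d)
    (Omega' : measurableType d') (T : Type) (G : set_system T)
    (Pr : probability Omega R) (X : T -> Omega -> cpath R)
    (Q : probability Omega' R) (Y : Omega' -> cpath R) : Prop :=
  forall phi : cpath R -> R, continuous phi ->
    (exists M : R, forall f, (`|phi f| <= M)%R) ->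
    'E_Pr[phi \o X i] @[i --> G] --> 'E_Q[phi \o Y].

Section diffusion.
Context {R : realType} {d : measure_display} {Omega : measurableType d}.
Variables (I : set R) (l r : \bar R).
Variables (F : time R -> set_system Omega) (P : R -> probability Omega R).
Variables (Y : Omega -> cpath R) (m : {measure set R -> \bar R}).

Definition state_space : Prop :=
  [/\ l < r, is_interval I & I° = [set x | l < x%:E < r]].

Definition filtration : Prop :=
  [/\ forall t, sigma_algebra setT (F t),
      forall t, F t `<=` measurable
    & forall s t : time R, (s%:num <= t%:num)%R -> F s `<=` F t].

Definition adapted : Prop :=
  forall t (B : set R), measurable B -> F t [set w | B (ev (Y w) t)].

Definition stopping_time (tau : Omega -> \bar R) : Prop :=
  (forall w, 0 <= tau w) /\
  forall t : time R, F t [set w | tau w <= t%:num%:E].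

Definition stopped_sigma (tau : Omega -> \bar R) : set_system Omega :=
  [set A | measurable A /\
    forall t : time R, F t (A `&` [set w | tau w <= t%:num%:E])].

Definition cylinder_sigma : set_system (cpath R) :=
  <<s [set [set f : cpath R | B (ev f t)] | t in setT & B in measurable] >>.

(* the absolute value only casts a finite value of tau to the type of times *)
Definition at_time (tau : Omega -> \bar R) (w : Omega) : time R :=
  `|fine (tau w)|%:nng%R.

Definition strong_markov : Prop :=
  forall (y : R) (tau : Omega -> \bar R) (A : set Omega) (B : set (cpath R)),
    I y -> stopping_time tau -> stopped_sigma tau A -> cylinder_sigma B ->
    P y (A `&` [set w | tau w < +oo /\ B (shift (at_time tau w) (Y w))]) =
    \int[P y]_(w in A `&` [set w | tau w < +oo])
      P (ev (Y w) (at_time tau w)) (Y @^-1` B).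

Definition hit (x : \bar R) (w : Omega) : \bar R :=
  ereal_inf [set t%:num%:E | t in [set t : time R | (ev (Y w) t)%:E = x]].

Definition accessible (x : \bar R) : Prop :=
  exists2 y : R, I° y & 0 < P y [set w | hit x w < +oo].

(* The values of m off the interior of I are never used: all the integrals
   below and in [emcel] are over open intervals with end points in I. *)
Record general_diffusion : Prop := GeneralDiffusion {
  gd_state_space : state_space ;
  gd_filtration : filtration ;
  gd_adapted : adapted ;
  gd_state : forall w t, I (ev (Y w) t) ;
  gd_start : forall y, I y -> P y [set w | ev (Y w) 0%:nng%R = y] = 1 ;
  gd_kernel : forall B, cylinder_sigma B ->
    measurable_fun I (fun y : R => P y (Y @^-1` B)) ;
  gd_strong_markov : strong_markov ;
  gd_regular : forall y x : R, I° y -> I x -> 0 < P y [set w | hit x%:E w < +oo] ;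
  gd_natural_scale : forall a y b : R, I a -> I b -> (a < y < b)%R ->
    P y [set w | hit b%:E w < hit a%:E w] = ((y - a) / (b - a))%:E ;
  gd_accessible : forall x, x = l \/ x = r ->
    (accessible x <-> exists2 x', I x' & x'%:E = x) ;
  gd_absorbing : forall x, I x -> x%:E = l \/ x%:E = r ->
    P x [set w | forall t, ev (Y w) t = x] = 1 ;
  gd_speed_pos : forall a b : R, I° a -> I° b -> (a < b)%R ->
    0 < m `[a, b]%classic < +oo ;
  gd_speed_exit : forall a b y : R, I a -> I b -> (a < b)%R -> (a <= y <= b)%R ->
    \int[P y]_w Order.min (hit a%:E w) (hit b%:E w) =
    \int[m]_(u in `]a, b[)
      ((b - Num.max y u) * (Num.min y u - a) / (b - a))%:E
}.

End diffusion.

(* Main.v *)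
From HB Require Import structures.
Require Import Defs.
From mathcomp Require Import all_boot all_order all_algebra.
From mathcomp Require Import all_classical all_reals all_analysis.
From mathcomp Require Import measurable_realfun ring lra.

(** The chain is embedded in the diffusion. Fix h and write a for the scale
    factor [emcel I m h]. From x, let Y run until it leaves (x - a x, x + a x),
    record the exit point, and start again from there. In natural scale the two
    exit points are equally likely, and by the strong Markov property what
    happens after an exit depends on the past only through the exit point, so
    under P_y the successive exit points ([embedded]) have the law of the
    coin-tossing chain. Both laws are computed on finitely many steps as the
    same sum over a binary tree ([integral_embedded], [integral_chain_heads]);
    [expectation_embedded] passes to whole paths. It remains to show that the
    interpolated embedded chain is uniformly close to Y on [0, T] with high
    probability ([coupling]); weak convergence follows by dominated convergence
    ([expectation_cvg]).

    The mean exit time from (x - b, x + b), started at x, is half the integral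
    of the tent function of height b at x against m. Hence a x is the largest
    radius whose mean exit time is at most h, and this mean is equal to h,
    uniformly for x in a compact subset of the interior, once h is small
    ([emcel_good]). The n-th embedded point is the position of Y at the sum of
    the first n exit durations, so a weak law of large numbers is needed: this
    sum must be close to n h, simultaneously for all n with n h <= T. Monotonicity
    reduces simultaneity to finitely many n ([clock_grid]). For one n
    ([clock_dev]) two estimates are combined. From every starting point of an
    exit interval the mean exit time is at most 2 h, so the tail of a duration
    contracts by 2/k over each time k h and E (duration - k h)^+ <= 2 h / k
    ([tail_excess]); this gives a Laplace transform of about exp (- lam h) and a
    Chernoff bound against small sums ([clock_lower]). Large sums need no further
    estimate: the mean of the sum is at most n h, so the expected excess is at
    most the expected deficit.

    Near the boundary the mean duration may be smaller than h, and the law of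
    large numbers fails. There [clock] counts h instead of the duration. This is
    harmless because a path which leaves a large compact K of the interior before
    time M moves very little between this exit and M: almost surely it is absorbed
    when it meets a boundary point ([absorbing]), and by compactness of [0, M]
    it comes close to the boundary only at times close to its absorption
    ([exit_ok_ex]). Together with the modulus of continuity of the path on [0, M]
    this turns closeness of clocks into closeness of paths ([embedded_close]). *)

Set Implicit Arguments.
Unset Strict Implicit.
Unset Printing Implicit Defensive.

Import Order.TTheory GRing.Theory Num.Theory.
Import numFieldNormedType.Exports.

Local Open Scope classical_set_scope.
Local Open Scope ring_scope.

Local Notation shift := Defs.shift.

(** * Paths and hitting times *)

Section paths.
Context {R : realType}.
Implicit Types (f : cpath R) (s t : R).

(** A path as a function on the whole line, extended by symmetry, so that the
    lemmas on continuous real functions apply. *)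
Definition path_at f s : R := ev f `|s|%:nng.

Lemma evE_at f (t : time R) : ev f t = path_at f t%:num.
Proof. by congr (ev f _); apply/val_inj; rewrite /= ger0_norm. Qed.

Lemma at_continuous f : continuous (path_at f).
Proof.
have tc : continuous ((fun s : R => `|s|%:nng) : R -> time R).
  apply: (@continuous_comp_initial _ _ _ (fun t : {nonneg R} => t%:num : R)
    ((fun s : R => `|s|%:nng) : R -> initial_topology (fun t : {nonneg R} => t%:num : R))).
  by move=> s; exact: norm_continuous.
by move=> s; apply: (@continuous_comp _ _ _ ((fun s : R => `|s|%:nng) : R -> time R) (ev f));
  [exact: tc | exact: ev_continuous].
Qed.

Lemma at_shift f (t : time R) s : path_at (shift t f) s = path_at f (t%:num + `|s|).
Proof.
rewrite /path_at /shift evE; congr (ev f _); apply/val_inj => /=.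
by rewrite [RHS]ger0_norm// addr_ge0.
Qed.

(** [hit] as a functional of the path alone. *)
Definition hit_time (c : R) f : \bar R :=
  ereal_inf [set t%:num%:E | t in [set t : time R | (ev f t)%:E = c%:E]].

Lemma hit_time_ge0 c f : (0 <= hit_time c f)%E.
Proof. by apply: le_ereal_inf_tmp => _ [t _ <-]; rewrite lee_fin. Qed.

(** The infimum is attained. On [0, s + 1] the continuous function
    |f t - c| + (t - s)^+ has a minimum, and hits of c before s + eps for
    every eps force the minimum to be 0, that is, a hit of c before s. *)
Lemma hit_time_leP c f s :
  (hit_time c f <= s%:E)%E <-> exists2 t, 0 <= t <= s & path_at f t = c.
Proof.
split; last first.
  move=> [t /andP[t0 ts] ftc]; apply: (@le_trans _ _ t%:E); last by rewrite lee_fin.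
  apply: ereal_inf_lbound; exists `|t|%:nng; first by rewrite /= -ftc.
  by rewrite /= ger0_norm.
move=> hs.
have s0 : 0 <= s by rewrite -lee_fin; exact: le_trans (hit_time_ge0 c f) hs.
pose g t := `|path_at f t - c| + Num.max (t - s) 0.
have gc : continuous g.
  move=> t; rewrite /g; apply: (@cvgD _ _ _ (nbhs t) _ (fun t => `|path_at f t - c|)
    (fun t => Num.max (t - s) 0)).
    apply: cvg_norm; apply: cvgB; [exact: at_continuous | exact: cvg_cst].
  have c1 : {for t, continuous (fun u : R => u - s : R^o)}.
    by apply: (@cvgB _ _ _ (nbhs t) _ id (cst s)); [exact: cvg_id | exact: cvg_cst].
  have c2 : {for t, continuous (cst (0 : R^o) : R -> R^o)} by exact: cvg_cst.
  exact: (continuous_max c1 c2).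
have [|t] := @EVT_min R g 0 (s + 1) _ (continuous_subspaceT gc); first lra.
rewrite in_itv/= => /andP[t0 t1] tmin.
have g0 : g t <= 0.
  apply/ler_addgt0Pl => e e0; rewrite addr0.
  have : (hit_time c f < (s + Num.min e 1)%:E)%E.
    by apply: le_lt_trans hs _; rewrite lte_fin ltrDl lt_min e0 ltr01.
  move=> /ereal_inf_lt[_ [u /= fu <-]]; rewrite lte_fin => us.
  have {}fu : path_at f u%:num = c by rewrite -evE_at; case: fu.
  apply: (@le_trans _ _ (g u%:num)).
    apply: tmin; rewrite in_itv/= ge0//=; apply: le_trans (ltW us) _.
    by rewrite lerD2l ge_min lexx orbT.
  rewrite /g fu subrr normr0 add0r ge_max (ltW e0) andbT lerBlDl.
  by apply: le_trans (ltW us) _; rewrite lerD2l ge_min lexx.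
have : `|path_at f t - c| = 0 /\ Num.max (t - s) 0 = 0.
  have : 0 <= `|path_at f t - c| by [].
  have : 0 <= Num.max (t - s) 0 by rewrite le_max lexx orbT.
  by move: g0; rewrite /g => *; split; lra.
move=> [/eqP]; rewrite normr_eq0 subr_eq0 => /eqP fc ts; exists t => //.
by rewrite t0/= -subr_le0 -ts le_max lexx.
Qed.

Lemma at_hit_time c f : (hit_time c f < +oo)%E -> path_at f (fine (hit_time c f)) = c.
Proof.
move=> h; have hf : hit_time c f \is a fin_num.
  by rewrite ge0_fin_numE// hit_time_ge0.
have : (hit_time c f <= (fine (hit_time c f))%:E)%E by rewrite fineK.
move=> /hit_time_leP[t /andP[t0 th] ftc].
suff <- : t = fine (hit_time c f) by [].
apply/eqP; rewrite eq_le th/=.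
rewrite -lee_fin fineK//; apply/hit_time_leP; exists t => //.
by rewrite t0 lexx.
Qed.

Lemma hit_time_le c f t : 0 <= t -> path_at f t = c -> (hit_time c f <= t%:E)%E.
Proof. by move=> t0 ft; apply/hit_time_leP; exists t; rewrite ?t0 ?lexx. Qed.

Lemma hit_time_start f : hit_time (path_at f 0) f = 0%E.
Proof. by apply/eqP; rewrite eq_le hit_time_ge0 andbT; apply: hit_time_le. Qed.

Definition grid_floor (n : nat) s : R := (Num.truncn (s * n.+1%:R))%:R / n.+1%:R.

Lemma grid_floor_le n s : 0 <= s -> grid_floor n s <= s.
Proof.
by move=> s0; rewrite /grid_floor ler_pdivrMr// -truncn_ge_nat// mulr_ge0.
Qed.

Lemma grid_floor_homo n s t : s <= t -> grid_floor n s <= grid_floor n t.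
Proof.
by move=> st; rewrite /grid_floor ler_pM2r ?invr_gt0// ler_nat le_truncn// ler_pM2r.
Qed.

Lemma grid_floor_dist n s : 0 <= s -> `|s - grid_floor n s| <= n.+1%:R^-1.
Proof.
move=> s0; rewrite ger0_norm ?subr_ge0 ?grid_floor_le// lerBlDr /grid_floor.
rewrite [leRHS](_ : _ = (Num.truncn (s * n.+1%:R)).+1%:R / n.+1%:R).
  by rewrite ler_pdivlMr// ltW// truncnS_gt.
by rewrite -[in RHS]natr1 mulrDl mul1r addrC.
Qed.

Lemma grid_floor_cvg s : 0 <= s -> (fun n => grid_floor n s) @ \oo --> s.
Proof.
move=> s0; apply/cvgrPdist_le => e e0.
have := @near_infty_natSinv_lt R (PosNum e0); apply: filterS => n /= ne.
exact: le_trans (grid_floor_dist _ s0) (ltW ne).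
Qed.

Lemma at_grid_floor_cvg f s : 0 <= s -> (fun n => path_at f (grid_floor n s)) @ \oo --> path_at f s.
Proof.
move=> s0; apply: (@cvg_comp _ _ _ (fun n => grid_floor n s) (path_at f) _ _ _ (grid_floor_cvg s0)).
exact: at_continuous.
Qed.

(** By compactness of [0, s], the value c is attained up to time s if and only if
    it is approached along rational times; the right-hand side is a countable
    combination of cylinder conditions, whence the measurability below. *)
Lemma hit_time_le_grid c f s : 0 <= s -> [set f | (hit_time c f <= s%:E)%E] f <->
  forall n : nat, exists i j : nat,
    (i%:R / j.+1%:R <= s) && (`|path_at f (i%:R / j.+1%:R) - c| < n.+1%:R^-1).
Proof.
move=> s0; split=> [/hit_time_leP[t /andP[t0 ts] ftc] n|H].
  have /cvgrPdist_lt/(_ n.+1%:R^-1) := at_grid_floor_cvg (f := f) t0.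
  rewrite invr_gt0 ltr0n => /(_ isT)[j _ /(_ j (leqnn j))] fj.
  exists (Num.truncn (t * j.+1%:R)), j; rewrite (le_trans (grid_floor_le _ t0))//=.
  by rewrite -ftc distrC.
have gc : continuous (fun t => `|path_at f t - c|).
  by move=> t; apply: cvg_norm; apply: cvgB; [exact: at_continuous | exact: cvg_cst].
have [t] := @EVT_min R _ 0 s s0 (continuous_subspaceT gc).
rewrite in_itv/= => t0s tmin.
apply/hit_time_leP; exists t => //; apply/eqP; rewrite -subr_eq0 -normr_le0.
apply/ler_addgt0Pl => e e0; rewrite addr0.
have [n _ /(_ n (leqnn n)) /= ne] := @near_infty_natSinv_lt R (PosNum e0).
have [i [j /andP[ijs fij]]] := H n.
apply: (le_trans _ (ltW ne)); apply: (le_trans _ (ltW fij)); apply: tmin.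
by rewrite in_itv/= divr_ge0.
Qed.

End paths.

Section meas.
Context {R : realType} {d : measure_display} {T : measurableType d}.
Variable (Z : T -> cpath R).

Lemma measurable_hit_time_le (c s : R) :
  (forall t, 0 <= t <= s -> measurable_fun setT (fun w => path_at (Z w) t)) ->
  measurable [set w | (hit_time c (Z w) <= s%:E)%E].
Proof.
move=> mZ; have [s0|s0] := leP 0 s; last first.
  suff -> : [set w | (hit_time c (Z w) <= s%:E)%E] = set0 by [].
  apply/seteqP; split => // w /= h.
  by move: s0; rewrite ltNge -lee_fin (le_trans (hit_time_ge0 c (Z w)) h).
have -> : [set w | (hit_time c (Z w) <= s%:E)%E] = \bigcap_n \bigcup_i \bigcup_j
   [set w | (i%:R / j.+1%:R <= s) && (`|path_at (Z w) (i%:R / j.+1%:R) - c| < n.+1%:R^-1)].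
  apply/seteqP; split => w /=.
    move=> /(hit_time_le_grid c (Z w) s0) H n _; have [i [j ij]] := H n.
    by exists i => //; exists j.
  move=> H; apply/(hit_time_le_grid c (Z w) s0) => n.
  by have [i _ [j _ ij]] := H n I; exists i, j.
apply: bigcapT_measurable => n; apply: bigcupT_measurable => i.
apply: bigcupT_measurable => j; have [ij|ij] := boolP (i%:R / j.+1%:R <= s); last first.
  by under eq_set do rewrite /=; rewrite [X in measurable X](_ : _ = set0)//; apply/seteqP; split.
rewrite -[X in measurable X]setTI.
apply: (@measurable_fun_ltr _ _ _ setT (fun w => `|path_at (Z w) (i%:R / j.+1%:R) - c|) (cst n.+1%:R^-1)) => //.
apply: measurableT_comp => //; apply: measurable_funB => //; apply: mZ.
by rewrite ij divr_ge0.
Qed.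

Hypothesis mZ : forall t, 0 <= t -> measurable_fun setT (fun w => path_at (Z w) t).

Lemma measurable_hit_time (c : R) : measurable_fun setT (fun w => hit_time c (Z w)).
Proof.
move=> _; apply: (measurability _ (ErealGenOInfty.measurableE R)) => //.
move=> _ [_ [s ->] <-]; rewrite setTI.
rewrite (_ : _ @^-1` _ = ~` [set w | (hit_time c (Z w) <= s%:E)%E]).
  apply: measurableC; apply: measurable_hit_time_le => t /andP[t0 _]; exact: mZ.
by apply/seteqP; split => w /=; rewrite in_itv/= andbT ltNge => /negP.
Qed.

Lemma measurable_at (tau : T -> R) : measurable_fun setT tau -> (forall w, 0 <= tau w) ->
  measurable_fun setT (fun w => path_at (Z w) (tau w)).
Proof.
move=> mtau tau0.
apply: (@measurable_fun_cvg _ _ _ setT (fun n w => path_at (Z w) (grid_floor n (tau w)))); last first.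
  by move=> w _; exact: at_grid_floor_cvg.
move=> n _ B mB; rewrite setTI.
rewrite (_ : _ @^-1` _ = \bigcup_k ([set w | Num.truncn (tau w * n.+1%:R) = k] `&`
   [set w | B (path_at (Z w) (k%:R / n.+1%:R))])).
  apply: bigcupT_measurable => k; apply: measurableI.
    have m1 : measurable_fun setT (fun w => tau w * n.+1%:R) by apply: measurable_funM.
    rewrite (_ : [set w | _] = [set w | k%:R <= tau w * n.+1%:R] `&` [set w | tau w * n.+1%:R < k.+1%:R]).
      apply: measurableI; rewrite -[X in measurable X]setTI.
        exact: measurable_fun_ler.
      exact: measurable_fun_ltr.
    apply/seteqP; split => w /=.
      have t0 : 0 <= tau w * n.+1%:R by rewrite mulr_ge0.
      by move=> <-; rewrite truncnS_gt; split => //; rewrite -truncn_ge_nat.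
    by move=> [h1 h2]; apply: truncn_def; rewrite h1 h2.
  rewrite -[X in measurable X]setTI; apply: mZ => //; by rewrite divr_ge0.
apply/seteqP; split => w /=; first by move=> h; exists (Num.truncn (tau w * n.+1%:R)).
by move=> [k _ [<-]].
Qed.

End meas.

Lemma cst_path_continuous (R : realType) (x : R) : continuous (cst x : time R -> R).
Proof. exact: cst_continuous. Qed.

HB.instance Definition _ (R : realType) :=
  isPointed.Build (cpath R) (mkpath (@cst_path_continuous R 0)).

Section cylinder.
Context {R : realType}.

Definition cylinder_gen : set_system (cpath R) :=
  [set [set f : cpath R | B (ev f t)] | t in setT & B in measurable].

(** Its measurable sets are those of [cylinder_sigma], the ones to which the
    kernel and the strong Markov property apply. *)
Definition wpath := g_sigma_algebraType cylinder_gen.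

Lemma measurable_at_path (t : R) : measurable_fun setT (fun f : wpath => path_at f t).
Proof.
move=> _ B mB; rewrite setTI; apply: sub_sigma_algebra.
by exists `|t|%:nng => //; exists B.
Qed.

Lemma measurable_to_path d (T : measurableType d) (Z : T -> cpath R) :
  (forall t, 0 <= t -> measurable_fun setT (fun w => path_at (Z w) t)) ->
  measurable_fun setT (Z : T -> wpath).
Proof.
move=> mZ; apply: (@measurability _ _ T wpath setT Z cylinder_gen) => //.
move=> _ [_ [t _ [B mB <-]] <-].
rewrite (_ : _ `&` _ = setT `&` ((fun w => path_at (Z w) t%:num) @^-1` B)).
  exact: mZ.
by apply/seteqP; split=> w /=; rewrite evE_at.
Qed.

Lemma measurable_shift d (T : measurableType d) (Z : T -> cpath R) (tau : T -> R) :
  (forall t, 0 <= t -> measurable_fun setT (fun w => path_at (Z w) t)) ->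
  measurable_fun setT tau ->
  measurable_fun setT ((fun w => shift `|tau w|%:nng (Z w)) : T -> wpath).
Proof.
move=> mZ mtau; apply: measurable_to_path => t t0.
under eq_fun do rewrite at_shift/=.
apply: measurable_at => //.
by apply: measurable_funD => //; exact: measurableT_comp.
Qed.

End cylinder.
Arguments wpath : clear implicits.

(** * The chain read along a path *)

Section embedding.
Context {R : realType}.
Variables (a : R -> R).
Implicit Types (x : R) (f : cpath R) (K : pred R).

Definition exit_time x f : \bar R := Order.min (hit_time (x - a x) f) (hit_time (x + a x) f).

Definition duration x f : R := fine (exit_time x f).

Definition after_exit x f : cpath R := shift `|duration x f|%:nng f.

Definition exit_point x f : R := if path_at f (duration x f) == x + a x then x + a x else x - a x.

Fixpoint embedded x f n : R :=
  if n is k.+1 then embedded (exit_point x f) (after_exit x f) k else x.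

(** With K everywhere true this is the time at which the path performs the n-th
    exit. A general K replaces by h the durations spent from points outside K,
    where the mean duration is not controlled from below. *)
Fixpoint clock (h : R) K n x f : R :=
  if n is k.+1 then
    (if K x then duration x f else h) + clock h K k (exit_point x f) (after_exit x f)
  else 0.

Fixpoint finite_exits n x f : bool :=
  if n is k.+1 then
    (exit_time x f < +oo)%E && finite_exits k (exit_point x f) (after_exit x f)
  else true.

Lemma exit_time_ge0 x f : (0 <= exit_time x f)%E.
Proof. by rewrite /exit_time le_min !hit_time_ge0. Qed.

Lemma duration_ge0 x f : 0 <= duration x f.
Proof. by rewrite fine_ge0// exit_time_ge0. Qed.

Lemma exit_time_fin x f : (exit_time x f < +oo)%E -> exit_time x f = (duration x f)%:E.
Proof. by move=> h; rewrite fineK// ge0_fin_numE// exit_time_ge0. Qed.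

Lemma at_after_exit x f t : path_at (after_exit x f) t = path_at f (duration x f + `|t|).
Proof. by rewrite at_shift/= ger0_norm// duration_ge0. Qed.

Lemma at_duration x f : (exit_time x f < +oo)%E ->
  path_at f (duration x f) = x + a x \/ path_at f (duration x f) = x - a x.
Proof.
rewrite /duration /exit_time minEle; case: ifP => _ h; first by right; exact: at_hit_time.
by left; exact: at_hit_time.
Qed.

Lemma exit_point_at x f : (exit_time x f < +oo)%E -> exit_point x f = path_at f (duration x f).
Proof.
move=> /at_duration; rewrite /exit_point => -[->|->]; first by rewrite eqxx.
by case: eqP.
Qed.

Lemma clock_ge0 h K n x f : 0 <= h -> 0 <= clock h K n x f.
Proof.
move=> h0; elim: n x f => //= n IH x f; rewrite addr_ge0//.
by case: ifP; rewrite ?duration_ge0.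
Qed.

Lemma clock_nd h K n k x f : 0 <= h -> (n <= k)%N -> clock h K n x f <= clock h K k x f.
Proof.
move=> h0; elim: n k x f => [|n IH] [|k] x f //= nk; last by rewrite lerD2l IH.
by rewrite addr_ge0 ?clock_ge0//; case: ifP; rewrite ?duration_ge0.
Qed.

Lemma embedded_at h n k x f : path_at f 0 = x -> finite_exits n x f -> (k <= n)%N ->
  embedded x f k = path_at f (clock h predT k x f).
Proof.
move=> f0; elim: n k x f f0 => [|n IH] [|k] x f f0 //= /andP[Tf fn] kn.
have sf0 : path_at (after_exit x f) 0 = exit_point x f by rewrite at_after_exit normr0 addr0 exit_point_at.
rewrite (IH k _ _ sf0 fn kn) at_after_exit ger0_norm//.
have : forall m y g, 0 <= clock h predT m y g; last exact.
by elim=> //= m IHm y g; rewrite addr_ge0 ?duration_ge0.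
Qed.

(** The modified clock is the true one until the chain visits a point outside K,
    say at step j. *)
Lemma clock_split h K k x f : clock h K k x f = clock h predT k x f \/
  exists2 j, (j < k)%N & clock h K j x f = clock h predT j x f /\ ~~ K (embedded x f j).
Proof.
elim: k x f => [|k IH] x f /=; first by left.
have [Kx|Kx] := boolP (K x); last by right; exists 0%N.
have [->|[j jk [ej Kj]]] := IH (exit_point x f) (after_exit x f); first by left.
by right; exists j.+1 => //=; rewrite Kx ej.
Qed.

Section measurability.
Notation W := (wpath R).

Lemma measurable_exit_time x : measurable_fun setT (exit_time x : W -> \bar R).
Proof.
apply: measurable_mine; apply: measurable_hit_time => t _; exact: measurable_at_path.
Qed.

Lemma measurable_duration x : measurable_fun setT (duration x : W -> R).
Proof. by apply: measurableT_comp => //; exact: measurable_exit_time. Qed.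

Lemma measurable_at_duration x : measurable_fun setT ((fun f => path_at f (duration x f)) : W -> R).
Proof.
apply: measurable_at => [t _||w]; last exact: duration_ge0.
  exact: measurable_at_path.
exact: measurable_duration.
Qed.

Lemma measurable_after_exit x : measurable_fun setT (after_exit x : W -> W).
Proof.
apply: measurable_shift; last exact: measurable_duration.
by move=> t _; exact: measurable_at_path.
Qed.

Lemma measurable_up x : measurable [set f : W | path_at f (duration x f) == x + a x].
Proof.
rewrite -[X in measurable X]setTI.
rewrite (_ : [set f : W | _] = ((fun f => path_at f (duration x f)) : W -> R) @^-1` [set x + a x]).
  by apply: measurable_at_duration.
by apply/seteqP; split => f /= /eqP.
Qed.

(** From the fixed point x the restart takes place at one of two points only, so
    a family G indexed by the starting point may depend on it in any way, and the
    scale factor a may be an arbitrary function. *)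
Lemma measurable_restart d (T : measurableType d) (G : R -> W -> T) x :
  (forall z, measurable_fun setT (G z)) ->
  measurable_fun setT ((fun f => G (exit_point x f) (after_exit x f)) : W -> T).
Proof.
move=> mG.
rewrite (_ : (fun _ => _) = (fun f : W => if path_at f (duration x f) == x + a x
   then G (x + a x) (after_exit x f) else G (x - a x) (after_exit x f))).
  apply: measurable_fun_ifT => /=.
  - apply: (@measurable_fun_bool _ W setT (fun f => path_at f (duration x f) == x + a x) true).
    by rewrite setTI; exact: measurable_up.
  - exact: (measurableT_comp (mG _) (measurable_after_exit x)).
  - exact: (measurableT_comp (mG _) (measurable_after_exit x)).
by apply/funext => f; rewrite /exit_point; case: ifP.
Qed.

Lemma measurable_clock h K n x : measurable_fun setT (clock h K n x : W -> R).
Proof.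
elim: n x => [|n IH] x //=.
apply: measurable_funD; first by case: (K x) => //; exact: measurable_duration.
exact: (measurable_restart (G := clock h K n)).
Qed.

Lemma measurable_finite_exits n x : measurable_fun setT (finite_exits n x : W -> bool).
Proof.
elim: n x => [|n IH] x //=.
apply: (@measurable_and _ _ setT (fun f : W => (exit_time x f < +oo)%E)
  (fun f : W => finite_exits n (exit_point x f) (after_exit x f))); last first.
  exact: (measurable_restart (G := finite_exits n)).
apply: (@measurable_fun_bool _ W setT (fun f => exit_time x f < +oo)%E true).
rewrite (_ : _ `&` _ = setT `&` (exit_time x @^-1` [set~ +oo%E])).
  by apply: measurable_exit_time => //; apply: measurableC; exact: emeasurable_set1.
apply/seteqP; split => f /= [_]; first by move=> h; split=> // e; rewrite e in h.
by move=> /eqP; rewrite -ltey.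
Qed.

End measurability.

End embedding.

(** * Regularity of a single path, as measurable events *)

Section regularity.
Context {R : realType}.
Implicit Types (f : cpath R).

Lemma cluster_pair (M : R) (s t : nat -> R) :
  (forall n, 0 <= s n <= M) -> (forall n, 0 <= t n <= M) ->
  exists s' t', [/\ 0 <= s' <= M, 0 <= t' <= M &
    forall e N, 0 < e -> exists2 n, (N <= n)%N & `|s' - s n| < e /\ `|t' - t n| < e].
Proof.
move=> sM tM.
have cM : compact (`[0, M] `*` `[0, M] : set (R * R)).
  by apply: compact_setX; exact: segment_compact.
have := cM ((fun n => (s n, t n)) @ \oo) _.
case.
  by exists 0%N => // n _; split; rewrite /= in_itv/=.
move=> [s' t'] [[/=]]; rewrite !in_itv/= => s'M t'M cl.
exists s', t'; split => // e N e0.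
have /= := cl [set p | exists2 n, (N <= n)%N & p = (s n, t n)] (ball (s', t') e).
case.
- by exists N => // n Nn; exists n.
- exact: nbhsx_ballx.
- by move=> _ [[n Nn ->] [/= b1 b2]]; exists n.
Qed.

Lemma at_dist_le f s t e :  0 <= s -> 0 <= t ->
  (\forall n \near \oo, `|path_at f (grid_floor n s) - path_at f (grid_floor n t)| <= e) ->
  `|path_at f s - path_at f t| <= e.
Proof.
move=> s0 t0 H.
have c : (fun n => `|path_at f (grid_floor n s) - path_at f (grid_floor n t)|) @ \oo --> `|path_at f s - path_at f t|.
  by apply: cvg_norm; apply: cvgB; exact: at_grid_floor_cvg.
rewrite -(cvg_lim _ c)//; apply: limr_le => //.
by apply/cvg_ex; eexists; exact: c.
Qed.

(** Quantifying over rational times makes this a measurable event; [mod_okP]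
    recovers all times by continuity. *)
Definition mod_ok (M delta e : R) : set (cpath R) :=
  [set f | forall i j n : nat, i%:R / n.+1%:R <= M -> j%:R / n.+1%:R <= M ->
    `|i%:R / n.+1%:R - j%:R / n.+1%:R| < delta ->
    `|path_at f (i%:R / n.+1%:R) - path_at f (j%:R / n.+1%:R)| <= e].

Lemma mod_okP M delta e f : mod_ok M delta e f ->
  forall s t, 0 <= s <= M -> 0 <= t <= M -> `|s - t| < delta ->
  `|path_at f s - path_at f t| <= e.
Proof.
move=> H s t /andP[s0 sM] /andP[t0 tM] st; apply: at_dist_le => //.
have c : (fun n => `|grid_floor n s - grid_floor n t|) @ \oo --> `|s - t|.
  by apply: cvg_norm; apply: cvgB; exact: grid_floor_cvg.
apply: (filterS _ (cvgr_lt _ c _ st)) => n stn.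
apply: (H (Num.truncn (s * n.+1%:R)) (Num.truncn (t * n.+1%:R)) n) stn.
  exact: le_trans (grid_floor_le _ s0) sM.
exact: le_trans (grid_floor_le _ t0) tM.
Qed.

Lemma mod_ok_ex M e f : 0 < e -> exists n : nat, mod_ok M n.+1%:R^-1 e f.
Proof.
move=> e0; apply: contrapT => /forallNP H.
have /choice[g Hg] : forall n : nat, exists p : R * R,
    [/\ 0 <= p.1 <= M, 0 <= p.2 <= M, `|p.1 - p.2| < n.+1%:R^-1 &
     e < `|path_at f p.1 - path_at f p.2|].
  move=> n; have := H n; move=> /existsNP[i] /existsNP[j] /existsNP[k].
  move=> /not_implyP[iM] /not_implyP[jM] /not_implyP[ij] /negP; rewrite -ltNge => eij.
  by exists (i%:R / k.+1%:R, j%:R / k.+1%:R); split => //=; rewrite ?iM ?jM ?andbT divr_ge0.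
have [] := @cluster_pair M (fun n => (g n).1) (fun n => (g n).2).
- by move=> n; case: (Hg n).
- by move=> n; case: (Hg n).
move=> s' [t' [s'M t'M cl]].
have s't' : s' = t'.
  apply/eqP; rewrite -subr_eq0 -normr_le0; apply/ler_addgt0Pl => u u0; rewrite addr0.
  have u3 : 0 < u / 3 by rewrite divr_gt0.
  have [N _ /(_ _ (leqnn N)) Nu] := @near_infty_natSinv_lt R (PosNum u3).
  have {}Nu : N.+1%:R^-1 < u / 3 := Nu.
  have [n Nn /= [sn tn]] := cl (u / 3) N u3.
  have [_ _ stn _] := Hg n.
  have : n.+1%:R^-1 <= N.+1%:R^-1 :> R by rewrite lef_pV2 ?posrE// ler_nat.
  move: sn tn stn Nu; set q := n.+1%:R^-1; set q1 := N.+1%:R^-1; rewrite !ltr_norml ler_norml.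
  move=> /andP[? ?] /andP[? ?] /andP[? ?] ? ?.
  by apply/andP; split; lra.
have e3 : 0 < e / 3 by rewrite divr_gt0.
have /cvgrPdist_lt/(_ _ e3)/nbhs_ballP[u u0 Hu] := @at_continuous _ f s'.
have [n _ /= [sn tn]] := cl u 0%N u0.
have := Hu _ sn; have := Hu (g n).2; rewrite {1}s't' => /(_ tn) /=.
have [_ _ _] := Hg n; rewrite lter_normr ltr_norml ltr_norml.
by case/orP => ? /andP[? ?] /andP[? ?]; lra.
Qed.

(** Again an event given by rational times, hence measurable; [exit_okP] recovers
    all times. *)
Definition exit_ok (k1 k2 M e : R) : set (cpath R) :=
  [set f | forall i j n : nat, i%:R / n.+1%:R <= j%:R / n.+1%:R :> R ->
    j%:R / n.+1%:R <= M -> ~~ (k1 <= path_at f (i%:R / n.+1%:R) <= k2) ->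
    `|path_at f (i%:R / n.+1%:R) - path_at f (j%:R / n.+1%:R)| <= e].

Lemma exit_okP k1 k2 M e f : exit_ok k1 k2 M e f ->
  forall s t, 0 <= s -> s <= t -> t <= M -> ~~ (k1 <= path_at f s <= k2) ->
  `|path_at f s - path_at f t| <= e.
Proof.
move=> H s t s0 st tM Ks; have t0 := le_trans s0 st; apply: at_dist_le => //.
have c := @at_grid_floor_cvg _ f s s0.
have {Ks} : \forall n \near \oo, ~~ (k1 <= path_at f (grid_floor n s) <= k2).
  move: Ks; rewrite negb_and -!ltNge => /orP[h|h].
    apply: (filterS _ (cvgr_lt _ c _ h)) => n; by rewrite negb_and -ltNge => ->.
  apply: (filterS _ (cvgr_gt _ c _ h)) => n; by rewrite negb_and -!ltNge => ->; rewrite orbT.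
apply: filterS => n Kn.
apply: (H (Num.truncn (s * n.+1%:R)) (Num.truncn (t * n.+1%:R)) n) Kn.
  exact: grid_floor_homo.
exact: le_trans (grid_floor_le _ t0) tM.
Qed.

(** If no compact interval works, there are exit times s_n <= t_n with
    |f s_n - f t_n| > e and f s_n outside [k1 n, k2 n]. At a cluster point (s, t)
    of these pairs f s is outside I, so f is constant after s and
    f s = f t, a contradiction. *)
Lemma exit_ok_ex (I : set R) (k1 k2 : nat -> R) M e f :
  (forall x, I x -> exists N, forall n, (N <= n)%N -> k1 n < x < k2 n) ->
  (forall n k, (n <= k)%N -> k1 k <= k1 n /\ k2 n <= k2 k) ->
  (forall s t, 0 <= s -> s <= t -> ~ I (path_at f s) -> path_at f t = path_at f s) ->
  0 < e -> exists n : nat, exit_ok (k1 n) (k2 n) M e f.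
Proof.
move=> kI kmono stopf e0; apply: contrapT => /forallNP H.
have /choice[g Hg] : forall n : nat, exists p : R * R,
    [/\ 0 <= p.1, p.1 <= p.2, p.2 <= M, ~~ (k1 n <= path_at f p.1 <= k2 n) &
     e < `|path_at f p.1 - path_at f p.2|].
  move=> n; have := H n; move=> /existsNP[i] /existsNP[j] /existsNP[k].
  move=> /not_implyP[ij] /not_implyP[jM] /not_implyP[Ki] /negP; rewrite -ltNge => eij.
  by exists (i%:R / k.+1%:R, j%:R / k.+1%:R); split => //=; rewrite divr_ge0.
have [] := @cluster_pair M (fun n => (g n).1) (fun n => (g n).2).
- by move=> n; case: (Hg n) => -> h /(le_trans h) ->.
- by move=> n; case: (Hg n) => h1 h2 -> _ _; rewrite (le_trans h1 h2).
move=> s' [t' [/andP[s'0 s'M] t'M cl]].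
have s't' : s' <= t'.
  apply/ler_addgt0Pl => u u0.
  have u2 : 0 < u / 2 by rewrite divr_gt0.
  have [n _ /= [sn tn]] := cl (u / 2) 0%N u2.
  have [_ stn _ _ _] := Hg n.
  by move: sn tn stn; rewrite !ltr_norml => /andP[? ?] /andP[? ?] ?; lra.
have nI : ~ I (path_at f s').
  move=> /kI[N HN]; have /andP[h1 h2] := HN _ (leqnn N).
  have u0 : 0 < Num.min (path_at f s' - k1 N) (k2 N - path_at f s').
    by rewrite lt_min !subr_gt0 h1 h2.
  have /cvgrPdist_lt/(_ _ u0)/nbhs_ballP[u v0 Hu] := @at_continuous _ f s'.
  have [n Nn /= [sn tn]] := cl u N v0.
  have /= := Hu _ sn; rewrite lt_min => /andP[].
  rewrite !ltr_norml => /andP[? ?] /andP[? ?].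
  have [k1n k2n] := kmono _ _ Nn.
  have [_ _ _ /negP + _] := Hg n; apply; apply/andP; split; lra.
have fs' := stopf _ _ s'0 s't' nI.
have e3 : 0 < e / 3 by rewrite divr_gt0.
have /cvgrPdist_lt/(_ _ e3)/nbhs_ballP[u u0 Hu] := @at_continuous _ f s'.
have /cvgrPdist_lt/(_ _ e3)/nbhs_ballP[v v0 Hv] := @at_continuous _ f t'.
have [|n _ /= [sn tn]] := cl (Num.min u v) 0%N; first by rewrite lt_min u0.
move: sn tn; rewrite !lt_min => /andP[sn _] /andP[_ tn].
have := Hu _ sn; have := Hv _ tn; rewrite /= fs'.
have [_ _ _ _] := Hg n; rewrite lter_normr ltr_norml ltr_norml.
by case/orP => ? /andP[? ?] /andP[? ?]; lra.
Qed.

Lemma mod_ok_nd M e d1 d2 : d1 <= d2 -> mod_ok M d2 e `<=` mod_ok M d1 e.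
Proof. by move=> d12 f H i j n iM jM ij; apply: H => //; exact: lt_le_trans ij _. Qed.

Lemma exit_ok_nd M e k1 k2 k1' k2' : k1' <= k1 -> k2 <= k2' ->
  exit_ok k1 k2 M e `<=` exit_ok k1' k2' M e.
Proof.
move=> h1 h2 f H i j n ij jM K; apply: H => //; apply: contra K => /andP[K1 K2].
by rewrite (le_trans h1 K1) (le_trans K2 h2).
Qed.

Lemma measurable_mod_ok M delta e : measurable (mod_ok M delta e : set (wpath R)).
Proof.
rewrite (_ : mod_ok M delta e = \bigcap_i \bigcap_j \bigcap_n
   [set f : cpath R | i%:R / n.+1%:R <= M -> j%:R / n.+1%:R <= M ->
    `|i%:R / n.+1%:R - j%:R / n.+1%:R| < delta ->
    `|path_at f (i%:R / n.+1%:R) - path_at f (j%:R / n.+1%:R)| <= e]); last first.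
  by apply/seteqP; split => f H => [i _ j _ n _|i j n]; [exact: H | exact: (H i I j I n I)].
apply: bigcapT_measurable => i; apply: bigcapT_measurable => j.
apply: bigcapT_measurable => n.
have [iM|iM] := pselect (i%:R / n.+1%:R <= M :> R); last first.
  by rewrite [X in measurable X](_ : _ = setT)//; apply/seteqP; split => f //= _ /iM.
have [jM|jM] := pselect (j%:R / n.+1%:R <= M :> R); last first.
  by rewrite [X in measurable X](_ : _ = setT)//; apply/seteqP; split => f //= _ _ /jM.
have [ij|ij] := pselect (`|i%:R / n.+1%:R - j%:R / n.+1%:R : R| < delta); last first.
  by rewrite [X in measurable X](_ : _ = setT)//; apply/seteqP; split => f //= _ _ _ /ij.
rewrite [X in measurable X](_ : _ =
  setT `&` [set f : wpath R | `|path_at f (i%:R / n.+1%:R) - path_at f (j%:R / n.+1%:R)| <= e]).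
  apply: measurable_fun_ler => //; apply: measurableT_comp => //.
  by apply: measurable_funB; exact: measurable_at_path.
by apply/seteqP; split => f /=; [move=> /(_ iM jM ij) | move=> [_]].
Qed.

Lemma measurable_exit_ok k1 k2 M e : measurable (exit_ok k1 k2 M e : set (wpath R)).
Proof.
rewrite (_ : exit_ok k1 k2 M e = \bigcap_i \bigcap_j \bigcap_n
   [set f : cpath R | i%:R / n.+1%:R <= j%:R / n.+1%:R :> R ->
    j%:R / n.+1%:R <= M -> ~~ (k1 <= path_at f (i%:R / n.+1%:R) <= k2) ->
    `|path_at f (i%:R / n.+1%:R) - path_at f (j%:R / n.+1%:R)| <= e]); last first.
  by apply/seteqP; split => f H => [i _ j _ n _|i j n]; [exact: H | exact: (H i I j I n I)].
apply: bigcapT_measurable => i; apply: bigcapT_measurable => j.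
apply: bigcapT_measurable => n.
have [iM|iM] := pselect (i%:R / n.+1%:R <= j%:R / n.+1%:R :> R); last first.
  by rewrite [X in measurable X](_ : _ = setT)//; apply/seteqP; split => f //= _ /iM.
have [jM|jM] := pselect (j%:R / n.+1%:R <= M :> R); last first.
  by rewrite [X in measurable X](_ : _ = setT)//; apply/seteqP; split => f //= _ _ /jM.
rewrite [X in measurable X](_ : _ =
  ((setT `&` [set f : wpath R | k1 <= path_at f (i%:R / n.+1%:R)]) `&`
   (setT `&` [set f : wpath R | path_at f (i%:R / n.+1%:R) <= k2])) `|`
   (setT `&` [set f : wpath R | `|path_at f (i%:R / n.+1%:R) - path_at f (j%:R / n.+1%:R)| <= e])).
  apply: measurableU.
    apply: measurableI; apply: measurable_fun_ler => //; exact: measurable_at_path.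
  apply: measurable_fun_ler => //; apply: measurableT_comp => //.
  by apply: measurable_funB; exact: measurable_at_path.
apply/seteqP; split => f /=.
  move=> /(_ iM jM); have [/andP[h1 h2] _|_ h] := boolP (_ <= _ <= _); first by left.
  by right; split => //; exact: h.
by move=> [[[_ h1] [_ h2]]|[_ h] //] _ _; rewrite h1 h2.
Qed.

End regularity.

(** * From close clocks to close paths *)

Section deterministic.
Context {R : realType}.

(** Between two neighbouring grid times, both the clock and k h increase, so the
    deviation can grow only by the mesh and the deviations at its ends. *)
Lemma clock_grid (c : nat -> R) (h delta : R) (J : nat) :
  (forall n k, (n <= k)%N -> c n <= c k) -> 0 < h -> h <= delta ->
  (forall j, (j <= J)%N ->
    `|c (Num.truncn (j%:R * delta / h)) - (Num.truncn (j%:R * delta / h))%:R * h| <= delta) ->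
  forall k, k%:R * h < J%:R * delta -> `|c k - k%:R * h| <= 3 * delta.
Proof.
move=> cnd h0 hd H k kJ.
have d0 : 0 < delta := lt_le_trans h0 hd.
set j := Num.truncn (k%:R * h / delta).
have kh0 : 0 <= k%:R * h / delta by rewrite !mulr_ge0// ?invr_ge0 ltW.
have jd : j%:R * delta <= k%:R * h.
  by rewrite -ler_pdivlMr// -truncn_ge_nat.
have jd1 : k%:R * h < j.+1%:R * delta.
  by rewrite -ltr_pdivrMr// truncnS_gt.
have jJ : (j < J)%N.
  by rewrite -(ltr_nat R) -(ltr_pM2r d0); exact: le_lt_trans jd kJ.
have g0 i : 0 <= i%:R * delta / h :> R by rewrite !mulr_ge0// ?invr_ge0 ltW.
have up i : (Num.truncn (i%:R * delta / h))%:R * h <= i%:R * delta.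
  by rewrite -ler_pdivlMr// -truncn_ge_nat.
have lo i : i%:R * delta - h < (Num.truncn (i%:R * delta / h))%:R * h.
  rewrite ltrBlDr -{3}(mul1r h) -mulrDl natr1 -ltr_pdivrMr//; exact: truncnS_gt.
have kj : (Num.truncn (j%:R * delta / h) <= k)%N.
  by rewrite -(ler_nat R) -(ler_pM2r h0); exact: le_trans (up j) jd.
have kj1 : (k <= Num.truncn (j.+1%:R * delta / h))%N.
  by rewrite truncn_ge_nat// ler_pdivlMr// ltW.
have h1 := H j (ltnW jJ); have h2 := H j.+1 jJ.
have c1 := cnd _ _ kj; have c2 := cnd _ _ kj1.
move: h1 h2 (up j.+1) (lo j) jd jd1 c1 c2.
have -> : j.+1%:R * delta = j%:R * delta + delta by rewrite -natr1 mulrDl mul1r.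
move: (j%:R * delta) (k%:R * h) (c _) (c _) (c k) ((Num.truncn _)%:R * h)
  ((Num.truncn _)%:R * h) => x1 x2 x3 x4 x5 x6 x7.
rewrite !ler_norml => /andP[? ?] /andP[? ?] ? ? ? ? ? ?; apply/andP; split; lra.
Qed.

Lemma interp_dist (x : nat -> R) (g : R -> R) (h t e1 e2 : R) :
  0 < h -> 0 <= t ->
  (forall k, k%:R * h <= t + h -> `|x k - g (k%:R * h)| <= e1) ->
  (forall k, `|k%:R * h - t| <= h -> `|g (k%:R * h) - g t| <= e2) ->
  `|interp x h t - g t| <= e1 + e2.
Proof.
move=> h0 t0 H1 H2; rewrite /interp; set k := Num.truncn (t / h).
have k1 : k%:R * h <= t by rewrite -ler_pdivlMr// -truncn_ge_nat// mulr_ge0// invr_ge0 ltW.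
have k2 : t < k.+1%:R * h by rewrite -ltr_pdivrMr// truncnS_gt.
have kS : k.+1%:R * h = k%:R * h + h by rewrite -natr1 mulrDl mul1r.
have th : t / h * h = t by rewrite divfK// gt_eqF.
have b1 : `|x k - g t| <= e1 + e2.
  rewrite -(subrKA (g (k%:R * h))); apply: le_trans (ler_normD _ _) _; apply: lerD.
    by apply: H1; lra.
  by apply: H2; rewrite ler_norml; apply/andP; split; lra.
have b2 : `|x k.+1 - g t| <= e1 + e2.
  rewrite -(subrKA (g (k.+1%:R * h))); apply: le_trans (ler_normD _ _) _; apply: lerD.
    by apply: H1; lra.
  by apply: H2; rewrite ler_norml; apply/andP; split; lra.
set u := t / h - k%:R.
have u0 : 0 <= u by rewrite subr_ge0 ler_pdivlMr.
have u1 : u <= 1 by rewrite lerBlDr addrC natr1 ler_pdivrMr// ltW.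
rewrite (_ : _ - g t = (1 - u) * (x k - g t) + u * (x k.+1 - g t)); last ring.
apply: le_trans (ler_normD _ _) _; rewrite !normrM (ger0_norm u0) (@ger0_norm _ (1 - u)) ?subr_ge0//.
move: b1 b2; move: `|x k - g t| `|x k.+1 - g t| (e1 + e2) => p q r pr qr.
have : (1 - u) * p <= (1 - u) * r by rewrite ler_wpM2l// subr_ge0.
have : u * q <= u * r by rewrite ler_wpM2l.
lra.
Qed.

Variable a : R -> R.

(** The k-th embedded point is the value of f at the true clock. If the modified
    clock has not diverged from the true one at step k, the true clock is within
    3 delta of k h and the modulus of continuity applies. Otherwise the chain was
    outside K at some earlier step j; both the position at step k and the position
    at time k h are then within e of the position at step j, either because they
    are later or because the clock at step j is already close to k h. *)
Lemma embedded_close (f : cpath R) (x h T M delta e k1 k2 : R) (N : nat) :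
  let K := [pred z | k1 <= z <= k2] in
  0 < h -> h <= delta -> T + h <= N%:R * h -> N%:R * h <= M ->
  path_at f 0 = x -> finite_exits a N x f -> clock a h predT N x f <= M ->
  mod_ok M (4 * delta) e f -> exit_ok k1 k2 M e f ->
  (forall k, (k <= N)%N -> `|clock a h K k x f - k%:R * h| <= 3 * delta) ->
  forall t, 0 <= t <= T -> `|interp (embedded a x f) h t - path_at f t| <= 3 * e.
Proof.
move=> K h0 hd TN NM f0 fN cN mf xf H t /andP[t0 tT].
have d0 : 0 < delta := lt_le_trans h0 hd.
have {}mf := mod_okP mf; have {}xf := exit_okP xf.
have c0 n : 0 <= clock a h predT n x f by rewrite clock_ge0// ltW.
have cM n : (n <= N)%N -> 0 <= clock a h predT n x f <= M.
  by move=> nN; rewrite c0/= (le_trans _ cN)// clock_nd// ltW.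
have kM n : (n <= N)%N -> 0 <= n%:R * h <= M.
  move=> nN; rewrite mulr_ge0//= ?(ltW h0)//; apply: le_trans NM.
  by rewrite ler_pM2r// ler_nat.
have e0 : 0 <= e.
  have M0 : 0 <= M by have /andP[/le_trans] := kM 0%N (leq0n _); apply.
  have := mf 0 0; rewrite lexx M0 subrr normr0 => /(_ isT isT); rewrite subrr normr0.
  by apply; lra.
have Hpos k : (k <= N)%N -> `|embedded a x f k - path_at f (k%:R * h)| <= 2 * e.
  move=> kN; rewrite (embedded_at h f0 fN kN).
  have [ck|[j jk [cj Kj]]] := clock_split a h K k x f.
    apply: (@le_trans _ _ e); last lra.
    by apply: mf => //; [exact: cM | exact: kM | rewrite -ck; apply: le_lt_trans (H k kN) _; lra].
  have jN : (j <= N)%N by apply: leq_trans (ltnW jk) kN.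
  rewrite (embedded_at h f0 fN jN) in Kj.
  rewrite -(subrKA (path_at f (clock a h predT j x f))); apply: le_trans (ler_normD _ _) _.
  rewrite mulr2n mulrDl !mul1r; apply: lerD.
    rewrite distrC; apply: xf => //; first by apply: clock_nd; [exact: ltW | exact: ltnW].
    by case/andP: (cM k kN).
  have [le|lt] := leP (clock a h predT j x f) (k%:R * h).
    by apply: xf => //; case/andP: (kM k kN).
  apply: mf; [exact: cM | exact: kM |].
  have := H j jN; rewrite cj.
  have : j%:R * h <= k%:R * h by rewrite ler_pM2r// ler_nat ltnW.
  by rewrite ler_norml ltr_norml => ? /andP[? ?]; apply/andP; split; lra.
rewrite (_ : 3 * e = 2 * e + e); last ring.
have kN k : k%:R * h <= t + h -> (k <= N)%N.
  move=> kt; rewrite -(ler_nat R) -(ler_pM2r h0); apply: le_trans TN; lra.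
apply: interp_dist => // k; first by move=> /kN /Hpos.
rewrite ler_norml => /andP[k3 k4].
have kk : (k <= N)%N by apply: kN; lra.
apply: mf; first exact: kM.
  by rewrite t0/=; lra.
by rewrite ltr_norml; apply/andP; split; lra.
Qed.

End deterministic.

(** * The strong Markov property in product form *)

Lemma integral_mrestr d (T : measurableType d) (R : realType)
    (mu : {measure set T -> \bar R}) (U : set T) (mU : measurable U) (f : T -> \bar R) :
  measurable_fun setT f -> (forall x, 0 <= f x)%E ->
  (\int[mrestr mu mU]_x f x = \int[mu]_(x in U) f x)%E.
Proof.
move=> mf f0.
rewrite (@ge0_negligible_integral _ _ _ _ setT (~` U))//=; first last.
- by rewrite /mrestr/= setICl measure0.
- exact: measurableC.
rewrite setTD setCK; apply: eq_measure_integral => A mA AU.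
by change (mu (A `&` U) = mu A); rewrite setIidl.
Qed.

(** On U the joint law of (X, Z) is the product of the law of X restricted to U
    and nu, so Tonelli applies. Keeping the event U as a second coordinate of X
    turns the restriction to U into a restriction of the image measure. *)
Lemma integral_indep d d1 d2 (T : measurableType d) (V1 : measurableType d1)
    (V2 : measurableType d2) (R : realType) (mu : probability T R) (U : set T)
    (X : T -> V1) (Z : T -> V2) (nu : probability V2 R)
    (g : V1 -> \bar R) (G : V2 -> \bar R) :
  measurable U -> measurable_fun setT X -> measurable_fun setT Z ->
  (forall A B, measurable A -> measurable B ->
    (mu (U `&` (X @^-1` A `&` Z @^-1` B)) = mu (U `&` X @^-1` A) * nu B)%E) ->
  measurable_fun setT g -> (forall u, 0 <= g u)%E ->
  measurable_fun setT G -> (forall u, 0 <= G u)%E ->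
  (\int[mu]_(w in U) (g (X w) * G (Z w)) =
   \int[mu]_(w in U) g (X w) * \int[nu]_u G u)%E.
Proof.
move=> mU mX mZ H mg g0 mG G0.
pose u w := `[< U w >].
have mu_ : measurable_fun setT u.
  apply: (@measurable_fun_bool _ _ _ _ true); rewrite setTI (_ : _ @^-1` _ = U)//.
  by apply/seteqP; split=> w /=; rewrite /u => /asboolP.
pose Xu w := (X w, u w).
have mXu : measurable_fun setT Xu by exact: measurable_fun_pair.
pose XuZ w := (Xu w, Z w).
have mXuZ : measurable_fun setT XuZ by exact: measurable_fun_pair.
pose fXu : {mfun T >-> (V1 * bool)%type} := HB.pack Xu (isMeasurableFun.Build _ _ _ _ Xu mXu).
pose fXuZ : {mfun T >-> (V1 * bool * V2)%type} :=
  HB.pack XuZ (isMeasurableFun.Build _ _ _ _ XuZ mXuZ).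
pose D : set (V1 * bool) := setT `*` [set true].
have mD : measurable D by exact: measurableX.
have mDT : measurable (D `*` [set: V2]) by exact: measurableX.
have Doo : (distribution mu fXu D < +oo)%E.
  by rewrite (le_lt_trans (probability_le1 _ _))// ltry.
pose m1 : {finite_measure set (V1 * bool)%type -> \bar R} := mfrestr mD Doo.
pose m' := mrestr (distribution mu fXuZ) mDT.
have UE : Xu @^-1` D = U.
  by apply/seteqP; split => w /=; rewrite /u; [move=> [_ /asboolP] | move=> /asboolP].
have m'E A B : measurable A -> measurable B -> (m' (A `*` B) = m1 A * nu B)%E.
  move=> mA mB.
  pose A1 := [set z | A (z, true)].
  have mA1 : measurable A1.
    rewrite -[X in measurable X]setTI.
    by apply: (_ : measurable_fun setT (fun z : V1 => (z, true))) => //; apply: measurable_fun_pair.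
  have -> : m' (A `*` B) = mu (U `&` (X @^-1` A1 `&` Z @^-1` B)).
    change (mu (XuZ @^-1` (A `*` B `&` D `*` setT)) = mu (U `&` (X @^-1` A1 `&` Z @^-1` B))).
    congr (mu _); apply/seteqP; split => w /=.
      by rewrite /Xu => -[[h1 h2] [[_ /= h3] _]]; rewrite h3 in h1; split=> //; exact/asboolP.
    by move=> [/asboolP Uw [h1 h2]]; rewrite /Xu /u Uw.
  have -> : m1 A = mu (U `&` (X @^-1` A1)).
    change (mu (Xu @^-1` (A `&` D)) = mu (U `&` (X @^-1` A1))).
    congr (mu _); apply/seteqP; split => w /=.
      by rewrite /Xu => -[h1 [_ /= h3]]; rewrite h3 in h1; split=> //; exact/asboolP.
    by move=> [/asboolP Uw h1]; rewrite /Xu /u Uw.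
  exact: H.
have mprod := product_measure_unique m'E.
pose h (p : V1 * bool * V2) := (g p.1.1 * G p.2)%E.
have mh : measurable_fun setT h.
  apply: emeasurable_funM; apply: measurableT_comp => //.
  exact: measurableT_comp.
have h0 p : (0 <= h p)%E by rewrite mule_ge0.
transitivity (\int[m']_p h p)%E.
  rewrite integral_mrestr// integral_mkcond ge0_integral_distribution; last 2 first.
  - by apply/(measurable_restrictT _ mDT); exact: measurable_funTS.
  - by move=> y; rewrite patchE; case: ifP.
  rewrite integral_mkcond; apply: eq_integral => w _; rewrite !patchE/= patchE.
  have -> : (w \in U) = (XuZ w \in D `*` setT).
    apply/idP/idP; rewrite !inE => h1.
      by split=> //; have : (Xu @^-1` D) w by rewrite UE.
    by have : (Xu @^-1` D) w := h1.1; rewrite UE.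
  by [].
transitivity (\int[m1 \x nu]_p h p)%E.
  apply: eq_measure_integral => A mA _; exact: (esym (mprod A mA)).
rewrite fubini_tonelli1// /fubini_F/=.
transitivity (\int[m1]_p (g p.1 * \int[nu]_u G u))%E.
  by apply: eq_integral => p _; rewrite /h/= ge0_integralZl.
have mg1 : measurable_fun setT (fun p : V1 * bool => g p.1) by exact: measurableT_comp.
rewrite ge0_integralZr//; last exact: integral_ge0.
congr (_ * _)%E; transitivity (\int[distribution mu fXu]_(p in D) g p.1)%E.
  exact: (@integral_mrestr _ _ _ (distribution mu fXu) _ mD).
rewrite integral_mkcond ge0_integral_distribution; last 2 first.
- by apply/(measurable_restrictT _ mD); exact: measurable_funTS.
- by move=> y; rewrite patchE; case: ifP.
rewrite [RHS]integral_mkcond; apply: eq_integral => w _; rewrite !patchE/= patchE.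
have -> : (w \in U) = (Xu w \in D).
  apply/idP/idP; rewrite !inE => h1.
    by have : (Xu @^-1` D) w by rewrite UE.
  by have : (Xu @^-1` D) w := h1; rewrite UE.
by [].
Qed.

Section markov.
Context {R : realType} {d : measure_display} {Omega : measurableType d}.
Context {I : set R} {l r : \bar R} {F : time R -> set_system Omega}
  {P : R -> probability Omega R} {Y : Omega -> cpath R}
  {m : {measure set R -> \bar R}}.
Hypothesis Yd : general_diffusion I l r F P Y m.
Local Open Scope ereal_scope.

Lemma at_I w t : I (path_at (Y w) t).
Proof. exact: (gd_state Yd). Qed.

Lemma measurable_at_Y t : measurable_fun setT (fun w => path_at (Y w) t).
Proof.
move=> _ B mB; rewrite setTI; have [_ h _] := gd_filtration Yd.
by apply: h; exact: (gd_adapted Yd (`|t|%:nng)%R mB).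
Qed.

Lemma measurable_Y : measurable_fun setT (Y : Omega -> wpath R).
Proof. by apply: measurable_to_path => t _; exact: measurable_at_Y. Qed.

Lemma measurable_interior : measurable I.
Proof. by apply: is_interval_measurable; case: (gd_state_space Yd). Qed.

(** Omega with the sigma-algebra F t, so that membership in F t can be proved by
    the closure properties of measurable sets and functions. *)
Definition stage (t : time R) := g_sigma_algebraType (F t).

Lemma stageE t : (measurable : set (set (stage t))) = F t.
Proof. by apply: measurable_g_measurableTypeE; case: (gd_filtration Yd). Qed.

Lemma stage_hit_time (c : R) (t : time R) (s : R) : (s <= t%:num)%R ->
  F t [set w | hit_time c (Y w) <= s%:E].
Proof.
move=> st; rewrite -(stageE t).
apply: (@measurable_hit_time_le _ _ (stage t) Y c s) => u /andP[u0 us] _ B mB.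
rewrite setTI stageE; have [_ _ Fle] := gd_filtration Yd.
apply: (Fle (`|u|%:nng)%R); first by rewrite /= ger0_norm// (le_trans us).
exact: (gd_adapted Yd (`|u|%:nng)%R mB).
Qed.

Lemma stopping_hit_time (c : R) : stopping_time F (fun w => hit_time c (Y w)).
Proof. by split=> [w|t]; [exact: hit_time_ge0 | exact: stage_hit_time]. Qed.

Lemma stopping_min (t1 t2 : Omega -> \bar R) : stopping_time F t1 -> stopping_time F t2 ->
  stopping_time F (fun w => Order.min (t1 w) (t2 w)).
Proof.
move=> [t10 t1F] [t20 t2F]; split=> [w|t]; first by rewrite le_min t10 t20.
rewrite -(stageE t) (_ : [set _ | _] =
   [set w | t1 w <= t%:num%:E] `|` [set w | t2 w <= t%:num%:E]).
  by apply: measurableU; rewrite stageE; [exact: t1F|exact: t2F].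
by apply/seteqP; split=> w /=; rewrite ge_min => /orP.
Qed.

Lemma stopping_cst (s : R) : (0 <= s)%R -> stopping_time F (fun=> s%:E).
Proof.
move=> s0; split=> [w|t]; first by rewrite lee_fin.
rewrite -(stageE t); have [st|st] := leP s t%:num.
  have -> : [set _ : Omega | s%:E <= t%:num%:E] = setT by apply/seteqP; split.
  exact: measurableT.
have -> : [set _ : Omega | s%:E <= t%:num%:E] = set0.
  by apply/seteqP; split => // w /=; rewrite lee_fin leNgt st.
exact: measurable0.
Qed.

Section stopping.
Variable tau : Omega -> \bar R.
Hypothesis stau : stopping_time F tau.

Lemma stopping_fine w : tau w < +oo -> tau w = (fine (tau w))%:E.
Proof. by move=> h; rewrite fineK// ge0_fin_numE//; case: stau. Qed.

Lemma stopping_ge0 w : (0 <= fine (tau w))%R.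
Proof. by rewrite fine_ge0//; case: stau. Qed.

Lemma stage_le (t : time R) (s : R) : (s <= t%:num)%R ->
  F t [set w | tau w <= s%:E].
Proof.
move=> st; have [s0|s0] := leP 0%R s; last first.
  rewrite -stageE (_ : [set _ | _] = set0)//; apply/seteqP; split => // w /= h.
  have /= := stau.1 w; move=> /le_trans /(_ h); rewrite lee_fin => /(lt_le_trans s0).
  by rewrite ltxx.
have [_ _ Fle] := gd_filtration Yd.
have [u us] : exists u : time R, u%:num = s.
  by exists (`|s|%:nng)%R; rewrite /= ger0_norm.
by apply: (Fle u); [rewrite us | rewrite -us; exact: stau.2].
Qed.

Lemma measurable_stopping : measurable_fun setT tau.
Proof.
move=> _; apply: (measurability _ (ErealGenOInfty.measurableE R)) => //.
move=> _ [_ [s ->] <-]; rewrite setTI.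
rewrite (_ : _ @^-1` _ = ~` [set w | (tau w <= s%:E)%E]).
  apply: measurableC; have [_ h _] := gd_filtration Yd.
  apply: (h (`|s|%:nng)%R); apply: stage_le; exact: ler_norm.
by apply/seteqP; split => w /=; rewrite in_itv/= andbT ltNge => /negP.
Qed.

Lemma measurable_finite : measurable [set w | tau w < +oo].
Proof.
rewrite (_ : [set _ | _] = setT `&` (tau @^-1` [set~ +oo])).
  by apply: measurable_stopping => //; apply: measurableC; exact: emeasurable_set1.
by apply/seteqP; split => w /=; rewrite ltey => h; [split => //; exact/eqP | case: h => _ /eqP].
Qed.

(** On {tau <= t}, tau coincides with min (tau, t), which is F t-measurable. *)
Lemma stopped_fine (S : set R) : measurable S ->
  stopped_sigma F tau [set w | tau w < +oo /\ S (fine (tau w))].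
Proof.
move=> mS; split.
  apply: measurableI; first exact: measurable_finite.
  rewrite -[X in measurable X]setTI; apply: measurableT_comp => //.
  exact: measurable_stopping.
move=> t; rewrite -(stageE t).
rewrite (_ : _ `&` _ = [set w | tau w <= t%:num%:E] `&`
   (setT `&` (fun w => fine (Order.min (tau w) t%:num%:E)) @^-1` S)); last first.
  apply/seteqP; split => w /=.
    by move=> [[h1 h2] h3]; split=> //; split=> //; rewrite min_l.
  move=> [h3 [_ +]]; rewrite min_l// => h2; split=> //; split => //.
  by apply: le_lt_trans h3 _; rewrite ltry.
apply: measurableI; first by rewrite stageE; case: stau.
apply: (_ : measurable_fun (setT : set (stage t)) _) => //.
apply: measurableT_comp => //.
move=> _; apply: (measurability _ (ErealGenOInfty.measurableE R)) => //.
move=> _ [_ [s ->] <-]; rewrite setTI.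
rewrite (_ : _ @^-1` _ = ~` [set w | (Order.min (tau w) t%:num%:E <= s%:E)%E]).
  apply: measurableC.
  have [st|st] := ltP s t%:num.
    rewrite (_ : [set _ | _] = [set w | tau w <= s%:E]).
      by rewrite stageE; apply: stage_le; exact: ltW.
    by apply/seteqP; split => w /=; rewrite ge_min lee_fin [(t%:num <= s)%R]leNgt st orbF.
  rewrite (_ : [set _ | _] = setT)//.
  by apply/seteqP; split => w //= _; rewrite ge_min !lee_fin st orbT.
by apply/seteqP; split => w /=; rewrite in_itv/= andbT ltNge => /negP.
Qed.

Definition post w : cpath R := shift (at_time tau w) (Y w).

Lemma at_post w t : path_at (post w) t = path_at (Y w) (fine (tau w) + `|t|).
Proof. by rewrite /post at_shift/= ger0_norm// stopping_ge0. Qed.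

Lemma measurable_post : measurable_fun setT (post : Omega -> wpath R).
Proof.
apply: measurable_shift => [t _|]; first exact: measurable_at_Y.
by apply: measurableT_comp => //; exact: measurable_stopping.
Qed.

Lemma start_at z : I z -> P z [set w | path_at (Y w) 0 = z] = 1.
Proof.
move=> Iz; rewrite -(gd_start Yd Iz); congr (P z _); apply/seteqP; split=> w /=;
by rewrite evE_at/=.
Qed.

Lemma measurable_start z : measurable [set w | path_at (Y w) 0 = z].
Proof.
rewrite -[X in measurable X]setTI.
change (measurable (setT `&` (fun w => path_at (Y w) 0) @^-1` [set z])).
by apply: measurable_at_Y.
Qed.

Lemma start_atC z : I z -> P z (~` [set w | path_at (Y w) 0 = z]) = 0.
Proof.
move=> Iz; have := probability_setC (P z) (measurable_start z).
by rewrite start_at// subee// => ->.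
Qed.

Lemma start_null z (B : set Omega) : I z -> measurable B ->
  B `<=` ~` [set w | path_at (Y w) 0 = z] -> P z B = 0.
Proof.
move=> Iz mB Bz.
exact: (@subset_measure0 _ _ _ (P z) _ _ mB (measurableC (measurable_start z)) Bz (start_atC Iz)).
Qed.

Definition at_exit (c : R) : set Omega :=
  [set w | tau w < +oo /\ path_at (Y w) (fine (tau w)) = c].

Lemma measurable_at_exit c : measurable (at_exit c).
Proof.
apply: measurableI; first exact: measurable_finite.
rewrite -[X in measurable X]setTI.
change (measurable (setT `&` (fun w => path_at (Y w) (fine (tau w))) @^-1` [set c])).
apply: measurable_at => //; first by move=> t _; exact: measurable_at_Y.
  by apply: measurableT_comp => //; exact: measurable_stopping.
exact: stopping_ge0.
Qed.

(** The strong Markov property restarts Y from its random position at tau. On the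
    event that this position is c the kernel is the constant P_c; intersecting B
    with the paths starting at c makes the integrand vanish off this event, since
    a path started elsewhere never starts at c. *)
Lemma markov_exit_set x c (S : set R) (B : set (wpath R)) : I x -> I c ->
  measurable S -> measurable B ->
  P x (at_exit c `&` ((fun w => fine (tau w)) @^-1` S `&` post @^-1` B)) =
  P x (at_exit c `&` (fun w => fine (tau w)) @^-1` S) * P c (Y @^-1` B).
Proof.
move=> Ix Ic mS mB.
pose A := [set w | tau w < +oo /\ S (fine (tau w))].
have mA : measurable A by case: (stopped_fine mS).
pose C : set (wpath R) := [set f | path_at f 0 = c].
have mC : measurable C.
  rewrite -[X in measurable X]setTI.
  change (measurable (setT `&` (fun f : wpath R => path_at f 0) @^-1` [set c])).
  by apply: measurable_at_path.
have mYB (D : set (wpath R)) : measurable D -> measurable (Y @^-1` D).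
  by move=> mD; rewrite -[X in measurable X]setTI; exact: measurable_Y.
have := gd_strong_markov Yd Ix stau (stopped_fine mS) (measurableI _ _ mB mC).
rewrite (_ : _ `&` _ = at_exit c `&`
   ((fun w => fine (tau w)) @^-1` S `&` post @^-1` B)); last first.
  apply/seteqP; split => w /=.
    move=> [[h1 h2]] [_ [h3 h4]]; have {}h4 : path_at (post w) 0 = c := h4.
    by rewrite at_post normr0 addr0 in h4; split.
  move=> [[h1 h4] [h2 h3]]; split => //; split => //; split => //.
  change (path_at (post w) 0 = c).
  by rewrite at_post normr0 addr0.
move=> ->.
transitivity (\int[P x]_(w in A) (P c (Y @^-1` B) * (\1_(at_exit c) w)%:E)).
  rewrite (_ : _ `&` _ = A); last by apply/seteqP; split=> w /=; [case | move=> h; split => //; case: h].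
  apply: eq_integral => w; rewrite inE => -[h1 h2].
  have -> : ev (Y w) (at_time tau w) = path_at (Y w) (fine (tau w)) by [].
  have [e|ne] := eqVneq (path_at (Y w) (fine (tau w))) c.
    have wc : w \in at_exit c by rewrite inE; split.
    rewrite indicE wc.
    rewrite e mule1 preimage_setI.
    rewrite [RHS](measureDI (P c) (mYB _ mB) (mYB _ mC)).
    rewrite [X in _ = X + _](_ : _ = 0) ?add0e//.
    apply: start_null => [//||]; first by apply: measurableD; exact: mYB.
    by move=> v [].
  have wc : w \notin at_exit c by apply/negP; rewrite inE => -[_ /eqP]; exact/negP.
  rewrite indicE (negbTE wc).
  rewrite mule0; apply: start_null; first exact: at_I.
    by apply: mYB; exact: measurableI.
  by move=> v [_ /= vc] vz; move: ne; rewrite -vz -vc eqxx.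
rewrite (@ge0_integralZl _ _ _ (P x) A mA (fun w => (\1_(at_exit c) w)%:E))//; first last.
  by apply/measurable_EFinP; apply: measurable_indic; exact: measurable_at_exit.
rewrite integral_indic//; last exact: measurable_at_exit.
rewrite muleC; congr (P x _ * _); apply/seteqP; split => w /=.
  by move=> [h1 [h2 h3]].
by move=> [[h1 h2] h3].
Qed.

(** Given the exit point, the exit time and the future are independent, and the
    future has the law of Y started at the exit point. *)
Lemma markov_exit x c (g : R -> \bar R) (G : wpath R -> \bar R) : I x -> I c ->
  measurable_fun setT g -> (forall u, 0 <= g u) ->
  measurable_fun setT G -> (forall u, 0 <= G u) ->
  \int[P x]_(w in at_exit c) (g (fine (tau w)) * G (post w)) =
  (\int[P x]_(w in at_exit c) g (fine (tau w))) * \int[P c]_w G (Y w).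
Proof.
move=> Ix Ic mg g0 mG G0.
have mU := measurable_at_exit c.
have mtau : measurable_fun setT (fun w => fine (tau w)).
  by apply: measurableT_comp => //; exact: measurable_stopping.
pose Ymf : {mfun Omega >-> wpath R} :=
  HB.pack (Y : Omega -> wpath R) (isMeasurableFun.Build _ _ _ _ (Y : Omega -> wpath R) measurable_Y).
rewrite (@integral_indep _ _ _ _ _ _ _ (P x) _ (fun w => fine (tau w)) (post : Omega -> wpath R) (distribution (P c) Ymf))//.
- by rewrite ge0_integral_distribution.
- exact: measurable_post.
- by move=> A B mA mB; exact: markov_exit_set.
Qed.
End stopping.
End markov.

(** * One step of the embedded chain *)

Section first_step.
Context {R : realType} {d : measure_display} {Omega : measurableType d}.
Context {I : set R} {l r : \bar R} {F : time R -> set_system Omega}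
  {P : R -> probability Omega R} {Y : Omega -> cpath R}
  {m : {measure set R -> \bar R}}.
Hypothesis Yd : general_diffusion I l r F P Y m.
Local Open Scope ereal_scope.

Lemma measurable_comp_Y d' (T' : measurableType d') (G : wpath R -> T') :
  measurable_fun setT G -> measurable_fun setT (fun w => G (Y w)).
Proof.
by move=> mG; apply: (measurableT_comp mG); exact: measurable_Y Yd.
Qed.

Lemma measurable_preim_Y (B : set (wpath R)) : measurable B -> measurable (Y @^-1` B).
Proof.
by move=> mB; rewrite -[X in measurable X]setTI; exact: (measurable_Y Yd).
Qed.

Variables (a : R -> R) (h : R).
Hypothesis h0 : (0 <= h)%R.
Definition scale_ok := forall x, I x ->
  [/\ (0 <= a x)%R, I (x - a x)%R, I (x + a x)%R &
      \int[P x]_w exit_time a x (Y w) <= h%:E].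
Hypothesis aok : scale_ok.

Let tau x w := exit_time a x (Y w).

Lemma stopping_exit_time x : stopping_time F (tau x).
Proof. by apply: (stopping_min Yd); exact: (stopping_hit_time Yd). Qed.

Lemma measurable_exit_timeY x : measurable_fun setT (tau x).
Proof. by apply: measurable_comp_Y; exact: measurable_exit_time. Qed.

Lemma measurable_durationY x : measurable_fun setT (fun w => duration a x (Y w)).
Proof. by apply: measurable_comp_Y; exact: measurable_duration. Qed.

Lemma exit_time_lty x : I x -> P x [set w | tau x w < +oo] = 1.
Proof.
move=> Ix; have [_ _ _ Eh] := aok Ix.
have mT := measurable_exit_timeY x.
have iT : (P x).-integrable setT (tau x).
  apply/integrableP; split => //.
  under eq_integral do rewrite gee0_abs ?exit_time_ge0//.
  by rewrite (le_lt_trans Eh)// ltry.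
have [N [mN PN subN]] := integrable_ae measurableT iT.
have mA : measurable [set w | tau x w < +oo] := measurable_finite Yd (stopping_exit_time x).
apply/eqP; rewrite eq_le probability_le1//=.
have : P x (~` N) = 1 by rewrite (@probability_setC _ _ _ (P x) _ mN) PN sube0.
move=> <-; apply: le_measure; rewrite ?inE//; first exact: measurableC.
move=> w /= nN; rewrite ltey; apply: contrapT => /negP/negPn/eqP wy.
by apply: nN; apply: subN => /= /(_ Logic.I); rewrite wy.
Qed.

Lemma integral_lty x (f : Omega -> \bar R) : I x -> measurable_fun setT f ->
  (forall w, 0 <= f w) -> \int[P x]_w f w = \int[P x]_(w in [set w | tau x w < +oo]) f w.
Proof.
move=> Ix mf f0.
have mA : measurable [set w | tau x w < +oo] := measurable_finite Yd (stopping_exit_time x).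
rewrite (@ge0_negligible_integral _ _ _ (P x) setT (~` [set w | tau x w < +oo]))//=.
- by rewrite setTD setCK.
- exact: measurableC.
- by rewrite (@probability_setC _ _ _ (P x) _ mA) exit_time_lty// subee.
Qed.

Local Notation at_exit x c := (at_exit (Y := Y) (tau x) c).

Lemma lty_split x : (0 < a x)%R ->
  [set w | tau x w < +oo] = at_exit x (x + a x)%R `|` at_exit x (x - a x)%R.
Proof.
move=> ax; apply/seteqP; split=> w /=; last by move=> [[]|[]].
by move=> wT; have [e|e] := at_duration wT; [left|right].
Qed.

Lemma lty_split0 x : a x = 0%R -> [set w | tau x w < +oo] = at_exit x (x + a x)%R.
Proof.
move=> ax; apply/seteqP; split=> w /=; last by move=> [].
move=> wT; split => //; have [e|e] := at_duration wT; first exact: e.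
by rewrite ax addr0; move: e; rewrite ax subr0.
Qed.

Lemma exit_disj x : (0 < a x)%R -> at_exit x (x + a x)%R `&` at_exit x (x - a x)%R = set0.
Proof.
move=> ax; apply/seteqP; split => w //= [[_ e1] [_ e2]].
have : (x + a x = x - a x)%R by rewrite -e1 -e2.
by lra.
Qed.

(** At the midpoint of an interval natural scale gives probability 1/2, and the
    right end point is hit first exactly when it is the exit point. *)
Lemma prob_up x : I x -> (0 < a x)%R -> P x (at_exit x (x + a x)%R) = (2^-1)%:E.
Proof.
move=> Ix ax; have [_ Im Ip _] := aok Ix.
have := gd_natural_scale Yd Im Ip; move=> /(_ x); rewrite ltrBlDr ltrDl ax => /(_ isT).
have -> : ((x - (x - a x)) / (x + a x - (x - a x)) = 2^-1)%R.
  rewrite (_ : (x - (x - a x) = a x)%R); last by ring.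
  rewrite (_ : (x + a x - (x - a x) = a x * 2)%R); last by ring.
  by rewrite invfM mulrA divff ?gt_eqF// mul1r.
move=> <-.
congr (P x _); apply/seteqP; split => w /=.
  move=> [wT e]; rewrite -[X in X < _]/(hit_time (x + a x) (Y w)) -[X in _ < X]/(hit_time (x - a x) (Y w)).
  rewrite ltNge; apply/negP => le.
  move: wT e; rewrite /tau /exit_time min_l// => wT; rewrite (at_hit_time wT) => e; lra.
rewrite -[X in X < _]/(hit_time (x + a x) (Y w)) -[X in _ < X]/(hit_time (x - a x) (Y w)) => lt.
have e : tau x w = hit_time (x + a x) (Y w) by rewrite /tau /exit_time min_r// ltW.
have wT : hit_time (x + a x) (Y w) < +oo by rewrite (lt_le_trans lt)// leey.
by rewrite /tau in e *; split; rewrite e//; exact: at_hit_time.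
Qed.

Lemma prob_down x : I x -> (0 < a x)%R -> P x (at_exit x (x - a x)%R) = (2^-1)%:E.
Proof.
move=> Ix ax; have := exit_time_lty Ix; rewrite lty_split//.
have mE c : measurable (at_exit x c) by exact: (measurable_at_exit Yd (stopping_exit_time x)).
have -> : P x (at_exit x (x + a x)%R `|` at_exit x (x - a x)%R) =
    P x (at_exit x (x + a x)%R) + P x (at_exit x (x - a x)%R).
  by rewrite measureU//; exact: exit_disj.
rewrite prob_up// => e.
have : ((2^-1)%:E + P x (at_exit x (x - a x)%R)) - (2^-1)%:E = 1 - (2^-1)%:E :> \bar R.
  by rewrite e.
rewrite addeAC subee// add0e => ->.
by rewrite -EFinB; congr EFin; lra.
Qed.

Lemma exit_product x c (g : R -> \bar R) (G : R -> wpath R -> \bar R) : I x -> I c ->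
  measurable_fun setT g -> (forall u, 0 <= g u) ->
  (forall z, measurable_fun setT (G z)) -> (forall z u, 0 <= G z u) ->
  \int[P x]_(w in at_exit x c) (g (duration a x (Y w)) * G (exit_point a x (Y w)) (after_exit a x (Y w))) =
  (\int[P x]_(w in at_exit x c) g (duration a x (Y w))) * \int[P c]_w G c (Y w).
Proof.
move=> Ix Ic mg g0 mG G0.
rewrite -(markov_exit Yd (stopping_exit_time x) Ix Ic mg g0 (mG c) (G0 c)).
apply: eq_integral => w; rewrite inE => -[wT e].
by rewrite (exit_point_at wT) e.
Qed.

Section step.
Variables (x : R) (g : R -> \bar R) (G : R -> wpath R -> \bar R).
Hypotheses (Ix : I x) (mg : measurable_fun setT g) (g0 : forall u, 0 <= g u).
Hypotheses (mG : forall z, measurable_fun setT (G z)) (G0 : forall z u, 0 <= G z u).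

Let mgr : measurable_fun setT (fun w => g (duration a x (Y w))).
Proof. by apply: (measurableT_comp mg); exact: measurable_durationY. Qed.

Lemma measurable_stepG :
  measurable_fun setT (fun w => G (exit_point a x (Y w)) (after_exit a x (Y w))).
Proof. exact: (measurable_comp_Y (measurable_restart a x mG)). Qed.

Let mint : measurable_fun setT
  (fun w => g (duration a x (Y w)) * G (exit_point a x (Y w)) (after_exit a x (Y w))).
Proof. by apply: emeasurable_funM => //; exact: measurable_stepG. Qed.

(** One step of the recursion for a product functional: whatever the exit point,
    the future contributes at most C. The exit time may depend on the exit
    point, but the future does not depend on it once the exit point is given. *)
Lemma step_le (C : R) : (0 <= C)%R -> (forall z, I z -> \int[P z]_w G z (Y w) <= C%:E) ->
  \int[P x]_w (g (duration a x (Y w)) * G (exit_point a x (Y w)) (after_exit a x (Y w))) <=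
  C%:E * \int[P x]_w g (duration a x (Y w)).
Proof.
move=> C0 GC; have [ax0 Im Ip _] := aok Ix.
rewrite integral_lty// => [|w]; last by rewrite mule_ge0.
rewrite [in leRHS]integral_lty//.
have mE c : measurable (at_exit x c) by exact: (measurable_at_exit Yd (stopping_exit_time x)).
have [ax|ax] := eqVneq (a x) 0%R.
  rewrite lty_split0// exit_product// muleC lee_wpmul2r//; last exact: GC.
  exact: integral_ge0.
have {}ax : (0 < a x)%R by rewrite lt_neqAle eq_sym ax.
rewrite lty_split// !ge0_integral_setU//; last 5 first.
- exact: measurable_funTS.
- by apply/disj_setPS; rewrite exit_disj.
- exact: measurable_funTS.
- by move=> w _; rewrite mule_ge0.
- by apply/disj_setPS; rewrite exit_disj.
rewrite !exit_product// [leRHS]ge0_muleDr ?integral_ge0//.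
by apply: leeD; rewrite muleC lee_wpmul2r ?integral_ge0// GC.
Qed.

Lemma step_half :
  \int[P x]_w G (exit_point a x (Y w)) (after_exit a x (Y w)) =
  (2^-1)%:E * \int[P (x + a x)%R]_w G (x + a x)%R (Y w) +
  (2^-1)%:E * \int[P (x - a x)%R]_w G (x - a x)%R (Y w).
Proof.
have [ax0 Im Ip _] := aok Ix.
have mE c : measurable (at_exit x c) by exact: (measurable_at_exit Yd (stopping_exit_time x)).
rewrite integral_lty//; last exact: measurable_stepG.
have prod c : I c -> \int[P x]_(w in at_exit x c) G (exit_point a x (Y w)) (after_exit a x (Y w)) =
    P x (at_exit x c) * \int[P c]_w G c (Y w).
  move=> Ic; have := @exit_product x c (cst 1) G Ix Ic (measurable_cst _) (fun _ => lee01) mG G0.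
  rewrite (eq_integral (fun w => G (exit_point a x (Y w)) (after_exit a x (Y w)))); last first.
    by move=> w _; rewrite mul1e.
  by move=> ->; rewrite integral_cst// mul1e.
have [ax|ax] := eqVneq (a x) 0%R.
  rewrite lty_split0// prod// -lty_split0// exit_time_lty// mul1e ax subr0 addr0.
  have : 0 <= \int[P x]_w G x (Y w) by apply: integral_ge0.
  move: (\int[P x]_w G x (Y w)) => q q0.
  rewrite -ge0_muleDl ?lee_fin// -EFinD (_ : (2^-1 + 2^-1 = 1 :> R)%R) ?mul1e//.
  by lra.
have {}ax : (0 < a x)%R by rewrite lt_neqAle eq_sym ax.
rewrite lty_split// !ge0_integral_setU//; last 2 first.
- by apply: measurable_funTS; exact: measurable_stepG.
- by apply/disj_setPS; rewrite exit_disj.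
by rewrite !prod// prob_up// prob_down.
Qed.

End step.

End first_step.

(** * Moments of the clock *)

Lemma expRN_le (R : realType) (y : R) : 0 <= y -> expR (- y) <= 1 - y + y ^+ 2.
Proof.
move=> y0; rewrite expRN; have y1 : 0 < 1 + y by lra.
apply: (@le_trans _ _ (1 + y)^-1).
  by rewrite lef_pV2 ?posrE ?expR_gt0//; exact: expR_ge1Dx.
rewrite -[leLHS]mul1r ler_pdivrMr// (_ : _ * _ = 1 + y ^+ 3); last by ring.
by rewrite lerDl exprn_ge0.
Qed.

Lemma integral_prob_cst d (T : measurableType d) (R : realType) (mu : probability T R)
  (c : \bar R) : (\int[mu]_w c = c)%E.
Proof.
rewrite integral_cst// [X in (_ * X)%E](_ : _ = 1%E) ?mule1//; exact: probability_setT.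
Qed.

Lemma measurable_natbool d (T : measurableType d) (R : realType) (b : T -> bool) :
  measurable_fun setT b -> measurable_fun setT (fun w => (b w)%:R%:E : \bar R).
Proof.
move=> mb; rewrite (_ : (fun _ => _) = (fun w => if b w then 1 else 0 : \bar R)%E).
  exact: measurable_fun_ifT.
by apply/funext => w; case: (b w).
Qed.

Lemma markov_ge d (T : measurableType d) (R : realType)
    (mu : {measure set T -> \bar R})
    (f : T -> \bar R) (c : R) (A : set T) : measurable A -> measurable_fun setT f ->
  (forall w, 0 <= f w)%E -> (0 <= c)%R -> (forall w, A w -> c%:E <= f w)%E ->
  (c%:E * mu A <= \int[mu]_w f w)%E.
Proof.
move=> mA mf f0 c0 Ac; rewrite -integral_cst//.
apply: (@le_trans _ _ (\int[mu]_(w in A) f w)%E).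
  apply: ge0_le_integral => //; exact: measurable_funTS.
exact: ge0_subset_integral.
Qed.

Section clock_moments.
Context {R : realType} {d : measure_display} {Omega : measurableType d}.
Context {I : set R} {l r : \bar R} {F : time R -> set_system Omega}
  {P : R -> probability Omega R} {Y : Omega -> cpath R}
  {m : {measure set R -> \bar R}}.
Hypothesis Yd : general_diffusion I l r F P Y m.
Local Open Scope ereal_scope.

Section scale.
Variables (a : R -> R) (h : R).
Hypothesis h0 : (0 <= h)%R.
Hypothesis aok : @scale_ok _ _ _ I P Y a h.

Lemma measurable_durationE x : measurable_fun setT (fun w => (duration a x (Y w))%:E).
Proof. by apply/measurable_EFinP; exact: (measurable_durationY Yd). Qed.

Lemma duration_le_exit_time x f : (duration a x f)%:E <= exit_time a x f.
Proof.
rewrite /duration; have := exit_time_ge0 a x f; by case: (exit_time a x f).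
Qed.

Lemma integral_duration_le x : I x -> \int[P x]_w (duration a x (Y w))%:E <= h%:E.
Proof.
move=> Ix; have [_ _ _] := aok Ix; apply: le_trans; apply: ge0_le_integral => //.
- by move=> w _; rewrite lee_fin duration_ge0.
- exact: measurable_durationE.
- exact: (measurable_exit_timeY Yd).
- by move=> w _; exact: duration_le_exit_time.
Qed.

Lemma integral_duration x : I x -> \int[P x]_w (duration a x (Y w))%:E = \int[P x]_w exit_time a x (Y w).
Proof.
move=> Ix; rewrite (integral_lty Yd aok Ix); last 2 first.
- exact: measurable_durationE.
- by move=> w; rewrite lee_fin duration_ge0.
rewrite [RHS](integral_lty Yd aok Ix); last 2 first.
- exact: (measurable_exit_timeY Yd).
- by move=> w; exact: exit_time_ge0.
by apply: eq_integral => w; rewrite inE/= => wT; rewrite exit_time_fin.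
Qed.

Lemma measurable_clockY (K : pred R) n x : measurable_fun setT (fun w => clock a h K n x (Y w)).
Proof. by apply: (measurable_comp_Y Yd); exact: measurable_clock. Qed.

Lemma integral_clock (K : pred R) n x : I x ->
  \int[P x]_w (clock a h K n x (Y w))%:E <= (n%:R * h)%:E.
Proof.
elim: n x => [|n IH] x Ix /=; first by rewrite integral0 mul0r.
pose G z f := (clock a h K n z f)%:E.
have mG z : measurable_fun setT (G z : wpath R -> \bar R).
  by apply/measurable_EFinP; exact: measurable_clock.
have G0 z f : 0 <= G z f by rewrite lee_fin clock_ge0.
under eq_integral do rewrite EFinD.
rewrite ge0_integralD//; last 4 first.
- by move=> w _; rewrite lee_fin; case: ifP => _; rewrite ?duration_ge0.
- by case: (K x); [exact: measurable_durationE | exact: measurable_cst].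
- by move=> w _; exact: G0.
- exact: (measurable_stepG Yd a x mG).
have -> : (n.+1%:R * h = h + n%:R * h)%R by rewrite -natr1 mulrDl mul1r addrC.
rewrite EFinD; apply: leeD.
  case: (K x) => /=; first exact: integral_duration_le.
  by rewrite integral_prob_cst.
have nh0 : (0 <= n%:R * h)%R by rewrite mulr_ge0.
have := @step_le _ _ _ _ _ _ _ _ _ _ Yd a h aok x (cst 1) G Ix (measurable_cst _)
  (fun=> lee01) mG G0 _ nh0 IH.
rewrite integral_prob_cst !mule1; apply: le_trans.
by rewrite le_eqVlt; apply/orP; left; apply/eqP; apply: eq_integral => w _; rewrite /= mul1e.
Qed.

Lemma measurable_finite_exitsY n x : measurable [set w | finite_exits a n x (Y w)].
Proof.
have := @measurable_finite_exits _ a n x; move=> /(measurable_comp_Y Yd) /(_ measurableT [set true]).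
by rewrite setTI; apply.
Qed.

Lemma finite_exits_ae n x : I x -> P x [set w | finite_exits a n x (Y w)] = 1.
Proof.
have E k z : P z [set w | finite_exits a k z (Y w)] = \int[P z]_w (finite_exits a k z (Y w))%:R%:E.
  rewrite (eq_integral (fun w => (\1_[set w | finite_exits a k z (Y w)] w)%:E)); last first.
    by move=> w _; rewrite indicE; congr (_%:R%:E); apply: congr1; apply/idP/idP; rewrite inE.
  by rewrite integral_indic ?setIT//; exact: measurable_finite_exitsY.
elim: n x => [|n IH] x Ix.
  by rewrite (_ : [set _ | _] = setT) ?(@probability_setT _ _ _ (P x))//; apply/seteqP; split.
have mfn z : measurable_fun setT ((fun f => (finite_exits a n z f)%:R%:E) : wpath R -> \bar R).
  exact: measurable_natbool (measurable_finite_exits a n z).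
have mSn : measurable_fun setT (fun w => (finite_exits a n.+1 x (Y w))%:R%:E : \bar R).
  by apply: measurable_natbool; apply: (measurable_comp_Y Yd); exact: measurable_finite_exits.
rewrite E (integral_lty Yd aok Ix)//.
pose G z f : \bar R := (finite_exits a n z f)%:R%:E.
have G0 z f : 0 <= G z f by rewrite lee_fin.
rewrite (eq_integral (fun w => G (exit_point a x (Y w)) (after_exit a x (Y w)))); last first.
  by move=> w; rewrite inE /= => ->.
rewrite -(integral_lty Yd aok Ix)//; last exact: (measurable_stepG Yd a x mfn).
rewrite (step_half Yd aok Ix mfn G0).
have [_ Im Ip _] := aok Ix.
rewrite -[\int[_]_w G (x + a x)%R _]E -[\int[_]_w G (x - a x)%R _]E !IH// !mule1 -EFinD.
by congr EFin; lra.
Qed.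

(** Each step multiplies the Laplace transform by at most q, either by the
    hypothesis on K or because the step lasts exactly h. *)
Lemma integral_exp_clock (K : pred R) (lam q : R) n x : (0 <= lam)%R -> (0 <= q)%R ->
  (expR (- (lam * h)) <= q)%R ->
  (forall z, I z -> K z -> \int[P z]_w (expR (- (lam * duration a z (Y w))))%:E <= q%:E) ->
  I x -> \int[P x]_w (expR (- (lam * clock a h K n x (Y w))))%:E <= (q ^+ n)%:E.
Proof.
move=> lam0 q0 hq Kq; elim: n x => [|n IH] x Ix /=.
  rewrite mulr0 oppr0 expR0 expr0.
  by rewrite integral_prob_cst.
pose G z f := (expR (- (lam * clock a h K n z f)))%:E.
have mG z : measurable_fun setT (G z : wpath R -> \bar R).
  apply/measurable_EFinP; apply: measurableT_comp => //.
  by apply: measurableT_comp => //; apply: measurable_funM => //; exact: measurable_clock.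
have G0 z f : 0 <= G z f by rewrite lee_fin expR_ge0.
pose g (u : R) := (expR (- (lam * (if K x then u else h))))%:E.
have mg : measurable_fun setT g.
  apply/measurable_EFinP; apply: measurableT_comp => //.
  by apply: measurableT_comp => //; apply: measurable_funM => //; case: (K x).
have qn0 : (0 <= q ^+ n)%R by rewrite exprn_ge0.
have := @step_le _ _ _ _ _ _ _ _ _ _ Yd a h aok x g G Ix mg
  (fun=> expR_ge0 _) mG G0 _ qn0 IH.
rewrite (eq_integral (fun w => (expR (- (lam * ((if K x then duration a x (Y w) else h) +
  clock a h K n (exit_point a x (Y w)) (after_exit a x (Y w))))))%:E)); last first.
  by move=> w _; rewrite /g /G -EFinM -expRD mulrDr opprD.
move=> /le_trans; apply.
rewrite exprSr EFinM; apply: lee_wpmul2l; first by rewrite lee_fin.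
rewrite /g; case: (boolP (K x)) => Kx; first exact: Kq.
by rewrite integral_prob_cst lee_fin.
Qed.

End scale.
End clock_moments.

(** * Tails of one exit time *)

Section tails.
Context {R : realType} {d : measure_display} {Omega : measurableType d}.
Context {I : set R} {l r : \bar R} {F : time R -> set_system Omega}
  {P : R -> probability Omega R} {Y : Omega -> cpath R}
  {m : {measure set R -> \bar R}}.
Hypothesis Yd : general_diffusion I l r F P Y m.
Local Open Scope ereal_scope.

Variables (a : R -> R) (h : R) (x : R).
Hypotheses (h0 : (0 < h)%R) (aok : @scale_ok _ _ _ I P Y a h).
Hypotheses (Ix : I x) (ax : (0 < a x)%R).
Hypothesis exit2 : forall u, (x - a x <= u <= x + a x)%R ->
  \int[P u]_w exit_time a x (Y w) <= (2 * h)%:E.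

Lemma exit_time_before (f : cpath R) (t : R) : (0 <= t)%R -> path_at f 0 = x -> t%:E < exit_time a x f ->
  (x - a x < path_at f t < x + a x)%R.
Proof.
move=> t0 f0; rewrite /exit_time lt_min => /andP[h1 h2].
have nohit c : t%:E < hit_time c f -> forall s, (0 <= s <= t)%R -> path_at f s != c.
  move=> hc s st; apply/eqP => fs; move: hc; rewrite ltNge => /negP; apply.
  by apply/hit_time_leP; exists s.
have fc : {within `[0%R, t], continuous (path_at f)}.
  by apply: continuous_subspaceT; exact: at_continuous.
apply/andP; split; rewrite ltNge; apply/negP => le.
  have [|s sI fs] := @IVT R (path_at f) 0%R t (x - a x)%R t0 fc.
    by rewrite f0 ge_min le_max le orbT/= gerBl ltW.
  by move: (nohit _ h1 s); rewrite fs eqxx => /(_ sI).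
have [|s sI fs] := @IVT R (path_at f) 0%R t (x + a x)%R t0 fc.
  by rewrite f0 ge_min le_max le orbT/= lerDl ltW.
by move: (nohit _ h2 s); rewrite fs eqxx => /(_ sI).
Qed.

Lemma exit_time_shift (f : cpath R) (t : time R) (s : R) : (0 <= s)%R ->
  (s + t%:num)%:E < exit_time a x f -> s%:E < exit_time a x (shift t f).
Proof.
move=> s0; rewrite /exit_time !lt_min => /andP[h1 h2].
have after_exit c : (s + t%:num)%:E < hit_time c f -> s%:E < hit_time c (shift t f).
  rewrite !ltNge; apply: contraNN => /hit_time_leP[u /andP[u0 us] fu].
  apply/hit_time_leP; exists (t%:num + u)%R; last by move: fu; rewrite at_shift ger0_norm.
  by rewrite addr_ge0//= addrC lerD2r.
by rewrite !after_exit.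
Qed.

Lemma measurable_exit_time_gt (s : R) : measurable [set f : wpath R | s%:E < exit_time a x f].
Proof.
rewrite (_ : [set _ | _] = setT `&` (exit_time a x @^-1` `]s%:E, +oo[%classic)).
  by apply: measurable_exit_time => //; exact: emeasurable_itv.
by apply/seteqP; split => f /=; rewrite in_itv/= andbT; [move=> sT|move=> []].
Qed.

(** Markov property at the fixed time t: on {exit_time > t} the path is inside the
    interval, and from there the mean exit time is at most 2 h, so it exceeds s
    with probability at most 2 h / s. *)
Lemma tail_mul (s t : R) : (0 < s)%R -> (0 <= t)%R ->
  P x [set w | (s + t)%:E < exit_time a x (Y w)] <=
  (2 * h / s)%:E * P x [set w | t%:E < exit_time a x (Y w)].
Proof.
move=> s0 t0.
have sT := stopping_cst Yd t0.
pose A := [set w | t%:E < exit_time a x (Y w)].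
pose B := [set f : wpath R | s%:E < exit_time a x f].
have mB : measurable B := measurable_exit_time_gt s.
have mA : measurable A := measurable_preim_Y Yd (measurable_exit_time_gt t).
have FA : F (`|t|%:nng)%R A.
  rewrite -(stageE Yd) (_ : A = ~` [set w | exit_time a x (Y w) <= t%:E]).
    apply: measurableC; rewrite (stageE Yd); apply: (stage_le Yd (stopping_exit_time Yd a x)).
    by rewrite /= ger0_norm.
  by apply/seteqP; split => w /=; rewrite /A/= ltNge => /negP.
have SA : stopped_sigma F (fun=> t%:E) A.
  split => // u; have [tu|ut] := leP t u%:num.
    rewrite (_ : _ `&` _ = A); last by apply/seteqP; split=> w /=; [case | rewrite lee_fin].
    have [_ _ Fle] := gd_filtration Yd; apply: Fle FA.
    by rewrite /= ger0_norm.
  rewrite (_ : _ `&` _ = set0); first by rewrite -(stageE Yd).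
  by apply/seteqP; split => w //= [_]; rewrite lee_fin leNgt ut.
have tE : (at_time (fun _ : Omega => t%:E) = fun=> (`|t|%:nng)%R) by [].
have := gd_strong_markov Yd Ix sT SA mB; rewrite tE.
rewrite (_ : A `&` [set _ | t%:E < +oo] = A); last first.
  by apply/seteqP; split=> w /=; [case | move=> ?; split => //; exact: ltry].
move=> SM.
pose A' := A `&` [set w | path_at (Y w) 0 = x].
have mS := measurable_start Yd x.
have mA' : measurable A' by exact: measurableI.
have PA' (D : set Omega) : measurable D -> P x D = P x (D `&` [set w | path_at (Y w) 0 = x]).
  move=> mD; rewrite (measureDI (P x) mD mS) [X in X + _](_ : _ = 0) ?add0e//.
  by apply: (start_null Yd Ix (measurableD mD mS)) => w [].
apply: (@le_trans _ _ (P x (A `&` [set w | t%:E < +oo /\ B (shift (`|t|%:nng)%R (Y w))]))).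
  apply: le_measure; rewrite ?inE//.
  - exact: (measurable_preim_Y Yd (measurable_exit_time_gt (s + t))).
  - apply: measurableI => //.
    rewrite (_ : [set _ | _] = [set w | B (shift (`|t|%:nng)%R (Y w))]); last first.
      by apply/seteqP; split=> w /=; [case | move=> ?; split => //; exact: ltry].
    rewrite -[X in measurable X]setTI.
    have := measurable_post Yd sT; rewrite /post tE; exact.
  - move=> w /= st; split.
      by rewrite /A/=; apply: le_lt_trans st; rewrite lee_fin lerDr ltW.
    split; first exact: ltry.
    apply: (exit_time_shift (t := (`|t|%:nng)%R)); first exact: ltW.
    by move: st; rewrite /= ger0_norm.
rewrite SM.
have bnd u : (x - a x <= u <= x + a x)%R -> I u -> P u (Y @^-1` B) <= (2 * h / s)%:E.
  move=> ux Iu; rewrite -(@lee_pmul2l _ s%:E)// -EFinM mulrC mulfVK ?gt_eqF//.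
  apply: le_trans (exit2 ux).
  apply: (@markov_ge _ _ _ (P u) (fun w => exit_time a x (Y w)) s (Y @^-1` B) _ _ _ (ltW s0)).
  - exact: (measurable_preim_Y Yd mB).
  - exact: (measurable_exit_timeY Yd).
  - by move=> w; exact: exit_time_ge0.
  - by move=> w /= /ltW.
rewrite (PA' A mA) -/A' -integral_cst//.
have mk : measurable_fun setT (fun w => P (path_at (Y w) t) (Y @^-1` B)).
  have mPI := gd_kernel Yd mB.
  have mI := measurable_interior Yd.
  pose k := (fun y => P y (Y @^-1` B)) \_ I.
  have mk : measurable_fun setT k by apply/(measurable_restrictT _ mI).
  have := measurableT_comp mk (measurable_at_Y Yd t).
  apply: eq_measurable_fun => w _ /=; rewrite /k patchE.
  by rewrite mem_set//; exact: (at_I Yd).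
rewrite (@ge0_negligible_integral _ _ _ (P x) A (~` [set w | path_at (Y w) 0 = x]))//.
- rewrite (_ : A `\` _ = A'); last by rewrite setDE setCK.
  apply: ge0_le_integral => //.
  - exact: measurable_funTS mk.
  - move=> w [wA w0]; apply: bnd; last exact: (at_I Yd).
    by have /andP[h1 h2] := exit_time_before t0 w0 wA; apply/andP; split; exact: ltW.
- exact: measurableC.
- exact: measurable_funTS mk.
- exact: (start_atC Yd).
Qed.

Let X : {RV (P x) >-> R} :=
  HB.pack (fun w => duration a x (Y w)) (isMeasurableFun.Build _ _ _ _ _ (measurable_durationY Yd a x)).

(** Layer cake: E (X - k h)^+ is the integral of P (X > k h + s) over s > 0, which
    by [tail_mul] is at most 2/k times the integral of P (X > s), that is, 2/k
    times E X <= h. *)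
Lemma tail_excess (k : R) : (0 < k)%R ->
  \int[P x]_w (Num.max (duration a x (Y w) - k * h) 0)%:E <= (2 * h / k)%:E.
Proof.
move=> k0.
have mX' : measurable_fun setT (fun w => Num.max (duration a x (Y w) - k * h) 0 : R)%R.
  by apply: measurable_maxr => //; apply: measurable_funB => //; exact: (measurable_durationY Yd).
pose X' : {RV (P x) >-> R} :=
  HB.pack (fun w => Num.max (duration a x (Y w) - k * h) 0)%R (isMeasurableFun.Build _ _ _ _ _ mX').
have -> : \int[P x]_w (Num.max (duration a x (Y w) - k * h) 0)%:E = 'E_(P x)[X'] by rewrite unlock.
rewrite ge0_expectation_ccdf; last by move=> w; rewrite /= le_max lexx orbT.
have EX : 'E_(P x)[X] <= h%:E.
  by rewrite unlock; exact: (integral_duration_le Yd aok Ix).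
have k2 : (0 <= 2 / k)%R by rewrite divr_ge0// ltW.
apply: (@le_trans _ _ ((2 / k)%:E * 'E_(P x)[X])); last first.
  apply: (@le_trans _ _ ((2 / k)%:E * h%:E)); first exact: lee_wpmul2l.
  by rewrite -EFinM lee_fin mulrAC.
rewrite ge0_expectation_ccdf; last by move=> w; exact: duration_ge0.
have gtE (s : R) : (0 <= s)%R -> P x [set w | s%:E < exit_time a x (Y w)] =
    P x [set w | (s < duration a x (Y w))%R].
  move=> s0.
  have [A1 A2] : measurable [set w | s%:E < exit_time a x (Y w)] /\
      measurable [set w | (s < duration a x (Y w))%R].
    split; first exact: (measurable_preim_Y Yd (measurable_exit_time_gt s)).
    rewrite -[X in measurable X]setTI; apply: measurable_fun_ltr => //.
    exact: (measurable_durationY Yd).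
  have Tm := measurable_finite Yd (stopping_exit_time Yd a x).
  have null (D : set Omega) : measurable D -> P x D = P x (D `&` [set w | exit_time a x (Y w) < +oo]).
    move=> mD; rewrite (measureDI (P x) mD Tm) [X in X + _](_ : _ = 0) ?add0e//.
    apply: (@subset_measure0 _ _ _ (P x) _ (~` [set w | exit_time a x (Y w) < +oo])).
    - exact: measurableD.
    - exact: measurableC.
    - by move=> w [].
    - have e := @probability_setC _ _ _ (P x) _ Tm.
      by rewrite (exit_time_lty Yd aok Ix) subee// in e; exact: e.
  rewrite (null _ A1) [RHS](null _ A2); congr (P x _); apply/seteqP; split => w /= [].
    by move=> sT wT; split => //; rewrite (exit_time_fin wT) lte_fin in sT.
  by move=> sT wT; split => //; rewrite (exit_time_fin wT) lte_fin.
rewrite -ge0_integralZl//; last by apply: measurable_funTS; exact: ccdf_measurable.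
apply: ge0_le_integral => //.
- by apply: measurable_funTS; exact: ccdf_measurable.
- apply: measurable_funTS; apply: measurable_funeM; exact: ccdf_measurable.
- move=> s /=; rewrite in_itv/= andbT => s0.
  rewrite /ccdf /distribution /pushforward/=.
  rewrite (_ : _ @^-1` _ = [set w | (k * h + s < duration a x (Y w))%R]); last first.
    apply/seteqP; split => w /=; rewrite in_itv/= andbT lt_max ltrBrDl.
      by case/orP => //; rewrite ltNge s0.
    by move=> ->.
  rewrite [X in _ <= _ * X](_ : _ = P x [set w | (s < duration a x (Y w))%R]); last first.
    by congr (P x _); apply/seteqP; split => w /=; rewrite in_itv/= andbT.
  have kh0 : (0 < k * h)%R by rewrite mulr_gt0.
  have := tail_mul kh0 s0; rewrite (_ : (2 * h / (k * h) = 2 / k)%R); last first.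
    by rewrite invfM mulrACA divff ?mulr1// gt_eqF.
  have ks0 : (0 <= k * h + s)%R by rewrite addr_ge0// ltW.
  by rewrite (gtE _ ks0) (gtE _ s0); exact.
Qed.

End tails.

(** * Law of large numbers for the clock *)

Section deviations.
Context {R : realType} {d : measure_display} {Omega : measurableType d}.
Context {I : set R} {l r : \bar R} {F : time R -> set_system Omega}
  {P : R -> probability Omega R} {Y : Omega -> cpath R}
  {m : {measure set R -> \bar R}}.
Hypothesis Yd : general_diffusion I l r F P Y m.
Local Open Scope ereal_scope.

(** The properties of a scale factor on which the law of large numbers for the
    clock rests; Chernoff bounds need the tail control of [gs_exit2], and [gs_exact]
    is available only away from the boundary. *)
Record good_scale (a : R -> R) (h : R) (K : pred R) : Prop := GoodScale {
  gs_ok : @scale_ok _ _ _ I P Y a h ;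
  gs_exit2 : forall x, I x -> (0 < a x)%R -> forall u, (x - a x <= u <= x + a x)%R ->
    \int[P u]_w exit_time a x (Y w) <= (2 * h)%:E ;
  gs_exact : forall x, I x -> K x -> (0 < a x)%R /\ \int[P x]_w exit_time a x (Y w) = h%:E
}.

(** Apply exp (- u) <= 1 - u + u^2 to lam times the duration truncated at k h. The
    truncation costs at most lam E (duration - k h)^+ <= lam (2 h / k), while the
    mean duration contributes - lam h. *)
Lemma exp_duration a h K (lam k x : R) : (0 < h)%R -> good_scale a h K -> (0 < lam)%R ->
  (0 < k)%R -> I x -> K x ->
  \int[P x]_w (expR (- (lam * duration a x (Y w))))%:E <=
  (1 - lam * (h - 2 * h / k) + (lam * (k * h)) ^+ 2)%:E.
Proof.
move=> h0 [aok e2 ex] lam0 k0 Ix Kx; have [ax Eh] := ex x Ix Kx.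
have mr := measurable_durationY Yd a x.
have mexp : measurable_fun setT (fun w => (expR (- (lam * duration a x (Y w))))%:E).
  apply/measurable_EFinP; apply: measurableT_comp => //.
  by apply: measurableT_comp => //; apply: measurable_funM.
have mmax : measurable_fun setT (fun w => (Num.max (duration a x (Y w) - k * h) 0)%:E : \bar R).
  by apply/measurable_EFinP; apply: measurable_maxr => //; exact: measurable_funB.
have max0 w : (0 <= Num.max (duration a x (Y w) - k * h) 0)%R by rewrite le_max lexx orbT.
have kh0 : (0 < k * h)%R by rewrite mulr_gt0.
have pt w : ((expR (- (lam * duration a x (Y w))))%:E + lam%:E * (duration a x (Y w))%:E) <=
   (1 + (lam * (k * h)) ^+ 2)%:E + lam%:E * (Num.max (duration a x (Y w) - k * h) 0)%:E.
  rewrite -!EFinM -!EFinD lee_fin.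
  have := duration_ge0 a x (Y w); move: (duration a x (Y w)) => u u0.
  have [le|lt] := leP u (k * h)%R.
    rewrite max_r ?subr_le0// mulr0 addr0.
    have lu : (0 <= lam * u)%R by rewrite mulr_ge0// ltW.
    have := expRN_le lu.
    have : ((lam * u) ^+ 2 <= (lam * (k * h)) ^+ 2)%R.
      by rewrite ler_sqr ?nnegrE// ?ler_pM2l// mulr_ge0 ?ltW.
    by lra.
  rewrite max_l ?subr_ge0 ?(ltW lt)//.
  have lu : (0 <= lam * (k * h))%R by rewrite mulr_ge0// ltW.
  have := expRN_le lu.
  have : (expR (- (lam * u)) <= expR (- (lam * (k * h))))%R.
    by rewrite ler_expR lerN2 ler_pM2l// ltW.
  by rewrite mulrBr; lra.
have : \int[P x]_w (expR (- (lam * duration a x (Y w))))%:E + lam%:E * h%:E <=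
    (1 + (lam * (k * h)) ^+ 2)%:E + lam%:E * (2 * h / k)%:E.
  rewrite -Eh -(integral_duration Yd aok Ix) -ge0_integralZl//; last 3 first.
  - exact: (measurable_durationE Yd).
  - by move=> w _; rewrite lee_fin duration_ge0.
  - by rewrite lee_fin ltW.
  rewrite -ge0_integralD//; last 2 first.
  - by move=> w _; rewrite -EFinM lee_fin mulr_ge0 ?duration_ge0// ltW.
  - by apply: emeasurable_funM => //; exact: (measurable_durationE Yd).
  apply: (@le_trans _ _ (\int[P x]_w ((1 + (lam * (k * h)) ^+ 2)%:E +
     lam%:E * (Num.max (duration a x (Y w) - k * h) 0)%:E))).
    apply: ge0_le_integral => //.
    - by move=> w _; rewrite adde_ge0 ?mule_ge0 ?lee_fin ?expR_ge0 ?duration_ge0 ?(ltW lam0).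
    - by apply: emeasurable_funD => //; apply: emeasurable_funM => //; exact: (measurable_durationE Yd).
    - by apply: emeasurable_funD => //; apply: emeasurable_funM.
  have c0 : (0 <= 1 + (lam * (k * h)) ^+ 2)%R by rewrite addr_ge0// sqr_ge0.
  rewrite ge0_integralD//; last 2 first.
  - by move=> w _; rewrite -EFinM lee_fin mulr_ge0 ?max0// ltW.
  - by apply: emeasurable_funM.
  rewrite integral_prob_cst leeD2l// ge0_integralZl//; last 2 first.
  - by move=> w _; rewrite lee_fin max0.
  - by rewrite lee_fin ltW.
  rewrite lee_wpmul2l// ?lee_fin ?(ltW lam0)//.
  exact: (tail_excess Yd h0 aok Ix ax (e2 x Ix ax) k0).
rewrite -!EFinM -EFinD -leeBrDr// -EFinB => /le_trans; apply.
by rewrite lee_fin; lra.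
Qed.

(** Chernoff bound. The exponent n log q + lam n h - lam e is at most
    lam (2 T / k) + T h (lam k)^2 - lam e; k makes the first term lam e / 4, h1
    makes the second at most lam e / 4, and lam e = 2 / eta leaves at most
    - 1 / eta, where exp (- 1 / eta) <= eta. *)
Lemma clock_lower (T e eta : R) : (0 < T)%R -> (0 < e)%R -> (0 < eta)%R ->
  exists2 h1, (0 < h1)%R & forall a h K, (0 < h < h1)%R -> good_scale a h K ->
  forall n x, I x -> (n%:R * h <= T)%R ->
  P x [set w | (clock a h K n x (Y w) <= n%:R * h - e)%R] <= eta%:E.
Proof.
move=> T0 e0 eta0.
pose lam := (2 / (e * eta))%R; pose k := (8 * T / e)%R.
have lam0 : (0 < lam)%R by rewrite divr_gt0// mulr_gt0.
have k0 : (0 < k)%R by rewrite divr_gt0// mulr_gt0.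
pose h1 := (e / (4 * T * lam * k ^+ 2))%R.
have den0 : (0 < 4 * T * lam * k ^+ 2)%R.
  by apply: mulr_gt0; [apply: mulr_gt0 => //; exact: mulr_gt0 | exact: exprn_gt0].
exists h1; first by rewrite divr_gt0.
move=> a h K /andP[h0 hh1] gs n x Ix nT.
pose z := (- (lam * (h - 2 * h / k)) + (lam * (k * h)) ^+ 2)%R.
have q0 : (0 <= expR z)%R by rewrite expR_ge0.
have hq : (expR (- (lam * h)) <= expR z)%R.
  rewrite ler_expR /z.
  have : (0 <= lam * (2 * h / k))%R.
    apply: mulr_ge0; first exact: ltW.
    by apply: divr_ge0; [apply: mulr_ge0 => //; exact: ltW | exact: ltW].
  have : (0 <= (lam * (k * h)) ^+ 2)%R by rewrite sqr_ge0.
  by rewrite mulrBr; lra.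
have Kq y : I y -> K y -> \int[P y]_w (expR (- (lam * duration a y (Y w))))%:E <= (expR z)%:E.
  move=> Iy Ky; apply: le_trans (exp_duration h0 gs lam0 k0 Iy Ky) _.
  by rewrite lee_fin; apply: le_trans (expR_ge1Dx z); rewrite /z addrA.
have := integral_exp_clock Yd (gs_ok gs) n (ltW lam0) q0 hq Kq Ix.
pose c := expR (- (lam * (n%:R * h - e))).
pose A := [set w | (clock a h K n x (Y w) <= n%:R * h - e)%R].
have mc := measurable_clockY Yd a h K n x.
have mA : measurable A.
  by rewrite -[X in measurable X]setTI; exact: measurable_fun_ler.
have : c%:E * P x A <= \int[P x]_w (expR (- (lam * clock a h K n x (Y w))))%:E.
  apply: markov_ge => //.
  - apply/measurable_EFinP; apply: measurableT_comp => //.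
    by apply: measurableT_comp => //; apply: measurable_funM.
  - exact: expR_ge0.
  - by move=> w wA; rewrite lee_fin ler_expR lerN2 ler_pM2l.
move=> /le_trans /[apply].
rewrite -lee_pdivlMl ?expR_gt0// => /le_trans; apply.
rewrite -EFinM lee_fin /c -expRN opprK -expRM_natl -expRD.
apply: (@le_trans _ _ (expR (- eta^-1))); last first.
  rewrite expRN -[leRHS]invrK lef_pV2 ?posrE ?expR_gt0 ?invr_gt0//.
  by apply: le_trans (expR_ge1Dx _); rewrite lerDr.
rewrite ler_expR /z.
have le1 : (lam * e = 2 / eta)%R.
  by rewrite /lam invfM mulrA -!mulrA [(eta^-1 * e)%R]mulrC [(e^-1 * _)%R]mulrA mulVf ?gt_eqF// mul1r.
have Tk : (lam * (2 * T / k) = lam * e / 4)%R.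
  by rewrite /k; field; rewrite !gt_eqF.
have Th : (T * h * (lam * k) ^+ 2 <= lam * e / 4)%R.
  have : (h * (4 * T * lam * k ^+ 2) <= e)%R by rewrite -ler_pdivlMr// ltW.
  move=> /(ler_wpM2l (ltW lam0)); rewrite [X in (X <= _)%R -> _](_ : _ = 4 * (T * h * (lam * k) ^+ 2))%R; last by ring.
  by lra.
have n1 : (lam * (2 * (n%:R * h) / k) <= lam * (2 * T / k))%R.
  by rewrite ler_pM2l// ler_pM2r ?invr_gt0// ler_pM2l.
have n2 : ((n%:R * h) * h * (lam * k) ^+ 2 <= T * h * (lam * k) ^+ 2)%R.
  by rewrite ler_wpM2r ?sqr_ge0// ler_pM2r.
rewrite [leLHS](_ : _ = lam * (2 * (n%:R * h) / k) + (n%:R * h) * h * (lam * k) ^+ 2 - lam * e)%R; last by ring.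
by move: le1 Tk Th n1 n2; lra.
Qed.

(** Since E clock <= n h, the expected excess over n h is at most the expected
    deficit. The deficit is at most n h <= T and by [clock_lower] exceeds
    e1 = e eta / 4 with probability at most e1 / T, so its mean is at most
    2 e1 = e eta / 2; Markov's inequality then bounds upper deviations by eta / 2. *)
Lemma clock_dev (T e eta : R) : (0 < T)%R -> (0 < e)%R -> (0 < eta)%R ->
  exists2 h1, (0 < h1)%R & forall a h K, (0 < h < h1)%R -> good_scale a h K ->
  forall n x, I x -> (n%:R * h <= T)%R ->
  P x [set w | (e < `|clock a h K n x (Y w) - n%:R * h|)%R] <= eta%:E.
Proof.
move=> T0 e0 eta0.
have e10 : (0 < e * eta / 4)%R by rewrite divr_gt0// mulr_gt0.
have et10 : (0 < e * eta / 4 / T)%R by rewrite divr_gt0.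
have eta2 : (0 < eta / 2)%R by rewrite divr_gt0.
have [h1 h10 H1] := clock_lower T0 e10 et10.
have [h2 h20 H2] := clock_lower T0 e0 eta2.
exists (Num.min h1 h2); first by rewrite lt_min h10.
move=> a h K; rewrite lt_min => /andP[h0 /andP[hh1 hh2]] gs n x Ix nT.
have {}H1 := H1 a h K; rewrite h0 hh1 in H1; have {}H1 := H1 isT gs n x Ix nT.
have {}H2 := H2 a h K; rewrite h0 hh2 in H2; have {}H2 := H2 isT gs n x Ix nT.
set e1 := (e * eta / 4)%R in e10 et10 H1.
have mc := measurable_clockY Yd a h K n x.
have mcle (u : R) : measurable [set w | (clock a h K n x (Y w) <= u)%R].
  by rewrite -[X in measurable X]setTI; exact: measurable_fun_ler.
have mcge (u : R) : measurable [set w | (u <= clock a h K n x (Y w))%R].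
  by rewrite -[X in measurable X]setTI; exact: measurable_fun_ler.
have nh0 : (0 <= n%:R * h)%R by rewrite mulr_ge0// ltW.
pose up w := (Num.max (clock a h K n x (Y w) - n%:R * h) 0)%:E : \bar R.
pose dn w := (Num.max (n%:R * h - clock a h K n x (Y w)) 0)%:E : \bar R.
have mup : measurable_fun setT up.
  by apply/measurable_EFinP; apply: measurable_maxr => //; exact: measurable_funB.
have mdn : measurable_fun setT dn.
  by apply/measurable_EFinP; apply: measurable_maxr => //; exact: measurable_funB.
have up0 w : 0 <= up w by rewrite lee_fin le_max lexx orbT.
have dn0 w : 0 <= dn w by rewrite lee_fin le_max lexx orbT.
have updn : \int[P x]_w up w <= \int[P x]_w dn w.
  have : (n%:R * h)%:E + \int[P x]_w up w <= (n%:R * h)%:E + \int[P x]_w dn w.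
    apply: (@le_trans _ _ (\int[P x]_w (clock a h K n x (Y w))%:E + \int[P x]_w dn w)).
      rewrite -ge0_integralD//; last 2 first.
      - by move=> w _; rewrite lee_fin clock_ge0// ltW.
      - by apply/measurable_EFinP.
      rewrite -[X in X + _](integral_prob_cst (P x)) -ge0_integralD//.
      rewrite le_eqVlt; apply/orP; left; apply/eqP; apply: eq_integral => w _.
      rewrite /up /dn -!EFinD; congr EFin.
      have [le|/ltW le] := leP (n%:R * h)%R (clock a h K n x (Y w)).
        by rewrite max_l ?subr_ge0// max_r ?subr_le0//; lra.
      by rewrite max_r ?subr_le0// max_l ?subr_ge0//; lra.
    rewrite leeD2r//; exact: (integral_clock Yd (ltW h0) (gs_ok gs)).
  by rewrite leeD2lE.
have Edn : \int[P x]_w dn w <= (2 * e1)%:E.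
  apply: (@le_trans _ _ (\int[P x]_w (e1%:E +
    T%:E * (\1_[set w | (clock a h K n x (Y w) <= n%:R * h - e1)%R] w)%:E))).
    have mi : measurable_fun setT (fun w => T%:E *
        (\1_[set w | (clock a h K n x (Y w) <= n%:R * h - e1)%R] w)%:E).
      by apply: emeasurable_funM => //; apply/measurable_EFinP; exact: measurable_indic.
    apply: ge0_le_integral => //; first by apply: emeasurable_funD.
    move=> w _; rewrite /dn indicE -EFinM -EFinD lee_fin.
    have c0 := @clock_ge0 R a h K n x (Y w) (ltW h0).
    have [le|lt] := leP (clock a h K n x (Y w)) (n%:R * h - e1)%R.
      rewrite mem_set// mulr1 ge_max; apply/andP; split; lra.
    rewrite memNset/=; last by apply/negP; rewrite -ltNge.
    by rewrite mulr0 addr0 ge_max; apply/andP; split; lra.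
  rewrite ge0_integralD//; last 3 first.
  - by move=> w _; rewrite lee_fin ltW.
  - by move=> w _; rewrite -EFinM lee_fin mulr_ge0// ltW.
  - by apply: emeasurable_funM => //; apply/measurable_EFinP; exact: measurable_indic.
  rewrite integral_prob_cst ge0_integralZl//; last 2 first.
  - by apply/measurable_EFinP; exact: measurable_indic.
  - by rewrite lee_fin ltW.
  rewrite integral_indic// setIT.
  rewrite mulr2n mulrDl mul1r EFinD leeD2l//.
  apply: (@le_trans _ _ (T%:E * (e1 / T)%:E)); first by rewrite lee_wpmul2l// lee_fin ltW.
  by rewrite -EFinM lee_fin mulrC divfK// gt_eqF.
have Pup : P x [set w | (n%:R * h + e <= clock a h K n x (Y w))%R] <= (eta / 2)%:E.
  rewrite -(@lee_pmul2l _ e%:E)//; apply: (@le_trans _ _ (\int[P x]_w up w)).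
    apply: markov_ge => //; first exact: ltW.
    by move=> w /= le; rewrite /up lee_fin le_max lerBrDl le.
  apply: (le_trans updn); apply: (le_trans Edn).
  by rewrite -EFinM lee_fin /e1; lra.
apply: (@le_trans _ _ (P x ([set w | (clock a h K n x (Y w) <= n%:R * h - e)%R] `|`
   [set w | (n%:R * h + e <= clock a h K n x (Y w))%R]))).
  apply: le_measure; rewrite ?inE//; last 2 first.
  - exact: measurableU.
  - move=> w /=; rewrite lter_normr => /orP[] lt; [right|left]; lra.
  rewrite -[X in measurable X]setTI; apply: measurable_fun_ltr => //.
  by apply: measurableT_comp => //; exact: measurable_funB.
apply: le_trans (measureU2 _ _ _) _ => //.
apply: le_trans (leeD H2 Pup) _.
by rewrite -EFinD lee_fin; lra.
Qed.

End deviations.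

(** * Absorption and the pathwise coupling *)

Lemma prob_exhaust d (T : measurableType d) (R : realType) (mu : probability T R)
    (A : (set T)^nat) (S : set T) (e : R) :
  (forall n, measurable (A n)) -> {homo A : n k / (n <= k)%N >-> n `<=` k} ->
  measurable S -> mu S = 1%E -> S `<=` \bigcup_n A n -> 0 < e ->
  exists n, (mu (~` A n) <= e%:E)%E.
Proof.
move=> mA ndA mS S1 SA e0.
have mUA : measurable (\bigcup_n A n) by exact: bigcupT_measurable.
have c : (fun n => mu (A n)) @ \oo --> mu (\bigcup_n A n).
  by apply: nondecreasing_cvg_mu => // n k nk; apply/subsetPset; exact: ndA.
have UA1 : mu (\bigcup_n A n) = 1%E.
  apply/eqP; rewrite eq_le probability_le1//= -S1.
  by apply: le_measure; rewrite ?inE.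
rewrite UA1 in c.
have /fine_cvgP[_ c1] := c.
have /cvgrPdist_lt/(_ e e0)[n _ /(_ n (leqnn n)) /= h] := c1.
exists n; have -> : mu (~` A n) = (1 - mu (A n))%E by exact: probability_setC.
have fA : mu (A n) \is a fin_num.
  by rewrite ge0_fin_numE// (le_lt_trans (probability_le1 mu (mA n)))// ltry.
move: h; rewrite -[in X in _ -> X](fineK fA) -EFinB lee_fin.
by rewrite ltr_norml => /andP[_ /ltW].
Qed.

Section absorption.
Context {R : realType} {d : measure_display} {Omega : measurableType d}.
Context {I : set R} {l r : \bar R} {F : time R -> set_system Omega}
  {P : R -> probability Omega R} {Y : Omega -> cpath R}
  {m : {measure set R -> \bar R}}.
Hypothesis Yd : general_diffusion I l r F P Y m.
Local Open Scope ereal_scope.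

Lemma interiorE x : I° x <-> l < x%:E < r.
Proof. by have [_ _ ->] := gd_state_space Yd. Qed.

Lemma interval_between x y z : I x -> I z -> (x <= y <= z)%R -> I y.
Proof. by have [_ + _] := gd_state_space Yd => /[apply] /[apply]; exact. Qed.

Lemma interior_I x : I° x -> I x.
Proof. exact: interior_subset. Qed.

Lemma interior_between u v x : I u -> I v -> (u < x < v)%R -> I° x.
Proof.
move=> Iu Iv uxv; rewrite /interior /=.
have : nbhs x `]u, v[%classic.
  by apply: open_nbhs_nbhs; split; [exact: interval_open | rewrite /= in_itv].
apply: filterS => z /=; rewrite in_itv/= => /andP[/ltW h1 /ltW h2].
by apply: (interval_between Iu Iv); rewrite h1.
Qed.

Lemma boundaryP c : I c -> ~ I° c -> c%:E = l \/ c%:E = r.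
Proof.
move=> Ic nIc; have [lr _ _] := gd_state_space Yd.
have [z0 Iz0] : exists z, I° z.
  move: lr (interiorE); case: l => [l'| |]; case: r => [r'| |]//.
  - rewrite lte_fin => lr H; exists ((l' + r') / 2)%R; apply/H; rewrite !lte_fin.
    by apply/andP; split; lra.
  - by move=> _ H; exists (l' + 1)%R; apply/H; rewrite lte_fin ltry ltrDl ltr01.
  - by move=> _ H; exists (r' - 1)%R; apply/H; rewrite lte_fin ltNyr/= gtrBl ltr01.
  - by move=> _ H; exists 0%R; apply/H; rewrite ltNyr ltry.
have /interiorE/andP[lz zr] := Iz0.
have [lc|cl] := ltP l c%:E.
  have [cr|rc] := ltP c%:E r; first by exfalso; apply: nIc; apply/interiorE; rewrite lc.
  right; apply/eqP; rewrite eq_le rc andbT leNgt; apply/negP => rc'.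
  have [r' er] : exists r', r = r'%:E.
    by move: zr rc'; case: r => [r'| |]//; exists r'.
  rewrite er !lte_fin in zr rc'.
  have /interiorE : I° r' by apply: (interior_between (interior_I Iz0) Ic); rewrite zr.
  by rewrite er ltxx andbF.
left; apply/eqP; rewrite eq_le cl/= leNgt; apply/negP => rc'.
have [r' er] : exists r', l = r'%:E.
  by move: lz rc'; case: l => [r'| |]//; exists r'.
rewrite er !lte_fin in lz rc'.
have /interiorE : I° r' by apply: (interior_between Ic (interior_I Iz0)); rewrite rc'.
by rewrite er ltxx.
Qed.

Lemma measurable_cst_path (c : R) : measurable [set f : wpath R | forall t, ev f t = c].
Proof.
rewrite (_ : [set _ | _] = \bigcap_i \bigcap_j (setT `&`
   (fun f : wpath R => path_at f (i%:R / j.+1%:R)) @^-1` [set c])).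
  apply: bigcapT_measurable => i; apply: bigcapT_measurable => j.
  by apply: measurable_at_path.
apply/seteqP; split => f /= H; first by move=> i _ j _; split => //=; exact: H.
move=> t; rewrite evE_at.
have t0 : (0 <= t%:num :> R)%R by [].
have c1 := @at_grid_floor_cvg _ f _ t0.
have : (fun n => path_at f (grid_floor n t%:num)) @ \oo --> c.
  rewrite (_ : (fun _ => _) = cst c); first exact: cvg_cst.
  by apply/funext => n; have [_] := H (Num.truncn (t%:num * n.+1%:R)) Logic.I n Logic.I.
by move=> /(cvg_unique _ c1); apply.
Qed.

(** Strong Markov property at the hitting time of c: the path after it has the law
    P_c, under which Y stays at c if c is a boundary point. *)
Lemma absorb_at y c : I y -> exists S : set Omega, [/\ measurable S, P y S = 1 &
  forall w, S w -> forall s t, (0 <= s <= t)%R -> ~ I° (path_at (Y w) s) ->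
    path_at (Y w) s = c -> path_at (Y w) t = c].
Proof.
move=> Iy.
have [[Ic nIc]|nbd] := pselect (I c /\ ~ I° c); last first.
  exists setT; split => //; first exact: probability_setT.
  by move=> w _ s t _ nI ec; exfalso; apply: nbd; rewrite -ec; split => //; exact: (at_I Yd).
have sT := stopping_hit_time Yd c.
pose tau w := hit_time c (Y w).
pose B : set (wpath R) := ~` [set f : wpath R | forall t, ev f t = c].
have mB : measurable B by apply: measurableC; exact: measurable_cst_path.
have PB : P c (Y @^-1` B) = 0.
  have e := gd_absorbing Yd Ic (boundaryP Ic nIc).
  have mC := measurable_preim_Y Yd (measurable_cst_path c).
  have := @probability_setC _ _ _ (P c) _ mC.
  by rewrite (_ : P c (Y @^-1` _) = 1)// subee// => ->.
have SA := stopped_fine Yd sT measurableT.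
have := gd_strong_markov Yd Iy sT SA mB.
set A := (X in P y (X `&` _)); set D := (X in P y X).
have mA : measurable A by case: SA.
have mD : measurable D.
  apply: measurableI => //; apply: measurableI; first exact: (measurable_finite Yd sT).
  by rewrite -[X in measurable X]setTI; exact: (measurable_post Yd sT).
have mfin : measurable [set w | hit_time c (Y w) < +oo] := measurable_finite Yd sT.
rewrite (eq_integral (cst 0)); last first.
  move=> w; rewrite inE => -[_ /= wT].
  have -> : ev (Y w) (at_time (fun w => hit_time c (Y w)) w) = c by exact: at_hit_time wT.
  exact: PB.
rewrite integral_cst ?mul0e; last exact: measurableI.
move=> PD.
exists (~` D); split; first exact: measurableC.
  have := @probability_setC _ _ _ (P y) _ mD.
  by rewrite (_ : P y D = 0)// sube0.
move=> w nD s t /andP[s0 st] _ ec.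
have ht := hit_time_le s0 ec.
have wT : hit_time c (Y w) < +oo by rewrite (le_lt_trans ht)// ltry.
have : ~ B (post (Y := Y) (fun w => hit_time c (Y w)) w).
  by move=> wB; apply: nD; split; split.
move=> /contrapT H; have : path_at (post (Y := Y) (fun w => hit_time c (Y w)) w) (t - fine (hit_time c (Y w)))%R = c.
  exact: (H (`|t - fine (hit_time c (Y w))|%:nng)%R).
rewrite (at_post sT) ger0_norm; first by rewrite addrC subrK.
by rewrite subr_ge0 -lee_fin -(stopping_fine sT wT) (le_trans ht)// lee_fin.
Qed.

(** A point of I outside its interior is l or r, so the null sets of [absorb_at]
    for these two values are enough. *)
Lemma absorbing y : I y -> exists S : set Omega, [/\ measurable S, P y S = 1 &
  forall w, S w -> forall s t, (0 <= s)%R -> (s <= t)%R -> ~ I° (path_at (Y w) s) ->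
    path_at (Y w) t = path_at (Y w) s].
Proof.
move=> Iy; have [S1 [mS1 PS1 H1]] := absorb_at (fine l) Iy.
have [S2 [mS2 PS2 H2]] := absorb_at (fine r) Iy.
have PC1 : P y (~` S1) = 0.
  by have := @probability_setC _ _ _ (P y) _ mS1; rewrite PS1 subee.
have PC2 : P y (~` S2) = 0.
  by have := @probability_setC _ _ _ (P y) _ mS2; rewrite PS2 subee.
have mS : measurable (S1 `&` S2) by exact: measurableI.
exists (S1 `&` S2); split => //.
  have : P y (~` (S1 `&` S2)) = 0.
    apply/eqP; rewrite -measure_le0 setCI.
    have := measureU2 (P y) (measurableC mS1) (measurableC mS2).
    by rewrite [X in _ <= X](_ : _ = 0)//; rewrite [X in X + _](_ : _ = 0) ?add0e.
  have := @probability_setC _ _ _ (P y) _ (measurableC mS).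
  by rewrite setCK => -> ->; rewrite sube0.
move=> w [w1 w2] s t s0 st nI.
have st0 : (0 <= s <= t)%R by rewrite s0.
have [e|e] := boundaryP (at_I Yd w s) nI.
  by rewrite [RHS](_ : _ = fine l); [apply: (H1 w w1 s t st0 nI) |]; rewrite -e.
by rewrite [RHS](_ : _ = fine r); [apply: (H2 w w2 s t st0 nI) |]; rewrite -e.
Qed.

End absorption.

Section coupling.
Context {R : realType} {d : measure_display} {Omega : measurableType d}.
Context {I : set R} {l r : \bar R} {F : time R -> set_system Omega}
  {P : R -> probability Omega R} {Y : Omega -> cpath R}
  {m : {measure set R -> \bar R}}.
Hypothesis Yd : general_diffusion I l r F P Y m.
Local Open Scope ereal_scope.

Variables (a : R -> R -> R) (k1 k2 : nat -> R).
Hypotheses (kI : forall x, I° x -> exists N, forall n, (N <= n)%N -> (k1 n < x < k2 n)%R)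
  (kmono : forall n k, (n <= k)%N -> (k1 k <= k1 n)%R /\ (k2 n <= k2 k)%R)
  (agood : forall n, exists2 h0, (0 < h0)%R & forall h, (0 < h < h0)%R ->
    @good_scale _ _ _ I P Y (a h) h [pred z | k1 n <= z <= k2 n]%R).

(** Six exceptional events: a bad modulus of continuity, a large move after leaving
    [k1 n2, k2 n2], a true clock beyond M after N steps, a deviation of the
    modified clock at one of the J + 1 grid times, an infinite exit time, and a
    wrong starting point. The first four have probability at most q = eta / 4 each,
    the last two are null. *)
Lemma coupling y (T e eta : R) : I y -> (0 < T)%R -> (0 < e)%R -> (0 < eta)%R ->
  exists2 h0, (0 < h0)%R & forall h, (0 < h < h0)%R ->
  exists A, [/\ measurable A, P y A <= eta%:E &
    forall w, ~ A w -> forall t, (0 <= t <= T)%R ->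
      (`|interp (embedded (a h) y (Y w)) h t - path_at (Y w) t| <= e)%R].
Proof.
move=> Iy T0 e0 eta0.
pose e1 : R := (e / 3)%R; pose q : R := (eta / 4)%R.
have e10 : (0 < e1)%R by rewrite divr_gt0.
have q0 : (0 < q)%R by rewrite divr_gt0.
(* The mean of the clock after N steps is at most N h <= T + 2, so Markov's
   inequality at level M >= (T + 2) / q gives probability at most q. *)
pose M : R := ((T + 2) / q + T + 2)%R.
have [n1 Pmod] : exists n, P y (~` (Y @^-1` mod_ok M n.+1%:R^-1 e1)) <= q%:E.
  apply: (@prob_exhaust _ _ _ _ (fun n => Y @^-1` mod_ok M n.+1%:R^-1 e1) setT) => //.
  - by move=> n; apply: (measurable_preim_Y Yd); exact: measurable_mod_ok.
  - move=> n k nk w; apply: mod_ok_nd; by rewrite lef_pV2 ?posrE// ler_nat ltnS.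
  - exact: probability_setT.
  - by move=> w _; have [n] := mod_ok_ex M (Y w) e10; exists n.
have [n2 Pexit] : exists n, P y (~` (Y @^-1` exit_ok (k1 n) (k2 n) M e1)) <= q%:E.
  have [S [mS PS HS]] := absorbing Yd Iy.
  apply: (@prob_exhaust _ _ _ _ (fun n => Y @^-1` exit_ok (k1 n) (k2 n) M e1) S) => //.
  - by move=> n; apply: (measurable_preim_Y Yd); exact: measurable_exit_ok.
  - by move=> n k nk w; have [h1 h2] := kmono nk; exact: exit_ok_nd.
  - move=> w Sw; have [n] := @exit_ok_ex _ (I°) k1 k2 M e1 (Y w) kI kmono (HS w Sw) e10.
    by exists n.
pose delta : R := (n1.+1%:R^-1 / 4)%R.
have d0 : (0 < delta)%R by rewrite divr_gt0// invr_gt0.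
have d4 : (4 * delta = n1.+1%:R^-1)%R by rewrite /delta mulrC divfK.
pose J := (Num.truncn ((T + 2) / delta)).+1.
have JT : (T + 2 < J%:R * delta)%R by rewrite -ltr_pdivrMr// truncnS_gt.
have JT0 : (0 < J%:R * delta)%R by apply: lt_trans JT; rewrite addr_gt0.
have qJ : (0 < q / J.+1%:R)%R by rewrite divr_gt0.
have [h1 h10 Hdev] := clock_dev Yd JT0 d0 qJ.
have [h2 h20 Hgood] := agood n2.
exists (Num.min (Num.min h1 h2) (Num.min delta 1%R)).
  by rewrite !lt_min h10 h20 d0 ltr01.
move=> h; rewrite !lt_min => /andP[h0 /andP[/andP[hh1 hh2] /andP[hd hlt1]]].
have gs : @good_scale _ _ _ I P Y (a h) h [pred z | k1 n2 <= z <= k2 n2]%R.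
  by apply: Hgood; rewrite h0.
set K := [pred z | _] in gs.
pose N := (Num.truncn ((T + h) / h)).+1.
have TN : (T + h <= N%:R * h)%R by rewrite -ler_pdivrMr// ltW// truncnS_gt.
have NT : (N%:R * h <= T + 2)%R.
  have : ((Num.truncn ((T + h) / h))%:R * h <= T + h)%R.
    by rewrite -ler_pdivlMr// -truncn_ge_nat// divr_ge0 ?ltW// addr_gt0.
  rewrite /N; move: (Num.truncn ((T + h) / h)) => v.
  by rewrite -[v.+1%:R]natr1 mulrDl mul1r; lra.
have M0 : (0 < M - (T + 2))%R.
  rewrite (_ : (M - (T + 2) = (T + 2) / q)%R); last by rewrite /M; ring.
  by rewrite divr_gt0// addr_gt0.
pose kj j := Num.truncn (j%:R * delta / h).
pose A1 := ~` (Y @^-1` mod_ok M n1.+1%:R^-1 e1).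
pose A2 := ~` (Y @^-1` exit_ok (k1 n2) (k2 n2) M e1).
pose A3 := [set w | (M <= clock (a h) h predT N y (Y w))%R].
pose A4 j := [set w | (delta < `|clock (a h) h K (kj j) y (Y w) - (kj j)%:R * h|)%R].
pose A5 := ~` [set w | finite_exits (a h) N y (Y w)].
pose A6 := ~` [set w | path_at (Y w) 0 = y].
have mA1 : measurable A1 by apply: measurableC; apply: (measurable_preim_Y Yd); exact: measurable_mod_ok.
have mA2 : measurable A2 by apply: measurableC; apply: (measurable_preim_Y Yd); exact: measurable_exit_ok.
have mc L n : measurable_fun setT (fun w => clock (a h) h L n y (Y w)).
  exact: (measurable_clockY Yd).
have mA3 : measurable A3.
  by rewrite -[X in measurable X]setTI; exact: measurable_fun_ler.
have mA4 j : measurable (A4 j).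
  rewrite -[X in measurable X]setTI; apply: measurable_fun_ltr => //.
  by apply: measurableT_comp => //; exact: measurable_funB.
have mA5 : measurable A5 by apply: measurableC; exact: (measurable_finite_exitsY Yd).
have mA6 : measurable A6 by apply: measurableC; exact: (measurable_start Yd).
pose B := \big[setU/set0]_(j < J.+1) A4 j.
have mB : measurable B by exact: bigsetU_measurable.
have aok := gs_ok gs.
have P3 : P y A3 <= q%:E.
  have MM : (0 < M)%R by apply: (lt_trans M0); rewrite gtrBl addr_gt0.
  rewrite -(@lee_pmul2l _ M%:E)//; apply: (@le_trans _ _ (\int[P y]_w (clock (a h) h predT N y (Y w))%:E)).
    apply: markov_ge => //.
    - by apply/measurable_EFinP.
    - by move=> w; rewrite lee_fin clock_ge0// ltW.
    - exact: ltW.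
  apply: le_trans (integral_clock Yd (ltW h0) aok predT N Iy) _.
  rewrite -EFinM lee_fin; apply: (le_trans NT).
  rewrite /M mulrDl mulrDl divfK ?gt_eqF// -addrA lerDl addr_ge0// mulr_ge0// ltW//.
have P4 : P y B <= q%:E.
  apply: (le_trans (@Boole_inequality _ _ _ (P y) A4 J.+1 (fun i _ => mA4 i))).
  apply: (@le_trans _ _ (\sum_(j < J.+1) (q / J.+1%:R)%:E)).
    apply: lee_sum => j _; apply: (Hdev (a h) h K) => //; first by rewrite h0.
    apply: (@le_trans _ _ (j%:R * delta)%R).
      by rewrite -ler_pdivlMr// -truncn_ge_nat// !mulr_ge0 ?invr_ge0// ltW.
    by rewrite ler_pM2r// ler_nat -ltnS.
  by rewrite sumEFin sumr_const card_ord lee_fin -[leLHS]mulr_natr divfK// pnatr_eq0.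
have P5 : P y A5 = 0.
  have := @probability_setC _ _ _ (P y) _ (measurable_finite_exitsY Yd (a h) N y).
  by rewrite (finite_exits_ae Yd aok N Iy) subee.
have P6 : P y A6 = 0 by exact: (start_atC Yd).
exists (A1 `|` A2 `|` A3 `|` B `|` (A5 `|` A6)); split.
- by do 4 (apply: measurableU => //); exact: measurableU.
- have U S1 S2 (u v : R) : measurable S1 -> measurable S2 -> P y S1 <= u%:E ->
      P y S2 <= v%:E -> P y (S1 `|` S2) <= (u + v)%:E.
    move=> mS1 mS2 h3 h4; apply: le_trans (measureU2 (P y) mS1 mS2) _.
    by rewrite EFinD; exact: leeD.
  rewrite (_ : eta = (q + q + q + q + (0 + 0)))%R; last by rewrite /q; lra.
  have m12 := measurableU _ _ mA1 mA2.
  have m123 := measurableU _ _ m12 mA3.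
  have m1234 := measurableU _ _ m123 mB.
  have m56 := measurableU _ _ mA5 mA6.
  apply: (U _ _ _ _ m1234 m56); last by apply: (U _ _ _ _ mA5 mA6); rewrite ?P5 ?P6.
  apply: (U _ _ _ _ m123 mB) => //.
  apply: (U _ _ _ _ m12 mA3) => //.
  exact: (U _ _ _ _ mA1 mA2).
move=> w nA t tT.
have n1' : ~ A1 w by move=> ?; apply: nA; do 4 left.
have n2' : ~ A2 w by move=> ?; apply: nA; do 3 left; right.
have n3' : ~ A3 w by move=> ?; apply: nA; do 2 left; right.
have n4' : ~ B w by move=> ?; apply: nA; left; right.
have n5' : ~ A5 w by move=> ?; apply: nA; right; left.
have n6' : ~ A6 w by move=> ?; apply: nA; do 2 right.
rewrite (_ : e = 3 * e1)%R; last by rewrite /e1 mulrC divfK.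
apply: (@embedded_close _ (a h) (Y w) y h T M delta e1 (k1 n2) (k2 n2) N) => //.
- exact: ltW.
- by apply: (le_trans NT); rewrite -subr_ge0 ltW.
- exact: contrapT n6'.
- exact: contrapT n5'.
- by rewrite ltW// ltNge; exact/negP.
- by rewrite d4; exact: contrapT n1'.
- exact: contrapT n2'.
- move=> k kN.
  apply: (@clock_grid R (fun k => clock (a h) h K k y (Y w)) h delta J) => //.
  + by move=> u v uv; apply: clock_nd => //; exact: ltW.
  + exact: ltW.
  + move=> j jJ; rewrite leNgt; apply/negP => lt; apply: n4'.
    rewrite /B -bigcup_mkord; exists j => //=.
  + apply: le_lt_trans JT; apply: le_trans NT.
    by rewrite ler_pM2r// ler_nat.
Qed.

End coupling.

(** * Mean exit times and the scale factor *)

Section tent.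
Context {R : realType} (m : {measure set R -> \bar R}).

Definition tent (x a z : R) : R := Num.max (a - `|z - x|) 0.

Lemma tent_ge0 x a z : 0 <= tent x a z.
Proof. by rewrite /tent le_max lexx orbT. Qed.

Lemma tent_le x a b z : a <= b -> tent x a z <= tent x b z.
Proof. by move=> ab; rewrite /tent ge_max !le_max lexx orbT andbT lerD2r ab. Qed.

Lemma measurable_tent x a : measurable_fun setT (tent x a).
Proof.
apply: measurable_maxr => //; apply: measurable_funB => //.
by apply: measurableT_comp => //; apply: measurable_funB.
Qed.

(** Twice the mean exit time from (x - a, x + a) for Y started at x, when x - a and
    x + a belong to I; see [exit_time_mid]. *)
Definition Phi x a : \bar R := \int[m]_z (tent x a z)%:E.

Lemma Phi_ge0 x a : (0 <= Phi x a)%E.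
Proof. by apply: integral_ge0 => z _; rewrite lee_fin tent_ge0. Qed.

Lemma PhiE x a :
  (\int[m]_(z in `](x - a)%R, (x + a)%R[) (a - `|z - x|)%:E = Phi x a)%E.
Proof.
rewrite integral_mkcond; apply: eq_integral => z _; rewrite patchE /tent.
have -> : (z \in `]x - a, x + a[%classic) = (`|z - x| < a).
  apply/idP/idP; rewrite inE /= in_itv/= ltr_norml => /andP[? ?]; apply/andP; split; lra.
by case: ltP => h; [rewrite max_l// subr_ge0 ltW | rewrite max_r// subr_le0].
Qed.

Lemma Phi_le x a b : a <= b -> (Phi x a <= Phi x b)%E.
Proof.
move=> ab; apply: ge0_le_integral => //.
- by move=> z _; rewrite lee_fin tent_ge0.
- by apply/measurable_EFinP; exact: measurable_tent.
- by apply/measurable_EFinP; exact: measurable_tent.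
- by move=> z _; rewrite lee_fin tent_le.
Qed.

Lemma Phi0 x : (Phi x 0 = 0)%E.
Proof.
rewrite /Phi; under eq_integral do rewrite /tent sub0r max_r ?oppr_le0//.
by rewrite integral0.
Qed.

(** Monotone convergence: Phi is continuous from the left in a. *)
Lemma Phi_sup x a (c : \bar R) : 0 < a ->
  (forall b, 0 <= b < a -> (Phi x b <= c)%E) -> (Phi x a <= c)%E.
Proof.
move=> a0 H; pose b n : R := a - a / n.+1%:R.
have bn n : 0 <= b n < a.
  rewrite subr_ge0 ler_pdivrMr// ler_peMr ?ler1n ?ltW//=.
  by rewrite gtrBl divr_gt0.
have bnd n k : (n <= k)%N -> b n <= b k.
  by move=> nk; rewrite /b lerD2l lerN2 ler_pM2l// lef_pV2 ?posrE// ler_nat ltnS.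
have cb : b n @[n --> \oo] --> a.
  rewrite -[X in _ --> X]subr0; apply: cvgB; first exact: cvg_cst.
  rewrite -[X in _ --> X](mulr0 a); apply: cvgM; first exact: cvg_cst.
  apply/cvgrPdist_lt => e e0.
  have := @near_infty_natSinv_lt R (PosNum e0); apply: filterS => n /= ne.
  by rewrite sub0r normrN ger0_norm.
have := @cvg_monotone_convergence _ _ _ m setT measurableT
  (fun n z => (tent x (b n) z)%:E) _ _ _.
have lim z : limn (fun n => (tent x (b n) z)%:E) = (tent x a z)%:E.
  apply/cvg_lim => //; apply: cvg_EFin; first by apply: nearW.
  have c1 : {for a, continuous (fun u : R => u - `|z - x| : R^o)}.
    by apply: (@cvgB _ _ _ (nbhs a) _ id (cst `|z - x|)); [exact: cvg_id | exact: cvg_cst].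
  have c2 : {for a, continuous (cst (0 : R^o) : R -> R^o)} by exact: cvg_cst.
  exact: (cvg_comp _ _ cb (continuous_max c1 c2)).
rewrite (eq_integral (fun z => (tent x a z)%:E)); last by move=> z _; rewrite lim.
move=> C.
have {}C : (fun n => Phi x (b n)) @ \oo --> Phi x a.
  apply: C.
  - by move=> n; apply/measurable_EFinP; exact: measurable_tent.
  - by move=> n z _; rewrite lee_fin tent_ge0.
  - by move=> z _ n k nk; rewrite lee_fin tent_le// bnd.
rewrite -(cvg_lim _ C)//; apply: lime_le; first by apply/cvg_ex; eexists; exact: C.
by apply: nearW => n; exact: H.
Qed.

(** The Green function of (x - a, x + a) with pole x is half a tent. *)
Lemma green_mid (x a v : R) : 0 < a -> x - a < v < x + a ->
  (x + a - Num.max x v) * (Num.min x v - (x - a)) / (x + a - (x - a)) = 2^-1 * (a - `|v - x|).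
Proof.
move=> a0 /andP[v1 v2]; have a2 : x + a - (x - a) != 0 by rewrite gt_eqF//; lra.
apply: (mulIf a2); rewrite divfK//.
have [le|lt] := leP x v.
  by rewrite ger0_norm ?subr_ge0//; field.
by rewrite ltr0_norm ?subr_lt0//; field.
Qed.

(** For an arbitrary pole u it is still bounded by the full tent, hence the bound
    2 h for the mean exit time from any starting point. *)
Lemma green_le (x a u v : R) : 0 < a -> x - a <= u <= x + a -> x - a < v < x + a ->
  0 <= (x + a - Num.max u v) * (Num.min u v - (x - a)) / (x + a - (x - a)) <= a - `|v - x|.
Proof.
move=> a0 /andP[u1 u2] /andP[v1 v2].
have a2 : 0 < x + a - (x - a) by lra.
apply/andP; split.
  apply: divr_ge0; last exact: ltW.
  apply: mulr_ge0; rewrite subr_ge0 ?ge_max ?le_min ?u1 ?u2/=; exact: ltW.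
rewrite ler_pdivrMr//.
have m1 : Num.max u v <= x + a by rewrite ge_max u2 ltW.
have m2 : x - a <= Num.min u v by rewrite le_min u1 ltW.
have m3 : v <= Num.max u v by rewrite le_max lexx orbT.
have m4 : Num.min u v <= v by rewrite ge_min lexx orbT.
have [le|lt] := leP 0 (v - x).
  rewrite ger0_norm//; apply: ler_pM; lra.
by rewrite ltr0_norm// mulrC; apply: ler_pM; lra.
Qed.

End tent.

Section emcel.
Context {R : realType} {d : measure_display} {Omega : measurableType d}.
Context {I : set R} {l r : \bar R} {F : time R -> set_system Omega}
  {P : R -> probability Omega R} {Y : Omega -> cpath R}
  {m : {measure set R -> \bar R}}.
Hypothesis Yd : general_diffusion I l r F P Y m.
Local Open Scope ereal_scope.

Lemma exit_time_mid (a : R -> R) x : (0 < a x)%R -> I (x - a x)%R -> I (x + a x)%R ->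
  \int[P x]_w exit_time a x (Y w) = (2^-1)%:E * Phi m x (a x).
Proof.
move=> ax Im Ip; have lt : (x - a x < x + a x)%R by lra.
have xx : (x - a x <= x <= x + a x)%R by apply/andP; split; lra.
have := gd_speed_exit Yd Im Ip lt xx => ->.
rewrite (eq_integral (fun v : R => (2^-1)%:E * (a x - `|v - x|)%:E)); last first.
  by move=> v; rewrite inE/= in_itv/= => vx; rewrite green_mid// EFinM.
rewrite ge0_integralZl//; first by rewrite PhiE.
- apply/measurable_EFinP; apply: measurable_funTS; apply: measurable_funB => //.
  by apply: measurableT_comp => //; apply: measurable_funB.
- move=> v /=; rewrite in_itv/= => /andP[v1 v2]; rewrite lee_fin subr_ge0 ler_norml.
  by apply/andP; split; lra.
Qed.

Lemma exit_time_from (a : R -> R) x u : (0 < a x)%R -> I (x - a x)%R -> I (x + a x)%R ->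
  (x - a x <= u <= x + a x)%R -> \int[P u]_w exit_time a x (Y w) <= Phi m x (a x).
Proof.
move=> ax Im Ip ux; have lt : (x - a x < x + a x)%R by lra.
have := gd_speed_exit Yd Im Ip lt ux => ->.
rewrite -PhiE; apply: ge0_le_integral => //.
- move=> v /=; rewrite in_itv/= lee_fin => vx.
  by have /andP[] := green_le ax ux vx.
- apply/measurable_EFinP; apply: measurable_funTS; apply: measurable_funM => //.
  apply: measurable_funM; apply: measurable_funB => //.
    exact: measurable_maxr.
  exact: measurable_minr.
- apply/measurable_EFinP; apply: measurable_funTS; apply: measurable_funB => //.
  by apply: measurableT_comp => //; apply: measurable_funB.
- move=> v /=; rewrite in_itv/= lee_fin => vx.
  by have /andP[] := green_le ax ux vx.
Qed.

Lemma exit_time_zero (a : R -> R) x : I x -> a x = 0%R -> \int[P x]_w exit_time a x (Y w) = 0.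
Proof.
move=> Ix ax.
have mT : measurable_fun setT (fun w => exit_time a x (Y w)) := measurable_exit_timeY Yd a x.
rewrite (@ge0_negligible_integral _ _ _ (P x) setT (~` [set w | path_at (Y w) 0 = x]))//.
- rewrite setTD setCK; apply: integral0_eq => w /= w0.
  by rewrite /exit_time ax subr0 addr0 minxx -w0 hit_time_start.
- by apply: measurableC; exact: (measurable_start Yd).
- by move=> w _; exact: exit_time_ge0.
- exact: (start_atC Yd).
Qed.

End emcel.

Section emcel_scale.
Context {R : realType} {d : measure_display} {Omega : measurableType d}.
Context {I : set R} {l r : \bar R} {F : time R -> set_system Omega}
  {P : R -> probability Omega R} {Y : Omega -> cpath R}
  {m : {measure set R -> \bar R}}.
Hypothesis Yd : general_diffusion I l r F P Y m.
Local Open Scope ereal_scope.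

(** For every b < A, the exit time from (x - b, x + b) has mean at most h, so with
    probability at least 1/2 - 1/4 the path visits x + b before time 4 h. Hence with
    probability at least 1/4 this happens for infinitely many of the radii b n -> A.
    On such a path the maximum over the compact interval [0, 4 h] is at least x + A,
    and paths live in I, so x + A belongs to I; the same holds at x - A. *)
Lemma reach_endpoints x A h : I x -> (0 < h)%R -> (0 < A)%R ->
  (forall b, (0 <= b < A)%R -> [/\ I (x - b)%R, I (x + b)%R &
    (2^-1)%:E * Phi m x b <= h%:E]) ->
  I (x - A)%R /\ I (x + A)%R.
Proof.
move=> Ix h0 A0 H.
pose b n : R := (A - A / n.+2%:R)%R.
have bn n : (0 < b n < A)%R.
  rewrite subr_gt0 ltr_pdivrMr// ltr_pMr// ltr1n/=.
  by rewrite gtrBl divr_gt0.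
have bnd n k : (n <= k)%N -> (b n <= b k)%R.
  by move=> nk; rewrite /b lerD2l lerN2 ler_pM2l// lef_pV2 ?posrE// ler_nat !ltnS.
have cb (c : R) : (forall N : nat, exists2 n, (N <= n)%N & (b n <= c)%R) -> (A <= c)%R.
  move=> Hc; apply/ler_addgt0Pl => e e0.
  have eA : (0 < e / A)%R by rewrite divr_gt0.
  have [N _ /(_ _ (leqnn N)) Ne] := @near_infty_natSinv_lt R (PosNum eA).
  have {}Ne : (N.+1%:R^-1 < e / A)%R := Ne.
  have [n Nn nc] := Hc N.
  have : (A / n.+2%:R <= e)%R.
    rewrite mulrC -ler_pdivlMr//; apply: le_trans (ltW Ne).
    by rewrite lef_pV2 ?posrE// ler_nat ltnW.
  by move: nc; rewrite /b; move: (A / n.+2%:R)%R => u nc ue; lra.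
have ex n : exists a : R -> R, a x = b n /\ @scale_ok _ _ _ I P Y a h.
  have /andP[b0 bA] := bn n.
  have [Im Ip Ph] : [/\ I (x - b n)%R, I (x + b n)%R & (2^-1)%:E * Phi m x (b n) <= h%:E].
    by apply: H; rewrite bA ltW.
  (* Any radius admissible at x extends to a scale factor by 0 elsewhere. *)
  exists (fun z => if z == x then b n else 0%R); rewrite eqxx; split => // z Iz.
  have [->|zx] := eqVneq z x.
    split => //; first exact: ltW.
    by have := exit_time_mid Yd (a := fun z => if z == x then b n else 0%R) (x := x);
      rewrite eqxx => ->.
  rewrite subr0 addr0; split => //.
  have := exit_time_zero Yd (a := fun z => if z == x then b n else 0%R) Iz.
  by rewrite (negbTE zx) => -> //; rewrite lee_fin ltW.
have key (sgn : bool) (n : nat) :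
    (4^-1)%:E <= P x [set w | hit_time (if sgn then x + b n else x - b n)%R (Y w) <= (4 * h)%:E].
  have [a [ea aok]] := ex n; have /andP[b0 _] := bn n.
  have a0 : (0 < a x)%R by rewrite ea.
  pose c : R := (if sgn then x + b n else x - b n)%R.
  pose U := at_exit (Y := Y) (fun w => exit_time a x (Y w)) c.
  have PU : P x U = (2^-1)%:E.
    have [e|e] : sgn = true \/ sgn = false by case: (sgn); [left|right].
      by rewrite /U /c e -ea; exact: (prob_up Yd aok Ix a0).
    by rewrite /U /c e -ea; exact: (prob_down Yd aok Ix a0).
  pose V := [set w | (4 * h)%:E <= exit_time a x (Y w)].
  have mT := measurable_exit_timeY Yd a x.
  have mV : measurable V.
    rewrite /V (_ : [set _ | _] = setT `&` (fun w => exit_time a x (Y w)) @^-1` `[(4 * h)%:E, +oo[%classic).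
      by apply: mT => //; exact: emeasurable_itv.
    by apply/seteqP; split => w /=; rewrite in_itv/= andbT; [move=> ? | move=> []].
  have mU : measurable U := measurable_at_exit Yd (stopping_exit_time Yd a x) c.
  have h4 : (0 < 4 * h)%R by rewrite mulr_gt0.
  have PV : P x V <= (4^-1)%:E.
    rewrite -(@lee_pmul2l _ (4 * h)%:E)//.
    apply: (@le_trans _ _ (\int[P x]_w exit_time a x (Y w))).
      apply: markov_ge => //; first by move=> w; exact: exit_time_ge0.
      exact: ltW.
    have [_ _ _ /le_trans] := aok x Ix; apply.
    by rewrite -EFinM lee_fin mulrAC divff// mul1r.
  have mH : measurable [set w | hit_time c (Y w) <= (4 * h)%:E].
    apply: measurable_hit_time_le => t _; exact: (measurable_at_Y Yd).
  have : P x U <= P x (V `|` [set w | hit_time c (Y w) <= (4 * h)%:E]).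
    apply: le_measure; rewrite ?inE//; first exact: measurableU.
    move=> w [wT wc]; have [hT|hT] := leP (4 * h)%:E (exit_time a x (Y w)); first by left.
    right; apply/hit_time_leP; exists (duration a x (Y w)) => //.
    by rewrite duration_ge0/= -lee_fin -(exit_time_fin wT) ltW.
  rewrite PU => /le_trans /(_ (measureU2 (P x) mV mH)).
  have : P x V + P x [set w | hit_time c (Y w) <= (4 * h)%:E] <=
      (4^-1)%:E + P x [set w | hit_time c (Y w) <= (4 * h)%:E] by exact: leeD2r.
  move=> h1 h2; have := le_trans h2 h1.
  rewrite -leeBlDl// => /(le_trans _); apply.
  by rewrite -EFinB lee_fin; lra.
have reach (sgn : bool) : exists f : cpath R, (forall t, I (path_at f t)) /\
    forall N : nat, exists2 n, (N <= n)%N &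
      hit_time (if sgn then x + b n else x - b n)%R f <= (4 * h)%:E.
  pose E n := [set w | hit_time (if sgn then x + b n else x - b n)%R (Y w) <= (4 * h)%:E].
  have mE n : measurable (E n).
    apply: measurable_hit_time_le => t _; exact: (measurable_at_Y Yd).
  have [[w Hw]|nex] := pselect (exists w, forall N : nat, exists2 n, (N <= n)%N & E n w).
    by exists (Y w); split => // t; exact: (at_I Yd).
  exfalso; pose A' N := ~` (\bigcup_(n in [set n | (N <= n)%N]) E n).
  have mA' N : measurable (A' N).
    by apply: measurableC; apply: bigcup_measurable => n _; exact: mE.
  have e8 : (0 < 8^-1 :> R)%R by [].
  have [n] : exists n, P x (~` A' n) <= (8^-1)%:E.
    apply: (@prob_exhaust _ _ _ _ A' setT) => //.
    - move=> n k nk w nA; apply: contra_not nA => -[j /= kj Ej].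
      by exists j => //=; exact: leq_trans kj.
    - exact: probability_setT.
    - move=> w _; apply: contrapT => nA; apply: nex; exists w => N.
      have [//|noE] := pselect (exists2 n, (N <= n)%N & E n w).
      exfalso; apply: nA; exists N; first by [].
      by move=> [n /= Nn En]; apply: noE; exists n.
  rewrite setCK leNgt => /negP; apply.
  apply: (@lt_le_trans _ _ (4^-1)%:E); first by rewrite lte_fin; lra.
  apply: (le_trans (key sgn n)); apply: le_measure; rewrite ?inE//.
  - exact: mE.
  - by apply: bigcup_measurable => k _; exact: mE.
  - by move=> w Ew; exists n => //=.
have h4 : (0 <= 4 * h)%R by rewrite mulr_ge0// ltW.
split.
  have [f [If Hf]] := reach false.
  have [t _ tmin] := @EVT_min R (path_at f) 0%R (4 * h)%R h4
    (continuous_subspaceT (@at_continuous _ f)).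
  apply: (interval_between Yd (If t) Ix); apply/andP; split; last by rewrite gerBl ltW.
  rewrite -lerBlDr opprK addrC -lerBrDr.
  have : (A <= x - path_at f t)%R.
    apply: cb => N; have [n Nn /hit_time_leP[s sI fs]] := Hf N; exists n => //.
    have := tmin s; rewrite in_itv/= sI => /(_ isT); rewrite fs; lra.
  by lra.
have [f [If Hf]] := reach true.
have gc : continuous (fun t => - path_at f t)%R.
  by move=> t; apply: cvgN; exact: at_continuous.
have [t _ tmin] := @EVT_min R _ 0%R (4 * h)%R h4 (continuous_subspaceT gc).
apply: (interval_between Yd Ix (If t)); apply/andP; split; first by rewrite lerDl ltW.
have : (A <= path_at f t - x)%R.
  apply: cb => N; have [n Nn /hit_time_leP[s sI fs]] := Hf N; exists n => //.
  have := tmin s; rewrite in_itv/= sI => /(_ isT); rewrite fs; lra.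
by lra.
Qed.

Lemma emcel_off h x : ~ I° x -> emcel I m h x = 0%R.
Proof. by move=> nI; rewrite /emcel asboolF. Qed.

Definition emcel_set h x : set R := [set a : R | (0 <= a)%R /\ I (x - a)%R /\ I (x + a)%R /\
  (2^-1)%:E * Phi m x a <= h%:E].

Lemma emcelE h x : I° x -> emcel I m h x = sup (emcel_set h x).
Proof.
move=> Ix; rewrite /emcel asboolT//; congr sup; apply/seteqP; split => a /=;
by rewrite PhiE.
Qed.

Lemma emcel_set_down h x a b : I x -> emcel_set h x b -> (0 <= a <= b)%R -> emcel_set h x a.
Proof.
move=> Ix [b0 [Im [Ip Ph]]] /andP[a0 ab]; split => //; split; [|split].
- by apply: (interval_between Yd Im Ix); apply/andP; split; lra.
- by apply: (interval_between Yd Ix Ip); apply/andP; split; lra.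
- by apply: le_trans Ph; rewrite lee_wpmul2l// ?lee_fin// Phi_le.
Qed.

Lemma emcel_set0 h x : I x -> (0 < h)%R -> emcel_set h x 0%R.
Proof.
move=> Ix h0; split => //; rewrite subr0 addr0; split => //; split => //.
by rewrite Phi0 mule0 lee_fin ltW.
Qed.

Lemma emcel_below h x b : I° x -> (0 < h)%R -> (0 <= b < emcel I m h x)%R ->
  emcel_set h x b.
Proof.
move=> iIx h0; have Ix := interior_I iIx; rewrite emcelE// => /andP[b0 bs].
have hs : has_sup (emcel_set h x).
  apply: contrapT => /sup_out s0; rewrite s0 in bs.
  by have := le_lt_trans b0 bs; rewrite ltxx.
have sb : (0 < sup (emcel_set h x) - b)%R by rewrite subr_gt0.
have [c Sc bc] := sup_adherent sb hs.
apply: (emcel_set_down Ix Sc); rewrite b0 /= ltW//.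
by move: bc; rewrite opprB addrC subrK.
Qed.

Lemma emcel_ge0 h x : I x -> (0 < h)%R -> (0 <= emcel I m h x)%R.
Proof.
move=> Ix h0; have [iIx|nI] := pselect (I° x); last by rewrite emcel_off.
rewrite emcelE//.
have [hs|/sup_out ->//] := pselect (has_sup (emcel_set h x)).
by apply: ub_le_sup; [case: hs | exact: emcel_set0].
Qed.

(** The supremum is itself an admissible radius: the end points belong to I by
    [reach_endpoints] and the integral bound passes to the limit by [Phi_sup]. *)
Lemma emcel_mem h x : I x -> (0 < h)%R ->
  [/\ I (x - emcel I m h x)%R, I (x + emcel I m h x)%R &
    (2^-1)%:E * Phi m x (emcel I m h x) <= h%:E].
Proof.
move=> Ix h0; have := emcel_ge0 Ix h0; rewrite le_eqVlt => /predU1P[<-|A0].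
  by rewrite subr0 addr0 Phi0 mule0 lee_fin; split => //; exact: ltW.
have iIx : I° x.
  by apply: contrapT => nI; move: A0; rewrite emcel_off// ltxx.
have below b : (0 <= b < emcel I m h x)%R -> [/\ I (x - b)%R, I (x + b)%R &
    (2^-1)%:E * Phi m x b <= h%:E].
  by move=> bA; have [_ [? [? ?]]] := emcel_below iIx h0 bA; split.
have [Im Ip] := reach_endpoints Ix h0 A0 below.
split => //; rewrite muleC -lee_pdivlMr// invrK.
apply: Phi_sup => // b bA; have [_ _] := below b bA.
by rewrite muleC -lee_pdivlMr// invrK.
Qed.

Lemma emcel_scale_ok h : (0 < h)%R -> @scale_ok _ _ _ I P Y (emcel I m h) h.
Proof.
move=> h0 x Ix; have [Im Ip Ph] := emcel_mem Ix h0.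
have A0 := emcel_ge0 Ix h0; split => //.
move: A0; rewrite le_eqVlt => /predU1P[e|A0]; last by rewrite (exit_time_mid Yd A0 Im Ip).
by rewrite (exit_time_zero Yd Ix (esym e)) lee_fin ltW.
Qed.

Lemma emcel_exit2 h x : (0 < h)%R -> I x -> (0 < emcel I m h x)%R ->
  forall u, (x - emcel I m h x <= u <= x + emcel I m h x)%R ->
    \int[P u]_w exit_time (emcel I m h) x (Y w) <= (2 * h)%:E.
Proof.
move=> h0 Ix A0 u ux; have [Im Ip Ph] := emcel_mem Ix h0.
apply: (le_trans (exit_time_from Yd A0 Im Ip ux)).
by move: Ph; rewrite muleC -lee_pdivlMr// invrK muleC EFinM.
Qed.

(** Finitely many cells of positive mass have a common positive lower bound. *)
Lemma cells_lb (k1 k2 s : R) (J : nat) : (0 < s)%R ->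
  (forall z, (k1 <= z <= k2 + s)%R -> I° z) ->
  exists2 c : R, (0 < c)%R & forall j, (j < J)%N -> (k1 + j%:R * s <= k2)%R ->
    c%:E <= m `[(k1 + j%:R * s)%R, (k1 + j.+1%:R * s)%R]%classic.
Proof.
move=> s0 HI; elim: J => [|J [c c0 Hc]]; first by exists 1%R.
have [le|lt] := leP (k1 + J%:R * s)%R k2; last first.
  exists c => // j; rewrite ltnS leq_eqVlt => /predU1P[->|jJ]; last exact: Hc.
  by move=> /(lt_le_trans lt); rewrite ltxx.
have sJ : (k1 + J.+1%:R * s = k1 + J%:R * s + s)%R.
  by rewrite -natr1 mulrDl mul1r addrA.
have Js0 : (0 <= J%:R * s)%R by rewrite mulr_ge0// ltW.
have := gd_speed_pos Yd (a := (k1 + J%:R * s)%R) (b := (k1 + J.+1%:R * s)%R).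
case/(_ _ _ _)/andP.
- by apply: HI; apply/andP; split; lra.
- by apply: HI; rewrite sJ; apply/andP; split; lra.
- by rewrite sJ ltrDl.
move=> mpos mfin; set v := m _ in mpos mfin.
have vf : v = (fine v)%:E by rewrite fineK// ge0_fin_numE// ltW.
have v0 : (0 < fine v)%R by rewrite -lte_fin -vf.
exists (Num.min c (fine v)); first by rewrite lt_min c0.
move=> j; rewrite ltnS leq_eqVlt => /predU1P[->|jJ] jk.
  by rewrite -/v vf lee_fin ge_min lexx orbT.
by apply: le_trans (Hc j jJ jk); rewrite lee_fin ge_min lexx.
Qed.

(** A neighbourhood of [k1, k2] of width 2 delta lies in the interior. Every
    interval (x - delta, x + delta) contains one of finitely many cells of length
    s = delta / 4 on which the tent is at least 2 s, so Phi x delta >= 2 s c with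
    c independent of x. For h < s c no radius above delta is admissible, hence the
    supremum A is limited by the integral condition and not by the boundary. As
    Phi x is Lipschitz up to 2 delta, with constant the mass of the neighbourhood,
    Phi x A < 2 h would leave room for a larger radius. *)
Lemma emcel_exact (k1 k2 : R) : l < k1%:E -> k2%:E < r ->
  exists2 h0, (0 < h0)%R & forall h, (0 < h < h0)%R -> forall x, (k1 <= x <= k2)%R ->
    (0 < emcel I m h x)%R /\ (2^-1)%:E * Phi m x (emcel I m h x) = h%:E.
Proof.
move=> lk1 k2r.
have [k12|k21] := leP k1 k2; last first.
  exists 1%R => // h _ x /andP[h1 h2]; have := lt_le_trans k21 (le_trans h1 h2).
  by rewrite ltxx.
have Ik1 : I° k1.
  by apply/(interiorE Yd); rewrite lk1/= (le_lt_trans _ k2r)// lee_fin.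
have Ik2 : I° k2.
  by apply/(interiorE Yd); rewrite k2r andbT (lt_le_trans lk1)// lee_fin.
have [delta d0 HI] : exists2 delta : R, (0 < delta)%R &
    forall z, (k1 - 2 * delta <= z <= k2 + 2 * delta)%R -> I° z.
  have /nbhs_ballP[e1 e10 H1] : nbhs k1 I° by apply: open_nbhs_nbhs; split => //; exact: open_interior.
  have /nbhs_ballP[e2 e20 H2] : nbhs k2 I° by apply: open_nbhs_nbhs; split => //; exact: open_interior.
  have e0 : (0 < Num.min e1 e2)%R by rewrite lt_min; apply/andP; split.
  exists (Num.min e1 e2 / 4)%R; first by rewrite divr_gt0.
  have m1 : (Num.min e1 e2 <= e1)%R by rewrite ge_min lexx.
  have m2 : (Num.min e1 e2 <= e2)%R by rewrite ge_min lexx orbT.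
  set e := Num.min e1 e2 in e0 m1 m2 *.
  move=> z /andP[z1 z2].
  have [zk1|k1z] := ltP z k1.
    by apply: H1; rewrite /ball/= ltr_norml; apply/andP; split; lra.
  have [k2z|zk2] := ltP k2 z.
    by apply: H2; rewrite /ball/= ltr_norml; apply/andP; split; lra.
  apply/(interiorE Yd); rewrite (lt_le_trans lk1) ?lee_fin//=.
  by rewrite (le_lt_trans _ k2r)// lee_fin.
pose s : R := (delta / 4)%R.
have s0 : (0 < s)%R by rewrite divr_gt0.
have d4 : (delta = 4 * s)%R by rewrite /s mulrC divfK.
pose J := (Num.truncn ((k2 - k1) / s)).+1.
have [c c0 Hc] : exists2 c : R, (0 < c)%R & forall j, (j < J)%N -> (k1 + j%:R * s <= k2)%R ->
    c%:E <= m `[(k1 + j%:R * s)%R, (k1 + j.+1%:R * s)%R]%classic.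
  apply: cells_lb => // z /andP[z1 z2]; apply: HI; apply/andP; split; lra.
have Plow x : (k1 <= x <= k2)%R -> (2 * s * c)%:E <= Phi m x delta.
  move=> /andP[x1 x2]; set j := Num.truncn ((x - k1) / s).
  have js : (j%:R * s <= x - k1)%R.
    by rewrite -ler_pdivlMr// -truncn_ge_nat// divr_ge0 ?subr_ge0 ?(ltW s0).
  have js1 : (x - k1 < j.+1%:R * s)%R by rewrite -ltr_pdivrMr// truncnS_gt.
  have jJ : (j < J)%N.
    by rewrite ltnS; apply: le_truncn; rewrite ler_pM2r ?invr_gt0// lerD2r.
  have jk : (k1 + j%:R * s <= k2)%R by lra.
  have sj : (j.+1%:R * s = j%:R * s + s)%R by rewrite -natr1 mulrDl mul1r.
  apply: (@le_trans _ _ ((2 * s)%:E * m `[(k1 + j%:R * s)%R, (k1 + j.+1%:R * s)%R]%classic)).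
    rewrite (EFinM (2 * s) c); apply: lee_wpmul2l; last exact: (Hc j jJ jk).
    by rewrite lee_fin mulr_ge0// ltW.
  apply: markov_ge => //.
  - by apply/measurable_EFinP; exact: measurable_tent.
  - by move=> z; rewrite lee_fin tent_ge0.
  - by rewrite mulr_ge0// ltW.
  - move=> z /=; rewrite in_itv/= sj => /andP[z1 z2].
    rewrite lee_fin /tent le_max lerBrDr -lerBrDl.
    by apply/orP; left; rewrite ler_norml; apply/andP; split; lra.
exists (s * c)%R; first by rewrite mulr_gt0.
move=> h /andP[h0 hc] x xk; have /andP[x1 x2] := xk.
have iIx : I° x by apply: HI; apply/andP; split; lra.
have Ix := interior_I iIx.
have ub : ubound (emcel_set h x) delta.
  move=> a [a0 [Im [Ip Ph]]]; rewrite leNgt; apply/negP => da.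
  have := le_trans (Plow x xk) (Phi_le m x (ltW da)).
  move: Ph; rewrite muleC -lee_pdivlMr// invrK => /[swap] /le_trans /[apply].
  by rewrite -EFinM lee_fin; lra.
have Ale : (emcel I m h x <= delta)%R.
  rewrite emcelE//; apply: ge_sup => //.
  by exists 0%R; exact: emcel_set0.
have [Im Ip Ph] := emcel_mem Ix h0; have A0 := emcel_ge0 Ix h0.
set A := emcel I m h x in Ale Im Ip Ph A0 *.
have Pf : Phi m x A \is a fin_num.
  rewrite ge0_fin_numE ?Phi_ge0//; move: Ph; rewrite muleC -lee_pdivlMr// => /le_lt_trans; apply.
  by rewrite -EFinM ltry.
pose D : set R := `[(k1 - 2 * delta)%R, (k2 + 2 * delta)%R]%classic.
have mD : measurable D by exact: measurable_itv.
have mDf : m D \is a fin_num.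
  rewrite ge0_fin_numE//.
  have := gd_speed_pos Yd (a := (k1 - 2 * delta)%R) (b := (k2 + 2 * delta)%R).
  case/(_ _ _ _)/andP => //.
  - by apply: HI; apply/andP; split; lra.
  - by apply: HI; apply/andP; split; lra.
  - by lra.
(* A radius slightly above A violates the integral condition. *)
have up a : (A < a < 2 * delta)%R -> (2 * h <= fine (Phi m x A) + (a - A) * fine (m D))%R.
  move=> /andP[Aa a2].
  have : h%:E < (2^-1)%:E * Phi m x a.
    rewrite ltNge; apply/negP => le.
    have Sa : emcel_set h x a.
      split; first by lra.
      split; first by apply: interior_I; apply: HI; apply/andP; split; lra.
      split => //; by apply: interior_I; apply: HI; apply/andP; split; lra.
    have : (a <= A)%R.
      by rewrite /A emcelE//; apply: ub_le_sup => //; exists delta.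
    by rewrite leNgt Aa.
  rewrite muleC -lte_pdivrMr// invrK => /ltW lt.
  have : Phi m x a <= Phi m x A + (a - A)%:E * m D.
    apply: (@le_trans _ _ (\int[m]_z ((tent x A z)%:E + (a - A)%:E * (\1_D z)%:E))).
      apply: ge0_le_integral => //.
      - by move=> z _; rewrite lee_fin tent_ge0.
      - by apply/measurable_EFinP; exact: measurable_tent.
      - apply: emeasurable_funD; first by apply/measurable_EFinP; exact: measurable_tent.
        by apply: emeasurable_funM => //; apply/measurable_EFinP; exact: measurable_indic.
      - move=> z _; rewrite -EFinM -EFinD lee_fin indicE.
        have [zD|zD] := boolP (z \in D).
          rewrite mulr1 /tent ge_max; apply/andP; split; last first.
            by rewrite addr_ge0 ?tent_ge0// subr_ge0 ltW.
          rewrite -lerBlDr le_max; apply/orP; left; lra.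
        rewrite mulr0 addr0 {1}/tent max_r ?tent_ge0//.
        rewrite subr_le0 leNgt; apply/negP; rewrite ltr_norml => /andP[z1 z2].
        move/negP: zD; apply; rewrite inE /D /= in_itv/=; apply/andP; split; lra.
    rewrite ge0_integralD//; last 4 first.
    - by move=> z _; rewrite lee_fin tent_ge0.
    - by apply/measurable_EFinP; exact: measurable_tent.
    - by move=> z _; rewrite -EFinM lee_fin mulr_ge0 ?subr_ge0 ?(ltW Aa).
    - by apply: emeasurable_funM => //; apply/measurable_EFinP; exact: measurable_indic.
    rewrite ge0_integralZl//; last 2 first.
    - by apply/measurable_EFinP; exact: measurable_indic.
    - by rewrite lee_fin subr_ge0 ltW.
    by rewrite integral_indic// setIT.
  move=> /(le_trans lt); rewrite -(fineK Pf) -(fineK mDf) -!EFinM -EFinD lee_fin.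
  by rewrite mulrC.
have ge : (2 * h <= fine (Phi m x A))%R.
  apply/ler_addgt0Pr => e e0.
  pose D0 : R := (fine (m D) + 1)%R.
  have mD0 : (0 <= fine (m D))%R by exact: fine_ge0.
  have D00 : (0 < D0)%R by rewrite /D0; lra.
  have eD : (0 < e / D0)%R by rewrite divr_gt0.
  pose b := Num.min (e / D0)%R (delta / 2)%R.
  have b0 : (0 < b)%R by rewrite lt_min eD divr_gt0.
  have b1 : (b <= e / D0)%R by rewrite ge_min lexx.
  have b2 : (b <= delta / 2)%R by rewrite ge_min lexx orbT.
  apply: (le_trans (up (A + b)%R _)); first by apply/andP; split; lra.
  rewrite lerD2l [(A + b - A)%R]addrC addKr.
  apply: (@le_trans _ _ (e / D0 * D0)%R); last by rewrite divfK// gt_eqF.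
  apply: ler_pM => //; first exact: ltW.
  by rewrite /D0; lra.
have hE : (2^-1)%:E * Phi m x A = h%:E.
  apply/eqP; rewrite eq_le Ph/= -(fineK Pf) -EFinM lee_fin; lra.
split => //; rewrite lt_neqAle A0 andbT eq_sym; apply/eqP => A00.
by move: hE; rewrite A00 Phi0 mule0 => -[] h00; rewrite -h00 ltxx in h0.
Qed.

Lemma emcel_good (k1 k2 : R) : l < k1%:E -> k2%:E < r ->
  exists2 h0, (0 < h0)%R & forall h, (0 < h < h0)%R ->
    @good_scale _ _ _ I P Y (emcel I m h) h [pred z | k1 <= z <= k2]%R.
Proof.
move=> lk1 k2r; have [h0 h00 H] := emcel_exact lk1 k2r.
exists h0 => // h hh; have /andP[hp _] := hh; split.
- exact: emcel_scale_ok.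
- by move=> x Ix A0 u; exact: emcel_exit2.
- move=> x Ix /= xk; have [A0 e] := H h hh x xk; split => //.
  by have [Im Ip _] := emcel_mem Ix hp; rewrite (exit_time_mid Yd A0 Im Ip).
Qed.

End emcel_scale.

(** * Equality in law of the embedded and the coin-tossing chain *)

Section finite_horizon.
Context {R : realType}.
Variable a : R -> R.

Definition freeze V (N : nat) (s : nat -> V) : nat -> V := fun k => s (minn k N).

Definition pcons V (x : V) (s : nat -> V) : nat -> V := fun k => if k is j.+1 then s j else x.

Lemma freezeS V N (s : nat -> V) : freeze N.+1 s = pcons (s 0%N) (freeze N (fun k => s k.+1)).
Proof. by apply/funext => -[|k]; rewrite /freeze /= ?min0n// minnSS. Qed.

Lemma freeze0 V (s : nat -> V) : freeze 0 s = fun=> s 0%N.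
Proof. by apply/funext => k; rewrite /freeze minn0. Qed.

(** The expectation of G along the first N steps of the symmetric chain with scale
    factor a: a finite sum, whatever the functions a and G. *)
Fixpoint tree (N : nat) (G : (nat -> R) -> R) (x : R) : R :=
  if N is k.+1 then
    2^-1 * tree k (fun s => G (pcons x s)) (x + a x) +
    2^-1 * tree k (fun s => G (pcons x s)) (x - a x)
  else G (fun=> x).

Lemma measurable_embedded_stop N (G : (nat -> R) -> R) x :
  measurable_fun setT ((fun f => G (freeze N (embedded a x f))) : wpath R -> R).
Proof.
elim: N G x => [|N IH] G x.
  by rewrite (_ : (fun _ => _) = cst (G (fun=> x)))//; apply/funext => f; rewrite freeze0.
rewrite (_ : (fun _ => _) = (fun f => (fun z g => G (pcons x (freeze N (embedded a z g))))
    (exit_point a x f) (after_exit a x f))); last by apply/funext => f; rewrite freezeS.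
exact: (measurable_restart a x (fun z => IH (fun s => G (pcons x s)) z)).
Qed.

(** Finitely many discrete variables jointly take countably many values, so every
    function G of them is measurable. *)
Lemma measurable_discrete d (T : measurableType d) d' (T' : measurableType d')
    (V : countType) N (u : nat -> T -> V) (G : (nat -> V) -> T') :
  (forall k v, measurable [set w | u k w = v]) ->
  measurable_fun setT (fun w => G (freeze N (fun k => u k w))).
Proof.
move=> mu; elim: N u G mu => [|N IH] u G mu.
  move=> _ B mB; rewrite setTI.
  rewrite (_ : _ @^-1` _ = \bigcup_n [set w | [/\ unpickle n = Some (u 0%N w) & B (G (fun=> u 0%N w))]]).
    apply: bigcupT_measurable => n; case: (unpickle n) => [v|]; last first.
      by rewrite (_ : [set _ | _] = set0)//; apply/seteqP; split => w //= -[].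
    have [BG|BG] := pselect (B (G (fun=> v))).
      rewrite (_ : [set _ | _] = [set w | u 0%N w = v]); first exact: mu.
      by apply/seteqP; split => w /=; [move=> [[->]] | move=> ->].
    rewrite (_ : [set _ | _] = set0)//; apply/seteqP; split => w //= -[[e]].
    by rewrite -e => /BG.
  apply/seteqP; split => w /=; rewrite freeze0.
    by move=> h; exists (pickle (u 0%N w)) => //=; rewrite pickleK.
  by move=> [n _ [_]].
move=> _ B mB; rewrite setTI.
rewrite (_ : _ @^-1` _ = \bigcup_n [set w | unpickle n = Some (u 0%N w) /\
    B ((fun v => G (pcons v (freeze N (fun k => u k.+1 w)))) (u 0%N w))]).
  apply: bigcupT_measurable => n; case: (unpickle n) => [v|]; last first.
    by rewrite (_ : [set _ | _] = set0)//; apply/seteqP; split => w //= -[].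
  rewrite (_ : [set _ | _] = [set w | u 0%N w = v] `&` (setT `&`
     (fun w => G (pcons v (freeze N (fun k => u k.+1 w)))) @^-1` B)).
    apply: measurableI; first exact: mu.
    by apply: (IH (fun k => u k.+1) (fun s => G (pcons v s))) => // k v'; exact: mu.
  apply/seteqP; split => w /=; first by move=> [[->]].
  by move=> [<- [_]].
apply/seteqP; split => w /=; rewrite freezeS.
  by move=> h; exists (pickle (u 0%N w)) => //=; rewrite pickleK.
by move=> [n _ [_]].
Qed.

Lemma chain_front (xi : nat -> R) x k :
  chain a xi x k.+1 = chain a (fun j => xi j.+1) (x + a x * xi 0%N) k.
Proof. by elim: k => //= k IH; rewrite -IH. Qed.

End finite_horizon.

Section law_of_embedded.
Context {R : realType} {d : measure_display} {Omega : measurableType d}.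
Context {I : set R} {l r : \bar R} {F : time R -> set_system Omega}
  {P : R -> probability Omega R} {Y : Omega -> cpath R}
  {m : {measure set R -> \bar R}}.
Hypothesis Yd : general_diffusion I l r F P Y m.
Variables (a : R -> R) (h : R).
Hypothesis aok : @scale_ok _ _ _ I P Y a h.

Lemma integral_embedded N (G : (nat -> R) -> R) x : I x -> (forall s, 0 <= G s) ->
  (\int[P x]_w (G (freeze N (embedded a x (Y w))))%:E = (tree a N G x)%:E)%E.
Proof.
elim: N G x => [|N IH] G x Ix G0 /=.
  by under eq_integral do rewrite freeze0 /=; rewrite integral_prob_cst.
under eq_integral do rewrite freezeS.
pose H z f := (G (pcons x (freeze N (embedded a z f))))%:E.
have mH z : measurable_fun setT (H z : wpath R -> \bar R).
  by apply/measurable_EFinP; exact: (measurable_embedded_stop a N (fun s => G (pcons x s)) z).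
have H0 z f : (0 <= H z f)%E by rewrite lee_fin.
have [_ Im Ip _] := aok Ix.
transitivity (\int[P x]_w H (exit_point a x (Y w)) (after_exit a x (Y w)))%E; first by [].
rewrite (step_half Yd aok Ix mH H0) /H.
by rewrite (IH (fun s => G (pcons x s)))// (IH (fun s => G (pcons x s)))// EFinD !EFinM.
Qed.

End law_of_embedded.

Section law_of_chain.
Context {R : realType} {d : measure_display} {Omega : measurableType d}.
Variables (Pr : probability Omega R) (xi : nat -> {RV Pr >-> R}).
Hypothesis xi_iid : iid_signs xi.
Variable a : R -> R.

(** The sign variables may take other values on a null event; their heads
    do not, and the chain driven by the heads is a measurable functional. *)
Definition heads k w : bool := xi k w == 1.

Definition sgn_of (b : bool) : R := if b then 1 else -1.

Lemma measurable_heads k b : measurable [set w | heads k w = b].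
Proof.
have m1 : measurable (xi k @^-1` [set 1]).
  by rewrite -[X in measurable X]setTI; apply: measurable_funPT.
case: b.
  rewrite (_ : [set _ | _] = xi k @^-1` [set 1])//.
  by apply/seteqP; split => w /= /eqP.
rewrite (_ : [set _ | _] = ~` (xi k @^-1` [set 1])); first exact: measurableC.
apply/seteqP; split => w /=; first by move=> /negbT/eqP.
by move=> /eqP/negbTE.
Qed.

Definition cyl_heads (s : seq bool) : set Omega :=
  [set w | forall k, (k < size s)%N -> heads k w = nth false s k].

Lemma measurable_cyl_heads s : measurable (cyl_heads s).
Proof.
rewrite (_ : cyl_heads s = \bigcap_k
    [set w | (k < size s)%N -> heads k w = nth false s k]); last first.
  by apply/seteqP; split => w H k; [move=> _; exact: H | exact: (H k Logic.I)].
apply: bigcapT_measurable => k; have [ks|ks] := ltnP k (size s).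
  rewrite (_ : [set _ | _] = [set w | heads k w = nth false s k]); first exact: measurable_heads.
  by apply/seteqP; split => w /=; [exact | move=> + _].
by rewrite (_ : [set _ | _] = setT)//; apply/seteqP; split.
Qed.

Lemma prob_heads k b : Pr [set w | heads k w = b] = (2^-1)%:E.
Proof.
have [h1 _] := xi_iid.1 k; case: b.
  rewrite -h1; congr (Pr _); apply/seteqP; split => w /= /eqP//.
have mh := measurable_heads k true.
have -> : [set w | heads k w = false] = ~` [set w | heads k w = true].
  by apply/seteqP; split => w /=; [move=> -> | move=> /negP/negbTE].
have := @probability_setC _ _ _ Pr _ mh => ->.
rewrite (_ : Pr _ = (2^-1)%:E) -?EFinB; first by congr EFin; lra.
rewrite -h1; congr (Pr _); apply/seteqP; split => w /= /eqP//.
Qed.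

Lemma prob_cyl_heads s : Pr (cyl_heads s) = (2^-1 ^+ size s)%:E.
Proof.
pose B k : set R := if nth false s k then [set 1] else ~` [set 1].
have mB k : measurable (B k) by rewrite /B; case: ifP => _ //; exact: measurableC.
have xB k : xi k @^-1` B k = [set w | heads k w = nth false s k].
  rewrite /B /heads; case: (nth false s k); apply/seteqP; split => w /=.
  - by move=> ->; rewrite eqxx.
  - by move=> /eqP.
  - by move=> /eqP/negbTE.
  - by move=> /negbT/eqP.
have := xi_iid.2 (iota 0 (size s)) B (iota_uniq _ _) mB.
rewrite (_ : \bigcap_(k in _) _ = cyl_heads s); last first.
  apply/seteqP; split => w H k ks.
    have : (xi k @^-1` B k) w by apply: H; rewrite /= mem_iota.
    by rewrite xB.
  by rewrite xB /=; apply: H; move: ks; rewrite /= mem_iota.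
move=> ->; under eq_bigr do rewrite xB prob_heads.
rewrite big_const_seq count_predT size_iota.
elim: (size s) => //= n ->; by rewrite exprS EFinM.
Qed.

Lemma cyl_heads_split s : cyl_heads s = cyl_heads (rcons s true) `|` cyl_heads (rcons s false).
Proof.
apply/seteqP; split => w.
  move=> H; case e : (heads (size s) w); [left|right] => k;
  rewrite size_rcons ltnS leq_eqVlt nth_rcons => /predU1P[->|ks]; rewrite ?ltnn ?eqxx ?e// ks;
  exact: H.
have sub b : cyl_heads (rcons s b) w -> cyl_heads s w.
  move=> H k ks; have := H k; rewrite size_rcons ltnS nth_rcons ks; apply; exact: ltnW.
by move=> [/sub|/sub].
Qed.

Lemma cyl_heads_last s b w : cyl_heads (rcons s b) w -> heads (size s) w = b.
Proof. by move=> /(_ (size s)); rewrite size_rcons nth_rcons ltnn eqxx; apply. Qed.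

Definition chain_heads x w : nat -> R := chain a (fun k => sgn_of (heads k w)) x.

Lemma measurable_chain_stop (j : nat) N (G : (nat -> R) -> R) x :
  measurable_fun setT (fun w =>
    G (freeze N (chain a (fun k => sgn_of (heads (j + k) w)) x))).
Proof.
have E (s : nat -> bool) : freeze N (chain a (fun k => sgn_of (s k)) x) =
    freeze N (chain a (fun k => sgn_of (freeze N s k)) x).
  apply/funext => k; rewrite /freeze; have : (minn k N <= N)%N by exact: geq_minr.
  elim: (minn k N) => //= i IH iN; rewrite IH ?(ltnW iN)//.
  by rewrite (minn_idPl (ltnW iN)).
under eq_fun do rewrite E.
apply: (measurable_discrete (V := bool) N (u := fun k w => heads (j + k) w)
  (fun s => G (freeze N (chain a (fun k => sgn_of (s k)) x)))) => k v.
exact: measurable_heads.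
Qed.

(** The induction is on the number of steps to come, given the outcome s of the
    tosses so far: conditioning on the next toss splits [cyl_heads s] in two halves
    of equal probability. *)
Lemma integral_chain N (G : (nat -> R) -> R) x (s : seq bool) : (forall t, 0 <= G t) ->
  (\int[Pr]_(w in cyl_heads s)
     (G (freeze N (chain a (fun k => sgn_of (heads (size s + k) w)) x)))%:E =
   (2^-1 ^+ size s * tree a N G x)%:E)%E.
Proof.
elim: N G x s => [|N IH] G x s G0 /=.
  under eq_integral do rewrite freeze0 /=.
  rewrite integral_cst; last exact: measurable_cyl_heads.
  rewrite [X in (_ * X)%E](_ : _ = (2^-1 ^+ size s)%:E); last exact: prob_cyl_heads.
  by rewrite -EFinM mulrC.
rewrite cyl_heads_split ge0_integral_setU; first last.
- apply/disj_setPS => w [/cyl_heads_last + /cyl_heads_last] => -> //.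
- by move=> w _; rewrite lee_fin.
- by apply/measurable_EFinP; apply: measurable_funTS; exact: measurable_chain_stop.
- exact: measurable_cyl_heads.
- exact: measurable_cyl_heads.
have step b : (\int[Pr]_(w in cyl_heads (rcons s b))
     (G (freeze N.+1 (chain a (fun k => sgn_of (heads (size s + k) w)) x)))%:E =
   (2^-1 ^+ (size s).+1 * tree a N (fun t => G (pcons x t)) (x + a x * sgn_of b))%:E)%E.
  rewrite -(size_rcons s b) -(IH (fun t => G (pcons x t)))//.
  apply: eq_integral => w; rewrite inE => wb; congr (G _)%:E.
  rewrite freezeS /=; congr pcons; congr (freeze N _); apply/funext => k.
  rewrite [LHS](chain_front a (fun k => sgn_of (heads (size s + k) w))) addn0 (cyl_heads_last wb).
  congr (chain a _ _ k); apply/funext => i.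
  by rewrite size_rcons addSnnS.
rewrite !step -EFinD; congr EFin; rewrite /sgn_of mulr1 mulrN1 exprS; ring.
Qed.

Lemma integral_chain_heads N (G : (nat -> R) -> R) x : (forall t, 0 <= G t) ->
  (\int[Pr]_w (G (freeze N (chain_heads x w)))%:E = (tree a N G x)%:E)%E.
Proof.
move=> G0; have := @integral_chain N G x [::] G0.
rewrite expr0 mul1r (_ : cyl_heads [::] = setT)//.
by apply/seteqP; split.
Qed.

Lemma signs_ae : Pr (~` [set w | forall k, xi k w = sgn_of (heads k w)]) = 0%E /\
  measurable [set w | forall k, xi k w = sgn_of (heads k w)].
Proof.
pose S k := [set w | xi k w = sgn_of (heads k w)].
have m1 k (v : R) : measurable (xi k @^-1` [set v]).
  by rewrite -[X in measurable X]setTI; apply: measurable_funPT.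
have SE k : S k = xi k @^-1` [set 1] `|` xi k @^-1` [set -1].
  apply/seteqP; split => w; rewrite /S /heads /sgn_of /=.
    by case: eqP => [->|]; [left|right].
  move=> [->|->]; first by rewrite eqxx.
  by case: eqP => // ->.
have mS k : measurable (S k) by rewrite SE; exact: measurableU.
have S0 k : Pr (~` S k) = 0%E.
  have := @probability_setC _ _ _ Pr _ (mS k) => ->.
  have [p1 p2] := xi_iid.1 k.
  have -> : Pr (S k) = 1%E; last by rewrite subee.
  rewrite SE measureU//; last first.
    by apply/seteqP; split => w //= -[-> e]; clear p1 p2; exfalso; lra.
  rewrite [X in (X + _)%E](_ : _ = (2^-1)%:E)// [X in (_ + X)%E](_ : _ = (2^-1)%:E)//.
  by rewrite -EFinD; congr EFin; lra.
have E : [set w | forall k, xi k w = sgn_of (heads k w)] = \bigcap_k S k.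
  by apply/seteqP; split => w H k; [move=> _; exact: H | exact: (H k Logic.I)].
rewrite E; split; last exact: bigcapT_measurable.
rewrite setC_bigcap.
apply/eqP; rewrite -measure_le0.
have mC k : measurable (~` S k) by exact: measurableC.
have mUC : measurable (\bigcup_k ~` S k) by exact: bigcupT_measurable.
have := @measure_sigma_subadditive _ _ _ Pr _ (fun k => ~` S k) mC mUC (@subset_refl _ _).
by rewrite eseries0// => k _ _; exact: S0.
Qed.

End law_of_chain.

(** * Functionals of paths *)

Section cpath_cvg.
Context {R : realType}.

(** A compact set of times is contained in some [0, T]. *)
Lemma cpath_cvgP (g : nat -> cpath R) (f : cpath R) :
  (forall T e : R, 0 < e -> exists N, forall n, (N <= n)%N ->
    forall t, 0 <= t <= T -> `|path_at (g n) t - path_at f t| <= e) ->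
  g @ \oo --> f.
Proof.
move=> H B; rewrite nbhsE => -[U [[C oC CU] Uf] UB].
have Cf : C ((f : continuousType (time R) R) : {family compact, time R -> R}).
  by move: Uf; rewrite -CU.
have c : ((fun n => ((g n : continuousType (time R) R) : {family compact, time R -> R})) @ \oo
    --> ((f : continuousType (time R) R) : {family compact, time R -> R})).
  apply/fam_cvgP => A cA.
  have [T HT] : exists T : R, forall t : time R, A t -> t%:num <= T.
    have c1 : compact ((fun t : time R => t%:num : R) @` A).
      apply: continuous_compact => //; apply: continuous_subspaceT.
      exact: time_num_continuous.
    have [M [_ HM]] := compact_bounded c1.
    exists (M + 1) => t At; apply: le_trans (ler_norm _) _.
    by apply: (HM (M + 1)); [rewrite ltrDl | exists t].
  move=> V /uniform_nbhs[E [entE EV]].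
  have [e /= e0 He] : exists2 e : R, 0 < e & forall x y : R, `|x - y| < e -> E (x, y).
    move: entE; rewrite -entourage_ballE => -[e /= e0 He].
    by exists e => // x y xy; apply: He; exact: xy.
  have [N HN] := H T (e / 2) (ltac:(by rewrite divr_gt0)).
  exists N => // n /= Nn; apply: EV => t At /=.
  apply: He; rewrite distrC.
  have := HN n Nn t%:num; rewrite ge0 HT// => /(_ isT).
  rewrite -!evE_at => h; apply: le_lt_trans h _; lra.
have := c C; rewrite nbhsE => /(_ _) [].
  by exists C.
move=> N _ HN; exists N => // n Nn; apply: UB; rewrite -CU.
exact: (HN n Nn).
Qed.

Definition spath (s : nat -> R) (h : R) : cpath R := mkpath (@interp_continuous R s h).

Lemma at_spath s h t : 0 <= t -> path_at (spath s h) t = interp s h t.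
Proof. by move=> t0; rewrite /path_at /spath evE /= ger0_norm. Qed.

Lemma spath_stop_cvg (s : nat -> R) h : 0 < h ->
  (fun N => spath (freeze N s) h) @ \oo --> spath s h.
Proof.
move=> h0; apply: cpath_cvgP => T e e0.
exists (Num.truncn (T / h)).+1 => N TN t /andP[t0 tT].
rewrite !at_spath//.
have tN : (Num.truncn (t / h) < N)%N.
  apply: leq_trans TN; rewrite ltnS; apply: le_truncn.
  by rewrite ler_pM2r ?invr_gt0.
rewrite /interp /freeze (minn_idPl tN) (minn_idPl (ltnW tN)) subrr normr0.
exact: ltW.
Qed.

(** A path is the limit of interpolations of countably valued, finitely many
    coordinates. This makes continuous functionals measurable ([measurable_phi])
    without identifying the Borel sigma-algebra of the space of paths. *)
Lemma round_cvg (f : cpath R) :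
  (fun n : nat => spath (freeze (n.+1 ^ 2) (fun k =>
     (Num.floor (path_at f (k%:R / n.+1%:R) * n.+1%:R))%:~R / n.+1%:R)) n.+1%:R^-1) @ \oo --> f.
Proof.
apply: cpath_cvgP => T e e0.
have e2 : 0 < e / 2 by rewrite divr_gt0.
have [p fm] := mod_ok_ex (`|T| + 2) f e2; have {}fm := mod_okP fm.
have [N1 _ /(_ _ (leqnn N1)) HN1] := @near_infty_natSinv_lt R (PosNum e2).
have {}HN1 : N1.+1%:R^-1 < e / 2 := HN1.
pose N := maxn (maxn N1 p.+1) (Num.truncn `|T|).+2.
exists N => n Nn t /andP[t0 tT].
have [nN1 np nT] : [/\ (N1 <= n)%N, (p < n)%N & ((Num.truncn `|T|).+2 <= n)%N].
  move: Nn; rewrite !geq_max => /andP[/andP[h1 h2] h3]; split=> //.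
set v := n.+1%:R^-1; have v0 : 0 < v by rewrite invr_gt0.
have ve : v <= e / 2.
  by apply: le_trans (ltW HN1); rewrite lef_pV2 ?posrE// ler_nat.
have v1 : v <= 1 by rewrite invf_le1// ler1n.
have vp : v < p.+1%:R^-1 by rewrite ltf_pV2 ?posrE// ltr_nat ltnS.
have TT : T <= `|T| by exact: ler_norm.
have nv : n.+1%:R = v^-1 by rewrite invrK.
rewrite at_spath// (_ : e = e / 2 + e / 2); last by lra.
apply: interp_dist => // k kt.
  have kn : (k <= n.+1 ^ 2)%N.
    have : `|T| < n%:R - 1.
      apply: lt_le_trans (truncnS_gt _) _; rewrite lerBrDr natr1 ler_nat//.
    move=> Tn; rewrite -(ler_nat R) -(ler_pM2r v0).
    apply: (le_trans kt); rewrite expnS expn1 natrM -mulrA nv mulVf ?gt_eqF// mulr1.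
    by rewrite -nv -natr1; lra.
  rewrite /freeze (minn_idPl kn) -/v.
  have := floor_itv (path_at f (k%:R / n.+1%:R) * n.+1%:R).
  move: (Num.floor _) => z; rewrite -/v => /andP[z1 z2].
  have vv : n.+1%:R * v = 1 by rewrite /v divff.
  move: z1 z2; rewrite -(ler_pM2r v0) -(ltr_pM2r v0) -mulrA vv mulr1 intrD mulrDl mul1r => z1 z2.
  by apply: le_trans ve; rewrite ler_norml; apply/andP; split; lra.
have T20 : 0 <= `|T| by [].
apply: fm; last by apply: le_lt_trans vp.
- rewrite mulr_ge0 ?(ltW v0)//=; move: kt; rewrite ler_norml => /andP[_ ?]; lra.
- by rewrite t0/=; lra.
Qed.

End cpath_cvg.

Section observable.
Context {R : realType}.
Variables (phi : cpath R -> R).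
Hypothesis cphi : continuous phi.

Lemma phi_cvg (g : nat -> cpath R) f : g @ \oo --> f -> (fun n => phi (g n)) @ \oo --> phi f.
Proof. by move=> gf; apply: (@cvg_comp _ _ _ g phi _ _ _ gf); exact: cphi. Qed.

Lemma measurable_phi d (T : measurableType d) (Z : T -> cpath R) :
  (forall t, 0 <= t -> measurable_fun setT (fun w => path_at (Z w) t)) ->
  measurable_fun setT (fun w => phi (Z w)).
Proof.
move=> mZ.
pose u n k w : int := Num.floor (path_at (Z w) (k%:R / n.+1%:R) * n.+1%:R).
apply: (@measurable_fun_cvg _ _ _ setT (fun n w => phi (spath (freeze (n.+1 ^ 2)
    (fun k => (u n k w)%:~R / n.+1%:R)) n.+1%:R^-1))); last first.
  by move=> w _; apply: phi_cvg; exact: round_cvg.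
move=> n.
apply: (measurable_discrete (V := int) (n.+1 ^ 2) (u := u n)
  (fun s => phi (spath (fun k => (s k)%:~R / n.+1%:R) n.+1%:R^-1))) => k z.
pose f w := path_at (Z w) (k%:R / n.+1%:R) * n.+1%:R.
have mf : measurable_fun setT f.
  by apply: measurable_funM => //; apply: mZ; rewrite divr_ge0.
rewrite (_ : [set _ | _] = (setT `&` [set w | z%:~R <= f w]) `&`
  (setT `&` [set w | f w < (z + 1)%:~R])).
  by apply: measurableI; [exact: measurable_fun_ler | exact: measurable_fun_ltr].
apply/seteqP; split => w /=.
  by move=> <-; have /andP[] := floor_itv (f w).
by move=> [[_ h1] [_ h2]]; apply: floor_def; rewrite h1.
Qed.

End observable.

(** * Convergence of expectations *)

Import HBNNSimple.

Lemma sup_sintegral_null_le d (T : measurableType d) (R : realType)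
    (mu : {measure set T -> \bar R}) (S : set T) (f g : T -> \bar R) :
  measurable S -> mu (~` S) = 0%E ->
  (forall w, 0 <= g w)%E -> (forall w, S w -> f w = g w) ->
  (ereal_sup [set sintegral mu h | h in
     [set h : {nnsfun T >-> R} | forall x, ((h x)%:E <= f x)%E]] <=
   ereal_sup [set sintegral mu h | h in
     [set h : {nnsfun T >-> R} | forall x, ((h x)%:E <= g x)%E]])%E.
Proof.
move=> mS muS g0 fg; apply: ge_ereal_sup => _ [h /= hf <-].
have int_S (k : {nnsfun T >-> R}) : sintegral mu k = (\int[mu]_(x in S) (k x)%:E)%E.
  have := integral_nnsfun mu measurableT k; rewrite patch_setT => <-.
  rewrite (@ge0_negligible_integral _ _ _ mu setT (~` S))//.
  - by rewrite setTD setCK.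
  - exact: measurableC.
  - by apply/measurable_EFinP.
  - by move=> x _; rewrite lee_fin; exact: fun_ge0.
apply: le_ereal_sup_tmp; exists (sintegral mu (proj_nnsfun h mS)).
  exists (proj_nnsfun h mS) => //.
  move=> w /=; rewrite mindicE.
  have [wS|wS] := boolP (w \in S); last by rewrite mulr0.
  by rewrite mulr1 -fg ?hf//; rewrite inE in wS.
rewrite !int_S le_eqVlt; apply/orP; left; apply/eqP; apply: eq_integral => w wS.
by rewrite /= mindicE wS mulr1.
Qed.

(** The integral is defined as a supremum over simple functions below the integrand,
    and a simple function may be set to 0 on a null set. The functions f and g are
    arbitrary: off the event that all signs are 1 or -1, the chain is driven by
    arbitrary numbers through an arbitrary scale factor, and its functionals may fail
    to be measurable. *)
Lemma eq_integral_null d (T : measurableType d) (R : realType) (mu : {measure set T -> \bar R})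
    (S : set T) (f g : T -> \bar R) : measurable S -> mu (~` S) = 0%E ->
  (forall w, S w -> f w = g w) -> (\int[mu]_w f w = \int[mu]_w g w)%E.
Proof.
move=> mS muS fg; rewrite /integral !patch_setT; congr (_ - _)%E; apply/eqP; rewrite eq_le.
  by apply/andP; split; apply: (sup_sintegral_null_le mS muS) => // w Sw;
    rewrite !funeposE fg.
by apply/andP; split; apply: (sup_sintegral_null_le mS muS) => // w Sw;
  rewrite !funenegE fg.
Qed.

Section bounded.
Context {d : measure_display} {T : measurableType d} {R : realType} (mu : probability T R).

Lemma bounded_integrable (f : T -> R) (M : R) : measurable_fun setT f ->
  (forall w, `|f w| <= M) -> mu.-integrable setT (EFin \o f).
Proof.
move=> mf fM; apply/integrableP; split; first exact/measurable_EFinP.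
apply: (@le_lt_trans _ _ (\int[mu]_w M%:E)%E); last by rewrite integral_prob_cst ltry.
apply: ge0_le_integral => //.
- by apply: measurableT_comp => //; exact/measurable_EFinP.
- by move=> w _; rewrite /= lee_fin.
Qed.

Lemma bounded_cvg (f_ : nat -> T -> R) (f : T -> R) (M : R) :
  (forall n, measurable_fun setT (f_ n)) -> measurable_fun setT f ->
  {ae mu, forall w, (fun n => f_ n w) @ \oo --> f w} ->
  (forall n w, `|f_ n w| <= M) ->
  (fun n => \int[mu]_w (f_ n w)%:E)%E @ \oo --> (\int[mu]_w (f w)%:E)%E.
Proof.
move=> mf_ mf cf fM.
have iM : mu.-integrable setT (EFin \o cst M).
  by apply: (@bounded_integrable _ `|M|) => // w.
have [] := @dominated_convergence _ _ _ mu setT measurableT (fun n w => (f_ n w)%:E)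
  (fun w => (f w)%:E) (EFin \o cst M) _ _ _ iM _ => //.
- by move=> n; exact/measurable_EFinP.
- exact/measurable_EFinP.
- apply: filterS cf => w cw _; apply: cvg_EFin; last exact: cw.
  by apply: nearW.
- by apply: aeW => w n _; rewrite /= lee_fin.
Qed.

(** Reduces bounded functions to nonnegative ones. *)
Lemma bounded_shift (f : T -> R) (M : R) : measurable_fun setT f ->
  (forall w, `|f w| <= M) -> (\int[mu]_w (f w)%:E = \int[mu]_w (f w + M)%:E - M%:E)%E.
Proof.
move=> mf fM.
have iM : mu.-integrable setT (EFin \o cst M).
  by apply: (@bounded_integrable _ `|M|) => // w.
have iF := bounded_integrable mf fM.
under [in RHS]eq_integral do rewrite EFinD.
rewrite (@integralD _ _ _ mu setT measurableT (EFin \o f) (EFin \o cst M))//.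
by rewrite (integral_prob_cst mu M%:E) addeK.
Qed.

End bounded.

Section expectation.
Context {R : realType} {d d' : measure_display} {Omega : measurableType d}
  {Omega' : measurableType d'}.
Context {I : set R} {l r : \bar R} {F : time R -> set_system Omega}
  {P : R -> probability Omega R} {Y : Omega -> cpath R}
  {m : {measure set R -> \bar R}}.
Hypothesis Yd : general_diffusion I l r F P Y m.
Variables (Pr : probability Omega' R) (xi : nat -> {RV Pr >-> R}).
Hypothesis xi_iid : iid_signs xi.
Variables (phi : cpath R -> R) (M : R).
Hypotheses (cphi : continuous phi) (phiM : forall f, `|phi f| <= M).

Section fixed_step.
Variables (a : R -> R) (h : R) (y : R).
Hypotheses (h0 : 0 < h) (aok : @scale_ok _ _ _ I P Y a h) (Iy : I y).

Let fs N (s : nat -> R) := phi (spath (freeze N s) h).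

Lemma phi_stop_cvg s : (fun N => fs N s) @ \oo --> phi (spath s h).
Proof. by have := phi_cvg cphi (spath_stop_cvg (s := s) h0); exact. Qed.

Lemma measurable_phi_embedded :
  measurable_fun setT (fun w => phi (spath (embedded a y (Y w)) h)).
Proof.
apply: (@measurable_fun_cvg _ _ _ setT (fun N w => fs N (embedded a y (Y w)))).
  by move=> N; exact: (measurable_comp_Y Yd (measurable_embedded_stop a N (fun s => phi (spath s h)) y)).
by move=> w _; exact: phi_stop_cvg.
Qed.

Lemma measurable_phi_chain :
  measurable_fun setT (fun w => phi (spath (chain_heads xi a y w) h)).
Proof.
apply: (@measurable_fun_cvg _ _ _ setT (fun N w => fs N (chain_heads xi a y w))).
  move=> N; exact: (measurable_chain_stop xi a 0 N (fun s => phi (spath s h)) y).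
by move=> w _; exact: phi_stop_cvg.
Qed.

(** The laws agree on finitely many steps; the chain frozen after N steps agrees with
    the full one on longer and longer time intervals, and dominated convergence
    passes to the limit in N. *)
Lemma expectation_embedded :
  ('E_Pr[fun w => phi (chain_path a (xi ^~ w) h y)] =
   'E_(P y)[fun w => phi (spath (embedded a y (Y w)) h)])%E.
Proof.
rewrite !unlock; have [Pr0 mS] := signs_ae xi_iid.
transitivity (\int[Pr]_w (phi (spath (chain_heads xi a y w) h))%:E)%E.
  apply: (eq_integral_null mS Pr0) => w ws; congr (phi _)%:E.
  by have -> : xi ^~ w = (fun k => sgn_of (heads xi k w)) by apply/funext => k; exact: ws.
have M0 s : 0 <= phi (spath s h) + M.
  by have := phiM (spath s h); rewrite ler_norml => /andP[? _]; lra.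
rewrite (bounded_shift Pr measurable_phi_chain (fun w => phiM _)).
rewrite (bounded_shift (P y) measurable_phi_embedded (fun w => phiM _)).
congr (_ - _)%E.
have M2 s : `|phi (spath s h) + M| <= `|M| + `|M|.
  apply: le_trans (ler_normD _ _) _; rewrite lerD2r.
  by apply: le_trans (phiM _) _; exact: ler_norm.
have c1 : (fun N => \int[Pr]_w (fs N (chain_heads xi a y w) + M)%:E)%E @ \oo -->
    (\int[Pr]_w (phi (spath (chain_heads xi a y w) h) + M)%:E)%E.
  apply: (bounded_cvg (M := `|M| + `|M|)) => [N|| |N w]; last exact: M2.
  - apply: measurable_funD => //.
    exact: (measurable_chain_stop xi a 0 N (fun s => phi (spath s h)) y).
  - by apply: measurable_funD => //; exact: measurable_phi_chain.
  - by apply: aeW => w; apply: cvgD; [exact: phi_stop_cvg | exact: cvg_cst].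
have c2 : (fun N => \int[P y]_w (fs N (embedded a y (Y w)) + M)%:E)%E @ \oo -->
    (\int[P y]_w (phi (spath (embedded a y (Y w)) h) + M)%:E)%E.
  apply: (bounded_cvg (M := `|M| + `|M|)) => [N|| |N w]; last exact: M2.
  - apply: measurable_funD => //.
    exact: (measurable_comp_Y Yd (measurable_embedded_stop a N (fun s => phi (spath s h)) y)).
  - by apply: measurable_funD => //; exact: measurable_phi_embedded.
  - by apply: aeW => w; apply: cvgD; [exact: phi_stop_cvg | exact: cvg_cst].
have e : (fun N => \int[Pr]_w (fs N (chain_heads xi a y w) + M)%:E)%E =
    (fun N => \int[P y]_w (fs N (embedded a y (Y w)) + M)%:E)%E.
  apply/funext => N.
  rewrite (integral_chain_heads xi_iid a N (G := fun s => phi (spath s h) + M))//.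
  by rewrite (integral_embedded Yd aok N (G := fun s => phi (spath s h) + M)).
rewrite e in c1; exact: (cvg_unique _ c1 c2).
Qed.

End fixed_step.

Lemma expectation_fin d0 (T : measurableType d0) (mu : probability T R) (Z : T -> cpath R) :
  measurable_fun setT (fun w => phi (Z w)) -> 'E_mu[fun w => phi (Z w)]%E \is a fin_num.
Proof.
move=> mZ; rewrite unlock; have := bounded_integrable mu mZ (fun w => phiM _).
exact: integrable_fin_num.
Qed.

(** Otherwise there is a sequence of step sizes along which the expectations stay
    apart and the exceptional events of the coupling have summable probabilities.
    By Borel-Cantelli the chains converge to Y almost surely along it, which
    contradicts dominated convergence. *)
Lemma expectation_cvg (a : R -> R -> R) y : I y ->
  (forall h, 0 < h -> @scale_ok _ _ _ I P Y (a h) h) ->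
  (forall T e eta : R, 0 < T -> 0 < e -> 0 < eta ->
    exists2 h0, 0 < h0 & forall h, 0 < h < h0 ->
    exists A, [/\ measurable A, (P y A <= eta%:E)%E &
      forall w, ~ A w -> forall t, 0 <= t <= T ->
        `|interp (embedded (a h) y (Y w)) h t - path_at (Y w) t| <= e]) ->
  forall e : R, 0 < e -> exists2 h0, 0 < h0 & forall h, 0 < h < h0 ->
    `|fine ('E_(P y)[fun w => phi (Y w)])%E -
      fine ('E_(P y)[fun w => phi (spath (embedded (a h) y (Y w)) h)])%E| <= e.
Proof.
move=> Iy aok close e e0; apply: contrapT => far.
have mphiY : measurable_fun setT (fun w => phi (Y w)).
  by apply: (measurable_phi cphi) => t _; exact: (measurable_at_Y Yd).
have /choice[p Hp] : forall n : nat, exists p : R * set Omega,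
    [/\ 0 < p.1, measurable p.2, (P y p.2 <= (1 / (2 ^ (n + 1))%:R)%:E)%E,
      (forall w, ~ p.2 w -> forall t, 0 <= t <= n%:R ->
        `|interp (embedded (a p.1) y (Y w)) p.1 t - path_at (Y w) t| <= n.+1%:R^-1) &
      e < `|fine ('E_(P y)[fun w => phi (Y w)])%E -
        fine ('E_(P y)[fun w => phi (spath (embedded (a p.1) y (Y w)) p.1)])%E|].
  move=> n.
  have T0 : 0 < n.+1%:R :> R by [].
  have n0 : 0 < n.+1%:R^-1 :> R by [].
  have t0 : 0 < 1 / (2 ^ (n + 1))%:R :> R by rewrite divr_gt0// ltr0n expn_gt0.
  have [h0 h00 Hh] := close _ _ _ T0 n0 t0.
  have [h [hh hfar]] : exists h, 0 < h < h0 /\ e < `|fine ('E_(P y)[fun w => phi (Y w)])%E -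
        fine ('E_(P y)[fun w => phi (spath (embedded (a h) y (Y w)) h)])%E|.
    apply: contrapT => nh; apply: far; exists h0 => // h hh.
    by rewrite leNgt; apply/negP => lt; apply: nh; exists h.
  have [A [mA PA HA]] := Hh h hh.
  exists (h, A); split => //=; first by case/andP: hh.
  move=> w wA t /andP[t1 t2]; apply: HA => //; rewrite t1 (le_trans t2)// ler_nat//.
pose h n := (p n).1; pose A n := (p n).2.
have mA n : measurable (A n) by case: (Hp n).
have PA : P y (lim_sup_set A) = 0%E.
  apply: lim_sup_set_cvg0 => //.
  apply: (@le_lt_trans _ _ (\big[+%E/0%R]_(0 <= n <oo) (1 / (2 ^ (n + 1))%:R)%:E)%E).
    by apply: lee_nneseries => n _ //; case: (Hp n).
  have := @cvg_geometric_eseries_half R 1 0; rewrite expr0 divr1.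
  by move=> /cvg_lim -> //; exact: ltry.
have mlim : measurable (lim_sup_set A).
  apply: bigcapT_measurable => n; apply: bigcup_measurable => k _; exact: mA.
have good w : ~ lim_sup_set A w ->
    (fun n => spath (embedded (a (h n)) y (Y w)) (h n)) @ \oo --> Y w.
  move=> nw; apply: cpath_cvgP => T u u0.
  have [N HN] : exists N, forall n, (N <= n)%N -> ~ A n w.
    apply: contrapT => nN; apply: nw => N _.
    have [[n [Nn An]]|nA] := pselect (exists n, (N <= n)%N /\ A n w); first by exists n.
    by exfalso; apply: nN; exists N => n Nn An; apply: nA; exists n.
  have [N1 _ /(_ _ (leqnn N1)) HN1] := @near_infty_natSinv_lt R (PosNum u0).
  have {}HN1 : N1.+1%:R^-1 < u := HN1.
  exists (maxn (maxn N N1) (Num.truncn `|T|).+1) => n.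
  rewrite !geq_max => /andP[/andP[nN nN1] nT] t /andP[t0 tT].
  rewrite at_spath//; have [_ _ _ H _] := Hp n.
  apply: (le_trans (H w (HN n nN) t _)).
    rewrite t0 (le_trans tT)// (le_trans (ler_norm _))// ltW//.
    by apply: lt_le_trans (truncnS_gt _) _; rewrite ler_nat.
  by apply: le_trans (ltW HN1); rewrite lef_pV2 ?posrE// ler_nat ltnS.
have mh n : measurable_fun setT (fun w => phi (spath (embedded (a (h n)) y (Y w)) (h n))).
  by apply: measurable_phi_embedded; case: (Hp n).
have c : (fun n => 'E_(P y)[fun w => phi (spath (embedded (a (h n)) y (Y w)) (h n))])%E @ \oo -->
    ('E_(P y)[fun w => phi (Y w)])%E.
  have E (Z : Omega -> cpath R) :
      ('E_(P y)[fun w => phi (Z w)] = \int[P y]_w (phi (Z w))%:E)%E by rewrite unlock.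
  rewrite E; under eq_fun do rewrite E.
  apply: (bounded_cvg (M := M)) => //.
  exists (lim_sup_set A); split => // w /= nc; apply: contrapT => nw; apply: nc.
  by apply: (phi_cvg cphi); exact: good.
have /fine_cvgP[_ c1] : (fun n => 'E_(P y)[fun w => phi (spath (embedded (a (h n)) y (Y w)) (h n))])%E
    @ \oo --> (fine ('E_(P y)[fun w => phi (Y w)])%E)%:E.
  by rewrite fineK//; exact: (expectation_fin (P y) mphiY).
have /cvgrPdist_lt/(_ e e0)[n _ /(_ n (leqnn n)) /= lt] := c1.
by have [_ _ _ _ /(lt_trans lt)] := Hp n; rewrite ltxx.
Qed.

End expectation.

(** * Exhaustion of the interior and conclusion *)

Section exhaustion.
Context {R : realType} (l r : \bar R).

Definition lower_cut n : R := if l is l'%:E then l' + n.+1%:R^-1 else - n%:R.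
Definition upper_cut n : R := if r is r'%:E then r' - n.+1%:R^-1 else n%:R.

Lemma cuts_mono n k : (n <= k)%N ->
  lower_cut k <= lower_cut n /\ upper_cut n <= upper_cut k.
Proof.
move=> nk; have v : k.+1%:R^-1 <= n.+1%:R^-1 :> R by rewrite lef_pV2 ?posrE// ler_nat ltnS.
have v' : n%:R <= k%:R :> R by rewrite ler_nat.
rewrite /lower_cut /upper_cut; split.
  by case: l => [l'| |]; rewrite ?lerD2l// lerN2.
by case: r => [r'| |]; rewrite ?lerD2l ?lerN2.
Qed.

Lemma cuts_in n : (l < r -> l < (lower_cut n)%:E /\ (upper_cut n)%:E < r)%E.
Proof.
rewrite /lower_cut /upper_cut; case: l => [l'| |]; case: r => [r'| |] //= _;
  by rewrite ?lte_fin ?ltrDl ?gtrBl ?invr_gt0 ?ltr0n ?ltNyr ?ltry.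
Qed.

Lemma cuts_exhaust x : (l < x%:E < r)%E ->
  exists N, forall n, (N <= n)%N -> lower_cut n < x < upper_cut n.
Proof.
have inv (u : R) : 0 < u -> exists N, forall n, (N <= n)%N -> n.+1%:R^-1 < u.
  by move=> u0; have [N _ HN] := @near_infty_natSinv_lt R (PosNum u0); exists N => n /HN.
have nat (u : R) : exists N, forall n, (N <= n)%N -> u < n%:R.
  exists (Num.truncn `|u|).+1 => n Nn; apply: le_lt_trans (ler_norm u) _.
  by apply: lt_le_trans (truncnS_gt _) _; rewrite ler_nat.
move=> /andP[lx xr].
have [N1 H1] : exists N, forall n, (N <= n)%N -> lower_cut n < x.
  rewrite /lower_cut; move: lx; case: l => [l'| |]//.
    rewrite lte_fin -subr_gt0 => /inv[N HN]; exists N => n /HN; move: (n.+1%:R^-1) => v; lra.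
  by move=> _; have [N HN] := nat (- x); exists N => n /HN; rewrite ltrNl.
have [N2 H2] : exists N, forall n, (N <= n)%N -> x < upper_cut n.
  rewrite /upper_cut; move: xr; case: r => [r'| |]//.
    rewrite lte_fin -subr_gt0 => /inv[N HN]; exists N => n /HN; move: (n.+1%:R^-1) => v; lra.
by exists (maxn N1 N2) => n; rewrite geq_max => /andP[/H1 -> /H2 ->].
Qed.

End exhaustion.

Theorem corollary1p5 (R : realType) (d d' : measure_display)
    (Omega : measurableType d) (Omega' : measurableType d')
    (I : set R) (l r : \bar R)
    (F : time R -> set_system Omega) (P : R -> probability Omega R)
    (Y : Omega -> cpath R) (m : {measure set R -> \bar R})
    (hbar : R) (Pr : probability Omega' R) (xi : nat -> {RV Pr >-> R})
    (Ydiff : general_diffusion I l r F P Y m)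
    (hbar_gt0 : 0 < hbar) (xi_iid : iid_signs xi) (y : R) (Iy : I° y) :
  cvg_in_law (within `]0, hbar[ (nbhs (0 : R)))
    Pr (fun h w => chain_path (emcel I m h) (xi ^~ w) h y)
    (P y) Y.
Proof.
move=> phi cphi [M phiM].
have Iy' : I y := interior_I Iy.
have [lr _ _] := gd_state_space Ydiff.
have aok h : 0 < h -> scale_ok (emcel I m h) h := emcel_scale_ok Ydiff (h := h).
have Hclose := @coupling _ _ _ _ _ _ _ _ _ _ Ydiff (fun h => emcel I m h)
  (lower_cut l) (upper_cut r).
have {}Hclose := Hclose _ (@cuts_mono R l r).
have {}Hclose : forall T e eta : R, 0 < T -> 0 < e -> 0 < eta ->
    exists2 h0, 0 < h0 & forall h, 0 < h < h0 ->
    exists A, [/\ measurable A, (P y A <= eta%:E)%E &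
      forall w, ~ A w -> forall t, 0 <= t <= T ->
        `|interp (embedded (emcel I m h) y (Y w)) h t - path_at (Y w) t| <= e].
  move=> T e eta; apply: Hclose => //.
    by move=> x /(interiorE Ydiff); exact: cuts_exhaust.
  move=> n; have [h1 h2] := cuts_in n lr; exact: (emcel_good Ydiff h1 h2).
have mphiY : measurable_fun setT (fun w => phi (Y w)).
  by apply: (measurable_phi cphi) => t _; exact: (measurable_at_Y Ydiff).
have fY : 'E_(P y)[fun w => phi (Y w)]%E \is a fin_num by exact: (expectation_fin phiM (P y) mphiY).
have law h : 0 < h -> ('E_Pr[fun w => phi (chain_path (emcel I m h) (xi ^~ w) h y)] =
    'E_(P y)[fun w => phi (spath (embedded (emcel I m h) y (Y w)) h)])%E.
  by move=> h0; exact: (expectation_embedded Ydiff xi_iid cphi phiM h0 (aok h h0) Iy').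
have lim := expectation_cvg Ydiff cphi phiM Iy' aok Hclose.
change ('E_Pr[fun w => phi (chain_path (emcel I m h) (xi ^~ w) h y)]%E
   @[h --> within `]0, hbar[ (nbhs (0 : R))] --> 'E_(P y)[fun w => phi (Y w)]%E).
have near0 (u : R) : 0 < u -> \forall h \near within `]0, hbar[ (nbhs (0 : R)), 0 < h < u.
  move=> u0; apply/nbhs_ballP; exists u => // h; rewrite /ball/= sub0r normrN => hu.
  by rewrite in_itv/= => /andP[h0 _]; rewrite h0 /=; apply: le_lt_trans hu; exact: ler_norm.
rewrite -(fineK fY); apply/fine_cvgP; split.
  apply: filterS (near0 1 ltr01) => h /andP[h0 _]; rewrite law//.
  apply: (expectation_fin phiM (P y)).
  exact: (measurable_phi_embedded Ydiff cphi).
apply/cvgrPdist_le => e e0; have [h0 h00 H] := lim e e0.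
apply: filterS (near0 h0 h00) => h hh /=; have /andP[hp _] := hh.
by rewrite law//; exact: H.
Qed.
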